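(* Let $\lambda\Vdash n$ be a strict partition and $m=\lfloor\ell(\lambda)/2\rfloor$. The generators of the Sergeev superalgebra $\mathcal S_n$ act in the normalized basis of the simple module $J^\lambda=\mathcal S_n e_{\mathcal R^\lambda}\mathcal E^\lambda$, determined by the decomposition $J^\lambda=\bigoplus_{\mathrm{sh}(\mathcal T)=\lambda}\mathcal{C}l^{\mathcal T}_{n-m}\,\xi_{\mathcal T}$ (sum over standard unbarred tableaux $\mathcal T$ of shape $\lambda$), by the rule $$s_a\,\xi_{\mathcal T}=\Big(\frac1{\kappa_{a+1}(\mathcal T)-\kappa_a(\mathcal T)}+\frac{c_ac_{a+1}}{\kappa_{a+1}(\mathcal T)+\kappa_a(\mathcal T)}\Big)\xi_{\mathcal T}+\mathcal Y_a(\mathcal T)\,\xi_{s_a\mathcal T}\quad(1\le a\le n-1),$$ $$x_a\,\xi_{\mathcal T}=\kappa_a(\mathcal T)\,\xi_{\mathcal T}\quad(1\le a\le n),$$ where $\xi_{s_a\mathcal T}=0$ if the tableau $s_a\mathcal T$, obtained from $\mathcal T$ by swapping $a$ and $a+1$, is not standard. Moreover, for a given $\mathcal T$ with diagonal entries $d_1<\dots<d_\ell$, the action of $c_{d_2},c_{d_4},\dots,c_{d_{2m}}\in\mathcal{C}l_n$ is determined by $$c_{d_{2a}}\,\xi_{\mathcal T}=i\,c_{d_{2a-1}}\,\xi_{\mathcal T},\qquad a=1,\dots,m.$$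
   Context: All algebras are over $\mathbb C$, $i=\sqrt{-1}$. The Sergeev superalgebra $\mathcal S_n=\mathbb C\mathfrak S_n^-\otimes \mathcal{C}l_n$ is the graded tensor product of: the spin symmetric group algebra $\mathbb C\mathfrak S_n^-$, generated by odd $t_1,\dots,t_{n-1}$ with $t_a^2=1$, $t_at_{a+1}t_a=t_{a+1}t_at_{a+1}$, $t_at_b=-t_bt_a$ for $|a-b|>1$; and the Clifford superalgebra $\mathcal{C}l_n$, generated by odd $c_1,\dots,c_n$ with $c_a^2=-1$, $c_ac_b=-c_bc_a$ for $a\neq b$. In particular $t_ac_b=-c_bt_a$ for all $a,b$. For $k<n$, $\mathcal S_k\subset\mathcal S_n$ is generated by $t_1,\dots,t_{k-1},c_1,\dots,c_k$. Put $s_a=\frac1{\sqrt2}t_a(c_{a+1}-c_a)$; these elements satisfy the relations of the adjacent transpositions of $\mathfrak S_n$, and together with the $c_b$ they generate $\mathcal S_n$. Modules are $\mathbb Z_2$-graded, and simple means having no nonzero proper graded submodules. For $a<b$ put $t_{ab}=(-1)^{b-a-1}t_{b-1}\cdots t_{a+1}t_at_{a+1}\cdots t_{b-1}$. Jucys--Murphy elements: $m_1=0$, $m_a=t_{1a}+\dots+t_{a-1,a}$ for $a\ge2$, and $x_a=\sqrt2\,m_ac_a$ for $a=1,\dots,n$. The $x_a$ commute pairwise. A strict partition $\lambda\Vdash n$ is $\lambda=(\lambda_1>\dots>\lambda_\ell>0)$ with sum $n$; $\ell(\lambda)=\ell$. Its shifted Young diagram has boxes $(i,j)$ with $1\le i\le\ell$,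 $i\le j\le i+\lambda_i-1$; boxes $(i,i)$ are diagonal. A standard (unbarred) tableau of shape $\lambda$ is a bijective filling of the boxes by $1,\dots,n$ with entries increasing along rows and down columns. A standard barred tableau is obtained by putting bars on an arbitrary subset of the non-diagonal entries. The signed content of the entry $a$ (unbarred) or $\bar a$ (barred) in box $(i,j)$, with $\sigma=j-i$, is $\sqrt{\sigma(\sigma+1)}$, respectively $-\sqrt{\sigma(\sigma+1)}$; for an unbarred tableau $\mathcal T$ it is denoted $\kappa_a(\mathcal T)$. Put $\mathcal Y_a(\mathcal T)=\sqrt{A(\kappa_a(\mathcal T),\kappa_{a+1}(\mathcal T))}$ with $A(u,v)=1-\frac1{(u-v)^2}-\frac1{(u+v)^2}$. The elements $e_{\mathcal U}\in\mathcal S_n$, for standard barred tableaux $\mathcal U$, are defined inductively: $e_{\mathcal U}=1$ for the one-box tableau, and for $n\ge2$ $$e_{\mathcal U}=e_{\mathcal V}\,\frac{(x_n-b_1)\cdots(x_n-b_p)}{(\kappa-b_1)\cdots(\kappa-b_p)},$$ where $\mathcal V$ is obtained from $\mathcal U$ by removing the box containing $n$ or $\bar n$, $\kappa$ is the signed content of that entry, and $b_1,\dots,b_p$ are the signed contents of all possible entries $n$ or $\bar n$ (bars being allowed only in non-diagonal boxes) in all addable boxes of the shape $\mu$ of $\mathcal V$ (boxes whose addition to $\mu$ gives the shifted diagram of a strict partition), except for the actual entry of $\mathcal U$. Intertwiners: $\phi_a=s_a(x_a^2-x_{a+1}^2)+x_a+x_{a+1}-c_ac_{a+1}(x_a-x_{a+1})$,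 $1\le a\le n-1$. They satisfy the braid relations of $\mathfrak S_n$, so $\phi_w=\phi_{a_1}\cdots\phi_{a_r}$ is well defined for a reduced decomposition $w=s_{a_1}\cdots s_{a_r}$. $\mathcal R^\lambda$ is the (unbarred) row-tableau, with $1,\dots,n$ written consecutively by rows from left to right, starting from the top row; $d(\mathcal T)\in\mathfrak S_n$ is the unique permutation with $\mathcal T=d(\mathcal T)\mathcal R^\lambda$ (acting on entries). For a standard unbarred tableau $\mathcal T$ of shape $\lambda$ with diagonal entries $d_1<\dots<d_\ell$ put $\mathcal E^{\mathcal T}=\prod_{a=1}^m\frac{1+i\,c_{d_{2a-1}}c_{d_{2a}}}2$, and $\mathcal E^\lambda=\mathcal E^{\mathcal R^\lambda}$. Let $\mathcal{C}l^{\mathcal T}_{n-m}\subset\mathcal{C}l_n$ be the subalgebra generated by $c_{d_1},c_{d_3},\dots,c_{d_{2m-1}}$ and all $c_a$ with $a\in\{1,\dots,n\}\setminus\{d_1,\dots,d_{2m}\}$. Put $\zeta_{\mathcal T}=\phi_{d(\mathcal T)}\,e_{\mathcal R^\lambda}\,\mathcal E^\lambda$. The left ideal $J^\lambda=\mathcal S_ne_{\mathcal R^\lambda}\mathcal E^\lambda$ is a simple $\mathcal S_n$-module, and $J^\lambda=\bigoplus_{\mathcal T}\mathcal{C}l^{\mathcal T}_{n-m}\,\zeta_{\mathcal T}$ with each summand free of rank one over $\mathcal{C}l^{\mathcal T}_{n-m}$. The normalized vectors are $\xi_{\mathcal T}=\frac1{b_{\mathcal T}}\zeta_{\mathcal T}$,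 where $b_{\mathcal T}$ is the nonzero constant defined by $\phi_{d(\mathcal T)}v_{\mathcal R^\lambda}=b_{\mathcal T}v_{\mathcal T}$ in the following $\mathcal S_n$-module $\widehat U^\lambda$: it is the free $\mathcal{C}l_n$-module on vectors $v_{\mathcal T}$ indexed by the standard unbarred tableaux of shape $\lambda$, with $x_av_{\mathcal T}=\kappa_a(\mathcal T)v_{\mathcal T}$ and $s_av_{\mathcal T}=\big(\frac1{\kappa_{a+1}(\mathcal T)-\kappa_a(\mathcal T)}+\frac{c_ac_{a+1}}{\kappa_{a+1}(\mathcal T)+\kappa_a(\mathcal T)}\big)v_{\mathcal T}+\mathcal Y_a(\mathcal T)v_{s_a\mathcal T}$, where $v_{s_a\mathcal T}=0$ if $s_a\mathcal T$ is not standard. In this module $\phi_av_{\mathcal T}=(\kappa_a(\mathcal T)^2-\kappa_{a+1}(\mathcal T)^2)\mathcal Y_a(\mathcal T)v_{s_a\mathcal T}$. *)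

(* Defs.v *)
From HB Require Import structures.
From mathcomp Require Import all_boot all_order all_algebra all_fingroup.
From mathcomp Require Import generic_quotient.
From mathcomp Require Import all_classical.
From mathcomp Require Import reals complex.
Set Implicit Arguments.
Unset Strict Implicit.
Unset Printing Implicit Defensive.
Import Order.TTheory GRing.Theory Num.Theory.
Local Open Scope quotient_scope.
Local Open Scope ring_scope.

(* All indices are 0-based: the elements usually called t_a, c_a, x_a, s_a,
   phi_a and the tableau entry a are written here with index a - 1, and the
   box (i, j) is (i - 1, j - 1). *)

Inductive sexpr (C : Type) (n : nat) : Type :=
| Szero | Sone
| St of 'I_n.-1
| Sc of 'I_n
| Sopp of sexpr C n
| Sadd of sexpr C n & sexpr C n
| Smul of sexpr C n & sexpr C n
| Sscale of C & sexpr C n.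

Arguments Szero {C n}.
Arguments Sone {C n}.
Arguments St {C n} a.
Arguments Sc {C n} a.

(* The least congruence containing the axioms of unital associative
   C-algebras and the relations of the Sergeev superalgebra, which are those of
   the two tensor factors and, the tensor product being graded, t c = - c t. *)
Inductive seqv (C : nzRingType) (n : nat) : sexpr C n -> sexpr C n -> Prop :=
| seqv_refl x : seqv x x
| seqv_sym x y : seqv x y -> seqv y x
| seqv_trans x y z : seqv x y -> seqv y z -> seqv x z
| seqv_opp x y : seqv x y -> seqv (Sopp x) (Sopp y)
| seqv_add x y x' y' :
    seqv x x' -> seqv y y' -> seqv (Sadd x y) (Sadd x' y')
| seqv_mul x y x' y' :
    seqv x x' -> seqv y y' -> seqv (Smul x y) (Smul x' y')
| seqv_scale k x y : seqv x y -> seqv (Sscale k x) (Sscale k y)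
| seqv_addA x y z : seqv (Sadd x (Sadd y z)) (Sadd (Sadd x y) z)
| seqv_addC x y : seqv (Sadd x y) (Sadd y x)
| seqv_add0 x : seqv (Sadd Szero x) x
| seqv_addN x : seqv (Sadd (Sopp x) x) Szero
| seqv_mulA x y z : seqv (Smul x (Smul y z)) (Smul (Smul x y) z)
| seqv_mul1l x : seqv (Smul Sone x) x
| seqv_mul1r x : seqv (Smul x Sone) x
| seqv_mulDl x y z : seqv (Smul (Sadd x y) z) (Sadd (Smul x z) (Smul y z))
| seqv_mulDr x y z : seqv (Smul x (Sadd y z)) (Sadd (Smul x y) (Smul x z))
| seqv_scaleA a b x : seqv (Sscale a (Sscale b x)) (Sscale (a * b) x)
| seqv_scale1 x : seqv (Sscale 1 x) x
| seqv_scaleDr a x y :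
    seqv (Sscale a (Sadd x y)) (Sadd (Sscale a x) (Sscale a y))
| seqv_scaleDl a b x :
    seqv (Sscale (a + b) x) (Sadd (Sscale a x) (Sscale b x))
| seqv_scaleAl a x y : seqv (Sscale a (Smul x y)) (Smul (Sscale a x) y)
| seqv_scaleAr a x y : seqv (Sscale a (Smul x y)) (Smul x (Sscale a y))
| seqv_tt a : seqv (Smul (St a) (St a)) Sone
| seqv_braid (a b : 'I_n.-1) : b = a.+1 :> nat ->
    seqv (Smul (Smul (St a) (St b)) (St a)) (Smul (Smul (St b) (St a)) (St b))
| seqv_far (a b : 'I_n.-1) : (a.+1 < b)%N || (b.+1 < a)%N ->
    seqv (Smul (St a) (St b)) (Sopp (Smul (St b) (St a)))
| seqv_cc a : seqv (Smul (Sc a) (Sc a)) (Sopp Sone)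
| seqv_cC a b : a != b ->
    seqv (Smul (Sc a) (Sc b)) (Sopp (Smul (Sc b) (Sc a)))
| seqv_tc a b : seqv (Smul (St a) (Sc b)) (Sopp (Smul (Sc b) (St a))).

Section Sergeev.
Variables (C : numClosedFieldType) (n : nat).
Local Notation expr := (sexpr C n).

HB.instance Definition _ := gen_eqMixin expr.
HB.instance Definition _ := gen_choiceMixin expr.

Definition seqvb (x y : expr) : bool := `[< seqv x y >].

Lemma seqvb_refl : reflexive seqvb.
Proof. by move=> x; apply/asboolP; apply: seqv_refl. Qed.

Lemma seqvb_sym : symmetric seqvb.
Proof.
by move=> x y; apply/asboolP/asboolP => h; apply: seqv_sym.
Qed.

Lemma seqvb_trans : transitive seqvb.
Proof.
move=> y x z /asboolP xy /asboolP yz.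
by apply/asboolP; apply: seqv_trans xy yz.
Qed.

Canonical seqvb_equiv := EquivRel seqvb seqvb_refl seqvb_sym seqvb_trans.

Definition sergeev : Type := {eq_quot seqvb}.
HB.instance Definition _ := Choice.on sergeev.

Definition scl (x : expr) : sergeev := \pi_{eq_quot seqvb} x.
Definition srep (x : sergeev) : expr := repr (x : {eq_quot seqvb}).

Lemma sclP (x y : expr) : scl x = scl y <-> seqv x y.
Proof. by split=> [/eqmodP/asboolP|h]; last by apply/eqmodP/asboolP. Qed.

Lemma sclW (P : sergeev -> Prop) : (forall x, P (scl x)) -> forall q, P q.
Proof. by move=> h; elim/quotW; apply: h. Qed.

Lemma seqv_rep (x : expr) : seqv (srep (scl x)) x.
Proof. by apply/sclP; rewrite /scl /srep reprK. Qed.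

Definition sg_zero : sergeev := scl Szero.
Definition sg_one : sergeev := scl Sone.
Definition sg_opp (x : sergeev) : sergeev := scl (Sopp (srep x)).
Definition sg_add (x y : sergeev) : sergeev := scl (Sadd (srep x) (srep y)).
Definition sg_mul (x y : sergeev) : sergeev := scl (Smul (srep x) (srep y)).
Definition sg_scale (k : C) (x : sergeev) : sergeev := scl (Sscale k (srep x)).

Lemma scl_opp x : sg_opp (scl x) = scl (Sopp x).
Proof. by apply/sclP/seqv_opp/seqv_rep. Qed.
Lemma scl_add x y : sg_add (scl x) (scl y) = scl (Sadd x y).
Proof. by apply/sclP/seqv_add; apply: seqv_rep. Qed.
Lemma scl_mul x y : sg_mul (scl x) (scl y) = scl (Smul x y).
Proof. by apply/sclP/seqv_mul; apply: seqv_rep. Qed.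
Lemma scl_scale k x : sg_scale k (scl x) = scl (Sscale k x).
Proof. by apply/sclP/seqv_scale/seqv_rep. Qed.

Let sclE := (scl_opp, scl_add, scl_mul, scl_scale).

Lemma sg_addA : associative sg_add.
Proof.
by do 3!elim/sclW=> ?; rewrite !sclE; apply/sclP/seqv_addA.
Qed.
Lemma sg_addC : commutative sg_add.
Proof. by do 2!elim/sclW=> ?; rewrite !sclE; apply/sclP/seqv_addC. Qed.
Lemma sg_add0 : left_id sg_zero sg_add.
Proof. by elim/sclW=> ?; rewrite !sclE; apply/sclP/seqv_add0. Qed.
Lemma sg_addN : left_inverse sg_zero sg_opp sg_add.
Proof. by elim/sclW=> ?; rewrite !sclE; apply/sclP/seqv_addN. Qed.

HB.instance Definition _ :=
  GRing.isZmodule.Build sergeev sg_addA sg_addC sg_add0 sg_addN.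

Lemma sg_mulA : associative sg_mul.
Proof.
by do 3!elim/sclW=> ?; rewrite !sclE; apply/sclP/seqv_mulA.
Qed.
Lemma sg_mul1l : left_id sg_one sg_mul.
Proof. by elim/sclW=> ?; rewrite !sclE; apply/sclP/seqv_mul1l. Qed.
Lemma sg_mul1r : right_id sg_one sg_mul.
Proof. by elim/sclW=> ?; rewrite !sclE; apply/sclP/seqv_mul1r. Qed.
Lemma sg_mulDl : left_distributive sg_mul +%R.
Proof.
by do 3!elim/sclW=> ?; rewrite /+%R/= !sclE; apply/sclP/seqv_mulDl.
Qed.
Lemma sg_mulDr : right_distributive sg_mul +%R.
Proof.
by do 3!elim/sclW=> ?; rewrite /+%R/= !sclE; apply/sclP/seqv_mulDr.
Qed.

HB.instance Definition _ := GRing.Zmodule_isPzRing.Build sergeev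
  sg_mulA sg_mul1l sg_mul1r sg_mulDl sg_mulDr.

Lemma sg_scaleA a b (x : sergeev) :
  sg_scale a (sg_scale b x) = sg_scale (a * b) x.
Proof. by elim/sclW: x => x; rewrite !sclE; apply/sclP/seqv_scaleA. Qed.
Lemma sg_scale1 : left_id 1 sg_scale.
Proof. by elim/sclW=> ?; rewrite !sclE; apply/sclP/seqv_scale1. Qed.
Lemma sg_scaleDr : right_distributive sg_scale +%R.
Proof.
by move=> a; do 2!elim/sclW=> ?; rewrite /+%R/= !sclE; apply/sclP/seqv_scaleDr.
Qed.
Lemma sg_scaleDl (x : sergeev) :
  {morph sg_scale^~ x : a b / a + b}.
Proof.
move=> a b; elim/sclW: x => x.
by rewrite {2}/+%R/= !sclE; apply/sclP/seqv_scaleDl.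
Qed.

Lemma sg_scaleAl a (x y : sergeev) :
  sg_scale a (sg_mul x y) = sg_mul (sg_scale a x) y.
Proof.
by elim/sclW: x => x; elim/sclW: y => y; rewrite !sclE; apply/sclP/seqv_scaleAl.
Qed.
Lemma sg_scaleAr a (x y : sergeev) :
  sg_scale a (sg_mul x y) = sg_mul x (sg_scale a y).
Proof.
by elim/sclW: x => x; elim/sclW: y => y; rewrite !sclE; apply/sclP/seqv_scaleAr.
Qed.

HB.instance Definition _ := GRing.Zmodule_isLmodule.Build C sergeev
  sg_scaleA sg_scale1 sg_scaleDr sg_scaleDl.

(* 1 <> 0, through a matrix representation with n + n anticommuting square
   roots of 1; needed because algType only covers nontrivial algebras. *)
Section Eval.
Variables (A : algType C) (ft : 'I_n.-1 -> A) (fc : 'I_n -> A).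

Fixpoint seval (x : expr) : A :=
  match x with
  | Szero => 0 | Sone => 1
  | St a => ft a | Sc a => fc a
  | Sopp y => - seval y
  | Sadd y z => seval y + seval z
  | Smul y z => seval y * seval z
  | Sscale k y => k *: seval y
  end.

Lemma sevalP :
  (forall a, ft a * ft a = 1) ->
  (forall a b : 'I_n.-1, b = a.+1 :> nat -> ft a * ft b * ft a = ft b * ft a * ft b) ->
  (forall a b : 'I_n.-1, (a.+1 < b)%N || (b.+1 < a)%N -> ft a * ft b = - (ft b * ft a)) ->
  (forall a, fc a * fc a = - 1) ->
  (forall a b, a != b -> fc a * fc b = - (fc b * fc a)) ->
  (forall a b, ft a * fc b = - (fc b * ft a)) ->
  forall x y, seqv x y -> seval x = seval y.
Proof.
move=> tt tb tf cc cC tc x y; elim=> //=; intros;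
  by [congruence | rewrite addrA | rewrite addrC | rewrite add0r
     | rewrite addNr | rewrite mulrA | rewrite mul1r | rewrite mulr1
     | rewrite mulrDl | rewrite mulrDr | rewrite scalerA | rewrite scale1r
     | rewrite scalerDr | rewrite scalerDl | rewrite scalerAl
     | rewrite scalerAr | apply: tb | apply: tf | apply: cC].
Qed.
End Eval.

Lemma clifford_matrices k : exists (N : nat) (g : nat -> 'M[C]_N.+1),
  (forall i, (i < k)%N -> g i *m g i = 1%:M) /\
  (forall i j, (i < k)%N -> (j < k)%N -> i != j ->
     g i *m g j = - (g j *m g i)).
Proof.
elim: k => [|k [N [g [g1 gC]]]]; first by exists 0%N, (fun=> 0); split.
pose D i : 'M[C]_(N.+1 + N.+1) :=
  if i == k then block_mx 0 1%:M 1%:M 0 else block_mx (g i) 0 0 (- g i).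
pose z := (mul0mx, mulmx0, mulmx1, mul1mx, addr0, add0r, oppr0, opprK).
exists (N + N.+1)%N, D.
suff [D1 DC] : (forall i, (i < k.+1)%N -> D i *m D i = 1%:M) /\
  (forall i j, (i < k.+1)%N -> (j < k.+1)%N -> i != j ->
     D i *m D j = - (D j *m D i)) by split; [exact: D1 | exact: DC].
split=> [i|i j]; rewrite /D.
  rewrite ltnS leq_eqVlt; case: eqVneq => [_ _|_ /= /g1 gi]; rewrite mulmx_block !z -?scalar_mx_block //.
  by rewrite mulmxN mulNmx opprK gi -scalar_mx_block.
rewrite !ltnS (leq_eqVlt i) (leq_eqVlt j).
case: (eqVneq i k) (eqVneq j k) => [->|_] [->|_] //=; rewrite ?eqxx //.
- by move=> _ _ _; rewrite !mulmx_block opp_block_mx !z.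
- by move=> _ _ _; rewrite !mulmx_block opp_block_mx !z.
by move=> ik jk ij; rewrite !mulmx_block opp_block_mx !z !mulmxN !mulNmx !opprK gC.
Qed.

Lemma sergeev_oner_neq0 : (1 : sergeev) != 0.
Proof.
have [N [g [g1 gC]]] := clifford_matrices (n + n).
have {}g1 i : (i < n + n)%N -> g i * g i = 1 by apply: g1.
have {}gC i j : (i < n + n)%N -> (j < n + n)%N -> i != j ->
  g i * g j = - (g j * g i) by apply: gC.
pose k : C := (sqrtC 2)^-1.
have k2 : k * k + k * k = 1.
  by rewrite -mulr2n -expr2 exprVn sqrtCK -(mulr_natl 2^-1) mulfV // pnatr_eq0.
have lt1 (a : 'I_n.-1) : (a.+1 < n)%N by rewrite -ltn_predRL ltn_ord.
have lt2 i : (i < n)%N -> (i < n + n)%N by move/leq_trans; apply; apply: leq_addr.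
have lt3 (a : 'I_n.-1) : (a < n + n)%N by rewrite lt2 // ltnW // lt1.
have lt4 (a : 'I_n.-1) : (a.+1 < n + n)%N by rewrite lt2 // lt1.
have lt5 (a : 'I_n) : (n + a < n + n)%N by rewrite ltn_add2l.
pose ft (a : 'I_n.-1) := k *: (g a - g a.+1).
pose fc (a : 'I_n) := 'i *: g (n + a)%N.
have ftE a b : ft a * ft b = (k * k) *: ((g a - g a.+1) * (g b - g b.+1)).
  by rewrite -scalerAl -scalerAr scalerA.
have gB i j p : (i < n + n)%N -> (j < n + n)%N -> (p < n + n)%N ->
    i != p -> j != p -> (g i - g j) * g p = - (g p * (g i - g j)).
  by move=> *; rewrite mulrBl mulrBr !(gC _ p) // opprB opprK addrC.
have ft1 a : ft a * ft a = 1.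
  rewrite ftE mulrBl !mulrBr !g1 // (gC a.+1 a) ?gtn_eqF // opprD !opprK.
  by rewrite addrA subrK scalerDr -scalerDl k2 scale1r.
have ftS (a b : 'I_n.-1) : b = a.+1 :> nat -> ft a * ft b = - 1 - ft b * ft a.
  move=> e; rewrite !ftE.
  suff -> : (g a - g a.+1) * (g b - g b.+1) =
    - (1 + 1) - (g b - g b.+1) * (g a - g a.+1).
    by rewrite scalerBr scalerN scalerDr -scalerDl k2 scale1r.
  have ab : g a * g b = - (g b * g a) by rewrite gC // e ltn_eqF.
  have ab1 : g a * g b.+1 = - (g b.+1 * g a) by rewrite gC // e ltn_eqF.
  have bb1 : g b * g b.+1 = - (g b.+1 * g b) by rewrite gC // ltn_eqF.
  rewrite -e !mulrBl !mulrBr ab ab1 bb1 (g1 b) //.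
  rewrite !opprB !opprK (addrC (- (1 + 1))) opprD (addrC 1) !addrA addrK.
  by rewrite -[X in X - _ = _]addrA (addrC (- (g b * g a))).
have P : forall x y, seqv x y -> seval ft fc x = seval ft fc y.
  apply: sevalP => // [a b e|a b ab|a|a b ab|a b].
  - rewrite -[RHS]mulrA !(ftS _ _ e) mulrBl mulrBr -(mulrA (ft b)) ft1.
    by rewrite mulrA ft1 mulN1r mulrN1 mulr1 mul1r addrC.
  - have [ba Sba aSb] : [/\ a != b :> nat, a.+1 != b & a != b.+1 :> nat].
      by case/orP: ab => h; rewrite !neq_ltn h (ltnW h) ?orbT;
         rewrite ?ltnS ?(ltnW (ltnW h)) ?orbT.
    rewrite !ftE -scalerN mulrBr !gB // ?eqSS //.
    by rewrite [in RHS]mulrBl opprB opprK addrC.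
  - by rewrite -scalerAl -scalerAr scalerA -expr2 sqrCi g1 // scaleN1r.
  - by rewrite -!scalerAl -!scalerAr gC // ?eqn_add2l // !scalerN.
  rewrite -!scalerAl -!scalerAr gB ?scalerN //.
  all: try by [rewrite !scalerA mulrC | rewrite neq_ltn ltn_addr // ltnW].
apply/eqP => h; have /P/eqP := iffLR (sclP Sone Szero) h.
by rewrite /= oner_eq0.
Qed.

HB.instance Definition _ := GRing.PzSemiRing_isNonZero.Build sergeev
  sergeev_oner_neq0.
HB.instance Definition _ := GRing.Lmodule_isLalgebra.Build C sergeev sg_scaleAl.
HB.instance Definition _ := GRing.Lalgebra_isAlgebra.Build C sergeev sg_scaleAr.

(* Zero outside the range of the generators. *)
Definition tg (a : nat) : sergeev := oapp (fun i => scl (St i)) 0 (insub a).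
Definition cg (a : nat) : sergeev := oapp (fun i => scl (Sc i)) 0 (insub a).

(* [homog p x]: x has parity p, all the generators being odd. *)
Inductive homog : bool -> sergeev -> Prop :=
| homog_0 p : homog p 0
| homog_1 : homog false 1
| homog_t a : homog true (tg a)
| homog_c a : homog true (cg a)
| homogD p x y : homog p x -> homog p y -> homog p (x + y)
| homogZ p k x : homog p x -> homog p (k *: x)
| homogM p q x y : homog p x -> homog q y -> homog (p (+) q) (x * y).

Definition graded_left_ideal (N : set sergeev) : Prop :=
  [/\ N 0, forall x y, N x -> N y -> N (x + y), forall y x, N x -> N (y * x)
    & forall x, N x -> exists x0 x1,
        [/\ N x0, N x1, homog false x0, homog true x1 & x = x0 + x1]].

Definition simple_left_ideal (J : set sergeev) : Prop :=
  [/\ graded_left_ideal J, exists2 x, J x & x != 0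
    & forall N : set sergeev, graded_left_ideal N -> N `<=` J ->
        N `<=` [set 0] \/ J `<=` N]%classic.

Definition sg (a : nat) : sergeev :=
  (sqrtC 2)^-1 *: (tg a * (cg a.+1 - cg a)).

Definition tpair (a b : nat) : sergeev :=
  (-1) ^+ (b - a - 1) *:
    ((\prod_(k <- rev (iota a.+1 (b - a.+1))) tg k) * tg a
     * \prod_(a.+1 <= k < b) tg k).

Definition jm (b : nat) : sergeev := \sum_(a < b) tpair a b.

Definition xg (a : nat) : sergeev := sqrtC 2 *: (jm a * cg a).

Definition phi (a : nat) : sergeev :=
  sg a * (xg a ^+ 2 - xg a.+1 ^+ 2) + xg a + xg a.+1
  - cg a * cg a.+1 * (xg a - xg a.+1).

End Sergeev.

Arguments tg {C n} a.
Arguments cg {C n} a.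
Arguments sg {C n} a.
Arguments tpair {C n} a b.
Arguments jm {C n} b.
Arguments xg {C n} a.
Arguments phi {C n} a.

Inductive subalg (C : nzRingType) (A : algType C) (P : set A) : A -> Prop :=
| subalg_gen x : P x -> subalg P x
| subalg_1 : subalg P 1
| subalgD x y : subalg P x -> subalg P y -> subalg P (x + y)
| subalgZ k x : subalg P x -> subalg P (k *: x)
| subalgM x y : subalg P x -> subalg P y -> subalg P (x * y).

(* N is the direct sum over i in I of the subsets B_i g_i, and b |-> b g_i is
   injective on B_i; the B_i are meant to be subalgebras of S. *)
Definition free_decomposition (S : pzRingType) (M : lmodType S) (K : eqType)
    (I : seq K) (B : K -> set S) (g : K -> M) (N : set M) : Prop :=
  (forall u, N u <-> exists2 f : K -> S, (forall i, i \in I -> B i (f i))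
                       & u = \sum_(i <- I) f i *: g i) /\
  (forall f : K -> S, (forall i, i \in I -> B i (f i)) ->
     \sum_(i <- I) f i *: g i = 0 -> forall i, i \in I -> f i = 0).

Definition box : Type := (nat * nat)%type.

Definition is_diag (b : box) : bool := b.1 == b.2.

Definition strict_partition (la : seq nat) : bool :=
  sorted gtn la && all (ltn 0) la.

Definition diagram (la : seq nat) : seq box :=
  [seq (i, j) | i <- iota 0 (size la), j <- iota i (nth 0 la i)].

(* A bijective filling of the diagram by 0, .., n - 1 is encoded by the list T
   of its boxes in the order of their entries: the box of the entry a is
   [box_of T a] and the entry of the box b is [index b T]. *)
Definition tableau : Type := seq box.

Definition box_of (T : tableau) (a : nat) : box := nth (0, 0)%N T a.

Definition is_standard (T : tableau) : bool :=
  all (fun b : box => all (fun b' : box =>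
    ((b.1 == b'.1) && (b.2 < b'.2) || (b.2 == b'.2) && (b.1 < b'.1)) ==>
      (index b T < index b' T)) T)%N T.

Definition std_tableaux (la : seq nat) : seq tableau :=
  [seq T <- permutations (diagram la) | is_standard T].

(* [diagram] lists the boxes by rows. *)
Definition row_tableau (la : seq nat) : tableau := diagram la.

Definition tab_act (n : nat) (w : 'S_n) (T : tableau) : tableau :=
  [seq box_of T ((w^-1)%g k) | k : 'I_n <- enum 'I_n].

Definition adj (n : nat) (a : nat) : 'S_n :=
  match insub a, insub a.+1 with
  | Some i, Some j => tperm i j
  | _, _ => 1%g
  end.

Definition tab_perm (n : nat) (la : seq nat) (T : tableau) : 'S_n :=
  odflt 1%g [pick w : 'S_n | tab_act w (row_tableau la) == T].

(* [word] is a_1, .., a_r with w = s_(a_1) o .. o s_(a_r); the product of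
   permutations in the library composes from left to right, whence [rev]. *)
Definition spells (n : nat) (w : 'S_n) (word : seq nat) : Prop :=
  all (fun a => a.+1 < n)%N word /\ w = (\prod_(a <- rev word) adj n a)%g.

Definition reduced_word (n : nat) (w : 'S_n) (word : seq nat) : Prop :=
  spells w word /\ forall word', spells w word' -> (size word <= size word')%N.

Definition diag_entries (T : tableau) : seq nat :=
  [seq a <- iota 0 (size T) | is_diag (box_of T a)].

Section Idempotents.
Variable C : numClosedFieldType.

Definition barred_box : Type := (box * bool)%type.

Definition content (p : barred_box) : C :=
  let s := (p.1.2 - p.1.1)%N in (-1) ^+ p.2 * sqrtC (s * s.+1)%:R.

Definition kappa (T : tableau) (a : nat) : C := content (box_of T a, false).

Definition Afun (u v : C) : C := 1 - (u - v) ^- 2 - (u + v) ^- 2.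

Definition Yfun (T : tableau) (a : nat) : C :=
  sqrtC (Afun (kappa T a) (kappa T a.+1)).

Definition shape_of (V : seq box) : seq nat :=
  [seq count (fun b : box => b.1 == i) V | i <- iota 0 (count is_diag V)].

Definition addable (mu : seq nat) : seq box :=
  [seq (i, i + nth 0 mu i)%N
  | i <- iota 0 (size mu).+1 & strict_partition (incr_nth mu i)].

Definition possible_entries (mu : seq nat) : seq barred_box :=
  [seq p <- [seq (b, e) | b <- addable mu, e <- [:: false; true]]
  | p.2 ==> ~~ is_diag p.1].

Variable n : nat.
Local Notation S := (sergeev C n).

(* e_U for a barred tableau U given by the list of its boxes in the order of
   their entries, each box with a flag telling whether its entry is barred.
   The factor of index k is the one of the inductive step from [take k U] to
   [take k.+1 U]. *)
Definition e_factor (U : seq barred_box) (k : nat) : S :=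
  let p := nth ((0, 0)%N, false) U k in
  let mu := shape_of [seq q.1 | q <- take k U] in
  let others := [seq q <- possible_entries mu | q != p] in
  (\prod_(q <- others) (content p - content q))^-1 *:
    \prod_(q <- others) (xg k - (content q)%:A).

Definition e_elt (U : seq barred_box) : S :=
  \prod_(1 <= k < size U) e_factor U k.

Definition e_row (la : seq nat) : S :=
  e_elt [seq (b, false) | b <- row_tableau la].

Definition Ediag (T : tableau) : S :=
  let d := nth 0%N (diag_entries T) in
  \prod_(a < (size (diag_entries T))./2)
    (2^-1 *: (1 + 'i *: (cg (d a.*2) * cg (d a.*2.+1)))).

Definition Jideal (la : seq nat) : set S :=
  [set z | exists y, z = y * (e_row la * Ediag (row_tableau la))]%classic.

Definition clifford : set S :=
  subalg [set z | exists2 a, (a < n)%N & z = cg a]%classic.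

Definition clifford_tab (T : tableau) : set S :=
  let d := diag_entries T in
  let m := (size d)./2 in
  subalg [set z | (exists2 a, (a < m)%N & z = cg (nth 0%N d a.*2)) \/
    (exists a, [/\ (a < n)%N, a \notin take m.*2 d & z = cg a])]%classic.

(* The choice of the reduced word is irrelevant by the braid relations. *)
Definition phi_perm (w : 'S_n) : S :=
  \prod_(a <- xget [::] [set word | reduced_word w word]%classic) phi a.

Definition zeta (la : seq nat) (T : tableau) : S :=
  phi_perm (tab_perm n la T) * e_row la * Ediag (row_tableau la).

Definition s_coef (T : tableau) (a : nat) : S :=
  ((kappa T a.+1 - kappa T a)^-1)%:A +
  (kappa T a.+1 + kappa T a)^-1 *: (cg a * cg a.+1).

(* v is a basis of the free Cl_n-module U, extended by 0 to nonstandard T. *)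
Definition is_Uhat (la : seq nat) (U : lmodType S) (v : tableau -> U) : Prop :=
  [/\ free_decomposition (std_tableaux la) (fun=> clifford) v setT,
      forall T, T \notin std_tableaux la -> v T = 0,
      forall T a, T \in std_tableaux la -> (a < n)%N ->
        xg a *: v T = (kappa T a)%:A *: v T
    & forall T a, T \in std_tableaux la -> (a.+1 < n)%N ->
        sg a *: v T =
          s_coef T a *: v T + (Yfun T a)%:A *: v (tab_act (adj n a) T)].

End Idempotents.

(* Main.v *)
(* Call a vector z of S_n a weight vector of T if x_a z = kappa_a(T) z for all a.
   The core is a spectral theorem for the left regular module: on the vectors
   having the first k contents of T, the next x_a acts semisimply, and its
   eigenvalues are the signed contents of the entries that may be added. The
   induction on k uses the square of the intertwiner, and an argument with
   three strands to exclude the words of boxes that are not shifted standard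
   tableaux. Hence e_R is a weight vector, phi_a maps weight vectors of T to
   weight vectors of s_a T, and kills those of T when s_a T is not standard;
   chains of intertwiners give one vector z_T for each T, and the z_T span J
   over the subalgebras Cl^T.

   Acting on v_R in U, z_T gives a nonzero multiple of E^T v_T.  As p E^T = 0
   implies p = 0 for p in Cl^T, the map u |-> u v_R is injective on J; it sends
   xi_T to E^T v_T, so xi_T is a multiple of z_T and all formulas can be read
   off in U.  The s-formula is obtained from that for phi_a, which on a weight
   vector is affine in s_a.

   For simplicity, the x_a^2 separate the tableaux, so a nonzero graded
   submodule N of J contains p z_T with p in Cl^T nonzero.  The x_a with nonzero
   content, and the products of two paired diagonal c_d, change the sign of one
   generator in p; averaging reduces p to a combination of 1 and of at most one
   generator, and the grading to 1.  The intertwiners then lead from z_T to z_R,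
   which generates J. *)
Require Import Defs.
From HB Require Import structures.
From mathcomp Require Import all_boot all_order all_algebra all_fingroup.
From mathcomp Require Import all_classical.
From mathcomp Require Import reals complex.
From mathcomp Require Import ring zify.
Set Implicit Arguments.
Unset Strict Implicit.
Unset Printing Implicit Defensive.
Import Order.TTheory GRing.Theory Num.Theory.
Local Open Scope ring_scope.

(** * Equalities of linear combinations *)

(** The superalgebra is known only through its presentation: neither a basis nor its dimension is at
    hand. Upper bounds therefore come from the relations, lower bounds from [U], whose vectors are
    independent over the Clifford algebra by hypothesis. For the same reason the spectral theorem
    cannot start from a characteristic polynomial; an annihilating product of linear factors is
    carried through its induction. The pivot is $\phi_a^2=2(x_a^2+x_{a+1}^2)-(x_a^2-x_{a+1}^2)^2$.
    For $x_a^2=s(s+1)$ and $x_{a+1}^2=B$ it equals $-(B-(s+1)(s+2))(B-s(s-1))$, so $\phi_a$ is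
    injective unless the two contents are neighbours or both zero. A bad eigenvalue at which it
    degenerates is transported along swaps until contents $t',t,\pm t'$, with $t'$ next to $t$, sit
    on three adjacent strands. There both intertwiners vanish, so the $s_a$ act through scalars and
    Clifford elements, and the braid relation gives a contradiction. The braid relation of the
    intertwiners is established on weight vectors, where it is a Yang-Baxter equation with scalar
    parameters. *)

Section LinearNormalization.
Variables (K : comNzRingType) (V : lmodType K).

Inductive lexp : Type :=
| LAtom of nat | LZero | LAdd of lexp & lexp | LOpp of lexp | LScale of K & lexp.

Fixpoint leval (env : seq V) (e : lexp) : V :=
  match e with
  | LAtom i => nth 0 env i | LZero => 0
  | LAdd e1 e2 => leval env e1 + leval env e2
  | LOpp e1 => - leval env e1 | LScale k e1 => k *: leval env e1
  end.

(** [Nat.eqb] computes on literal indices, so that [cbv] leaves only equations between coefficients,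
    which are goals for [ring]. *)
Fixpoint lcoef (e : lexp) (i : nat) : K :=
  match e with
  | LAtom j => if Nat.eqb i j then 1 else 0 | LZero => 0
  | LAdd e1 e2 => lcoef e1 i + lcoef e2 i
  | LOpp e1 => - lcoef e1 i | LScale k e1 => k * lcoef e1 i
  end.

Fixpoint lcoefs_eq (e1 e2 : lexp) (k : nat) : Prop :=
  match k with
  | 0 => True
  | k'.+1 => lcoef e1 k' = lcoef e2 k' /\ lcoefs_eq e1 e2 k'
  end.

Lemma levalE env e : leval env e = \sum_(i < size env) lcoef e i *: env`_i.
Proof.
elim: e => /= [j||e1 -> e2 ->|e1 ->|k e1 ->].
- case: (ltnP j (size env)) => hj.
    rewrite (bigD1 (Ordinal hj)) //= PeanoNat.Nat.eqb_refl scale1r big1 ?addr0 //.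
    move=> i ij; case: PeanoNat.Nat.eqb_spec => [e|_]; last by rewrite scale0r.
    by rewrite -val_eqE /= e eqxx in ij.
  rewrite nth_default // big1 // => i _.
  case: PeanoNat.Nat.eqb_spec => [e|_]; last by rewrite scale0r.
  by rewrite -e leqNgt ltn_ord in hj.
- by rewrite big1 // => i _; rewrite scale0r.
- by rewrite -big_split; apply: eq_bigr => i _; rewrite scalerDl.
- by rewrite -sumrN; apply: eq_bigr => i _; rewrite scaleNr.
by rewrite scaler_sumr; apply: eq_bigr => i _; rewrite scalerA.
Qed.

Lemma leval_eq env e1 e2 :
  lcoefs_eq e1 e2 (size env) -> leval env e1 = leval env e2.
Proof.
rewrite !levalE => h; apply: eq_bigr => -[i hi] _ /=; congr (_ *: _).
elim: (size env) h i hi => //= k IH [ek /IH h] i.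
by rewrite ltnS leq_eqVlt => /orP[/eqP->|/h].
Qed.
End LinearNormalization.

(* Equality of ring expressions up to the structures found by inference, which
   need not be syntactically equal. *)
Ltac lin_same x y :=
  first [ constr_eq x y
  | lazymatch x with
    | GRing.one _ => lazymatch y with GRing.one _ => idtac end
    | GRing.zero => lazymatch y with GRing.zero => idtac end
    | GRing.opp ?a => lazymatch y with GRing.opp ?b => lin_same a b end
    | GRing.mul ?a ?a' => lazymatch y with
        GRing.mul ?b ?b' => lin_same a b; lin_same a' b' end
    | GRing.add ?a ?a' => lazymatch y with
        GRing.add ?b ?b' => lin_same a b; lin_same a' b' end
    | GRing.scale ?a ?a' => lazymatch y with
        GRing.scale ?b ?b' => lin_same a b; lin_same a' b' end
    | GRing.exp ?a ?k => lazymatch y with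
        GRing.exp ?b ?k' => constr_eq k k'; lin_same a b end
    end ].

Ltac lin_eqb x y :=
  match constr:(Set) with
  | _ => let _ := match goal with _ => lin_same x y end in constr:(true)
  | _ => constr:(false)
  end.

Ltac lin_index x l :=
  lazymatch l with
  | nil => constr:(@None nat)
  | cons ?y ?l' =>
    lazymatch lin_eqb x y with
    | true => constr:(Some O)
    | false => lazymatch lin_index x l' with
               | Some ?i => constr:(Some (S i))
               | None => constr:(@None nat)
               end
    end
  end.

Ltac lin_atoms t l :=
  lazymatch t with
  | GRing.add ?a ?b => let l' := lin_atoms a l in lin_atoms b l'
  | GRing.opp ?a => lin_atoms a l
  | GRing.scale _ ?a => lin_atoms a l
  | GRing.zero => l
  | _ => lazymatch lin_index t l with
         | Some _ => l
         | None => constr:(cons t l)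
         end
  end.

Ltac lin_reify K t l :=
  lazymatch t with
  | GRing.add ?a ?b =>
      let a' := lin_reify K a l in
      let b' := lin_reify K b l in constr:(@LAdd K a' b')
  | GRing.opp ?a => let a' := lin_reify K a l in constr:(@LOpp K a')
  | GRing.scale ?k ?a => let a' := lin_reify K a l in constr:(@LScale K k a')
  | GRing.zero => constr:(@LZero K)
  | _ => lazymatch lin_index t l with Some ?i => constr:(@LAtom K i) end
  end.

(* Reduces an equality of K-linear combinations to the equality of the
   coefficients of each atom. *)
Ltac lin_coefs K :=
  lazymatch goal with
  | |- ?x = ?y =>
    let V := type of x in
    let l := lin_atoms x (@nil V) in
    let l := lin_atoms y l in
    let e1 := lin_reify K x l in
    let e2 := lin_reify K y l in
    apply: (@leval_eq K _ l e1 e2);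
    cbv [lcoefs_eq lcoef size Nat.eqb];
    repeat split
  end.

Ltac lin K := lin_coefs K; ring.

(** * Relations of the Sergeev superalgebra *)

Section Relations.
Variables (C : numClosedFieldType) (n : nat).
Local Notation S := (sergeev C n).
Implicit Types (a b : nat) (z : S).

Lemma tgE a (h : (a < n.-1)%N) : tg a = scl (St (Ordinal h)) :> S.
Proof. by rewrite /tg insubT. Qed.

Lemma tg_out a : (n.-1 <= a)%N -> tg a = 0 :> S.
Proof. by move=> h; rewrite /tg insubF // ltnNge h. Qed.

Lemma cgE a (h : (a < n)%N) : cg a = scl (Sc (Ordinal h)) :> S.
Proof. by rewrite /cg insubT. Qed.

Lemma cg_out a : (n <= a)%N -> cg a = 0 :> S.
Proof. by move=> h; rewrite /cg insubF // ltnNge h. Qed.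

Lemma sclM (x y : sexpr C n) : scl x * scl y = scl (Smul x y) :> S.
Proof. exact: scl_mul. Qed.

Lemma sclN (x : sexpr C n) : - scl x = scl (Sopp x) :> S.
Proof. exact: scl_opp. Qed.

Lemma tg_sq a : (a.+1 < n)%N -> tg a * tg a = 1 :> S.
Proof.
rewrite -ltn_predRL => h; rewrite tgE sclM.
by apply/sclP/seqv_tt.
Qed.

Lemma tg_braid a :
  tg a * tg a.+1 * tg a = tg a.+1 * tg a * tg a.+1 :> S.
Proof.
case: (ltnP a.+1 n.-1) => [h|h]; last by rewrite (tg_out h) !(mulr0, mul0r).
rewrite (tgE (ltnW h)) tgE !sclM.
by apply/sclP/seqv_braid.
Qed.

Lemma tg_far a b : (a.+1 < b)%N || (b.+1 < a)%N ->
  tg a * tg b = - (tg b * tg a) :> S.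
Proof.
case: (ltnP a n.-1) => [ha|/tg_out ->]; last by rewrite mulr0 mul0r oppr0.
case: (ltnP b n.-1) => [hb|/tg_out ->]; last by rewrite mulr0 mul0r oppr0.
move=> ab; rewrite (tgE ha) (tgE hb) !sclM sclN.
by apply/sclP/seqv_far.
Qed.

Lemma cg_sq a : (a < n)%N -> cg a * cg a = -1 :> S.
Proof.
move=> h; rewrite cgE sclM -[1]/(scl Sone) sclN.
by apply/sclP/seqv_cc.
Qed.

Lemma cg_anti a b : a != b -> cg a * cg b = - (cg b * cg a) :> S.
Proof.
case: (ltnP a n) => [ha|/cg_out ->]; last by rewrite mulr0 mul0r oppr0.
case: (ltnP b n) => [hb|/cg_out ->]; last by rewrite mulr0 mul0r oppr0.
move=> ab; rewrite (cgE ha) (cgE hb) !sclM sclN.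
by apply/sclP/seqv_cC.
Qed.

Lemma tcg_anti a b : tg a * cg b = - (cg b * tg a) :> S.
Proof.
case: (ltnP a n.-1) => [ha|/tg_out ->]; last by rewrite mulr0 mul0r oppr0.
case: (ltnP b n) => [hb|/cg_out ->]; last by rewrite mulr0 mul0r oppr0.
rewrite (tgE ha) (cgE hb) !sclM sclN.
by apply/sclP/seqv_tc.
Qed.

Lemma sergeev_ind (P : S -> Prop) :
  P 0 -> P 1 -> (forall x y, P x -> P y -> P (x + y)) ->
  (forall k x, P x -> P (k *: x)) -> (forall x y, P x -> P y -> P (x * y)) ->
  (forall a, P (tg a)) -> (forall a, P (cg a)) -> forall x, P x.
Proof.
move=> P0 P1 PD PZ PM Pt Pc; elim/sclW; elim => //.
- by move=> a; have := Pt a; rewrite (tgE (ltn_ord a)); congr (P (scl (St _))); apply: val_inj.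
- by move=> a; have := Pc a; rewrite (cgE (ltn_ord a)); congr (P (scl (Sc _))); apply: val_inj.
- by move=> x h; rewrite -sclN -scaleN1r; apply: PZ.
- by move=> x hx y hy; rewrite -scl_add; apply: PD.
- by move=> x hx y hy; rewrite -sclM; apply: PM.
by move=> k x hx; rewrite -scl_scale; apply: PZ.
Qed.

Lemma tpairS a b : (a < b)%N ->
  tpair a b.+1 = - (tg b * tpair a b * tg b) :> S.
Proof.
move=> ab; rewrite /tpair.
have -> : (b.+1 - a - 1 = (b - a - 1).+1)%N by lia.
have -> : (b.+1 - a.+1 = (b - a.+1).+1)%N by lia.
rewrite exprS mulN1r scaleNr; congr (- _).
rewrite -(addn1 (b - a.+1)) iotaD rev_cat big_cat /= big_seq1 subnKC //.
rewrite [in LHS]big_nat_recr //= -scalerAr -scalerAl; congr (_ *: _).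
by rewrite !mulrA.
Qed.

Lemma tpair_adj b : tpair b b.+1 = tg b :> S.
Proof.
rewrite /tpair subSnn !subnn expr0 scale1r big_nil mul1r big_geq ?mulr1 //.
Qed.

Lemma jm0 : jm 0 = 0 :> S.
Proof. by rewrite /jm big_ord0. Qed.

(** Conjugation by [tg b] sends each $t_{ab}$ to $-t_{a,b+1}$. With this recursion, the later
    relations of [jm] are proved without opening the products in [tpair]. *)
Lemma jmS b : jm b.+1 = tg b - tg b * jm b * tg b :> S.
Proof.
rewrite /jm big_ord_recr /= tpair_adj addrC; congr (_ + _).
rewrite mulr_sumr mulr_suml -sumrN; apply: eq_bigr => a _.
by rewrite tpairS.
Qed.

Lemma anti2 (x y w : S) : x * y = - (y * x) -> x * w = - (w * x) ->
  x * (y * w) = y * w * x.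
Proof. by move=> xy xw; rewrite mulrA xy mulNr -(mulrA y x w) xw mulrN opprK mulrA. Qed.

Lemma anti3 (x y w : S) : x * y = - (y * x) -> x * w = - (w * x) ->
  x * (y * w * y) = - (y * w * y * x).
Proof.
by move=> xy xw; rewrite (mulrA x) (anti2 xy xw) -(mulrA _ x) xy mulrN !mulrA.
Qed.

Lemma tjm_anti a b : (b.+1 < a)%N || (a < b)%N ->
  tg b * jm a = - (jm a * tg b) :> S.
Proof.
elim/ltn_ind: a b => -[|a] IH b; first by rewrite jm0 mulr0 mul0r oppr0.
rewrite ltnS leq_eqVlt -orbA => /orP[/eqP e|hba]; last first.
  have hab : (b.+1 < a)%N || (a.+1 < b)%N by [].
  have tab : tg b * tg a = - (tg a * tg b) :> S by rewrite tg_far.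
  rewrite jmS mulrBr mulrBl opprB tab anti3 //; last first.
    by apply: IH => //; lia.
  by rewrite opprK addrC.
(* The critical case: [tg b] against [jm b.+2], unrolled twice. The braid relation carries [tg b]
   through the two conjugations and turns it into [tg b.+1] next to [jm b], with which it
   anticommutes by induction. *)
subst a; rewrite !jmS.
set t := tg b.+1; set r := tg b; set m := jm b.
have tm : t * m = - (m * t) by apply: IH => //; lia.
have br : r * t * r = t * r * t := tg_braid b.
case: (ltnP b.+1 n) => [hb|hb]; last first.
  have -> : r = 0 by apply: tg_out; lia.
  by rewrite !(mulr0, mul0r) oppr0.
case: (ltnP b.+2 n) => [hb2|hb2]; last first.
  have -> : t = 0 by apply: tg_out; lia.
  by rewrite !(mulr0, mul0r, subrr, oppr0).
have rr : r * r = 1 by apply: tg_sq.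
have tt : t * t = 1 by apply: tg_sq.
have e1 : r * (t * r * t) = t * r.
  by rewrite -br !mulrA rr mul1r.
have e2 : t * r * t * r = r * t.
  by rewrite -br -!mulrA rr mulr1.
have e3 : r * (t * (r * m * r) * t) = - (t * (r * m * r) * t * r).
  have -> : r * (t * (r * m * r) * t) = r * t * r * (m * (r * t)) by rewrite !mulrA.
  rewrite br.
  have -> : t * r * t * (m * (r * t)) = t * r * (t * m) * (r * t) by rewrite !mulrA.
  rewrite tm mulrN mulNr; congr (- _).
  have -> : t * (r * m * r) * t * r = t * r * m * (r * t * r) by rewrite !mulrA.
  by rewrite br !mulrA.
rewrite (mulrBr t) !mulrBl mulrBr (mulrBr r (t * r * t)) e1 e2 e3.
by lin C.
Qed.

Lemma cjm_anti a b : cg b * jm a = - (jm a * cg b) :> S.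
Proof.
have ct k : cg b * tg k = - (tg k * cg b) :> S by rewrite tcg_anti opprK.
elim: a => [|a IH]; first by rewrite jm0 mulr0 mul0r oppr0.
by rewrite jmS mulrBr mulrBl anti3 // ct opprK opprB addrC.
Qed.

Lemma jm_anti a b : (a < b)%N -> jm a * jm b = - (jm b * jm a) :> S.
Proof.
elim: a => [|a IH] ab; first by rewrite jm0 mulr0 mul0r oppr0.
have jt : jm b * tg a = - (tg a * jm b) :> S by rewrite tjm_anti ?opprK // ab.
have jj : jm b * jm a = - (jm a * jm b) :> S by rewrite IH ?opprK // ltnW.
by rewrite jmS mulrBl mulrBr (anti3 jt jj) jt; lin C.
Qed.

Lemma cgSubCg_sq a : (a.+1 < n)%N ->
  (cg a.+1 - cg a) * (cg a.+1 - cg a) = (-2)%:A :> S.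
Proof.
move=> h; rewrite mulrBl !mulrBr !cg_sq ?(ltnW h) //.
by rewrite (@cg_anti a a.+1) ?ltn_eqF //; lin C.
Qed.

Lemma sqrt2M : (sqrtC 2)^-1 * (sqrtC 2)^-1 = 2^-1 :> C.
Proof. by rewrite -expr2 exprVn sqrtCK. Qed.

Lemma sqrt2_neq0 : sqrtC 2 != 0 :> C.
Proof. by rewrite sqrtC_eq0 pnatr_eq0. Qed.

Lemma tcgB a b : tg b * (cg a.+1 - cg a) = - ((cg a.+1 - cg a) * tg b) :> S.
Proof. by rewrite mulrBr mulrBl !(tcg_anti b); lin C. Qed.

Lemma tcgB' a b : (cg a.+1 - cg a) * tg b = - (tg b * (cg a.+1 - cg a)) :> S.
Proof. by rewrite tcgB opprK. Qed.

Lemma sg_sq a : (a.+1 < n)%N -> sg a * sg a = 1 :> S.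
Proof.
move=> h; rewrite /sg -scalerAl -scalerAr scalerA sqrt2M.
set u := _ - _.
have -> : tg a * u * (tg a * u) = - (u * (tg a * tg a) * u).
  by rewrite {1}/u {1}tcgB -/u mulNr !mulrA.
rewrite tg_sq // mulr1 cgSubCg_sq // scaleNr opprK scalerA mulVf ?scale1r //.
by rewrite pnatr_eq0.
Qed.

Lemma sg_cg a : (a.+1 < n)%N -> sg a * cg a = cg a.+1 * sg a :> S.
Proof.
move=> h; rewrite /sg -scalerAl -scalerAr; congr (_ *: _).
have dt : cg a.+1 * tg a = - (tg a * cg a.+1) :> S by rewrite tcg_anti opprK.
rewrite -(mulrA (tg a)) (mulrA (cg a.+1)) dt mulNr -(mulrA (tg a)) -mulrN.
by congr (_ * _); rewrite mulrBl mulrBr !cg_sq ?(ltnW h) //; lin C.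
Qed.

Lemma sg_cgS a : (a.+1 < n)%N -> sg a * cg a.+1 = cg a * sg a :> S.
Proof.
move=> h; rewrite -[RHS]mul1r -(sg_sq h) -mulrA (mulrA _ (cg a)) sg_cg //.
by rewrite -(mulrA _ (sg a)) sg_sq // mulr1.
Qed.

Lemma sg_cg_far a b : b != a -> b != a.+1 -> sg a * cg b = cg b * sg a :> S.
Proof.
move=> ba ba1; rewrite /sg -scalerAl -scalerAr; congr (_ *: _).
have e : (cg a.+1 - cg a) * cg b = - (cg b * (cg a.+1 - cg a)) :> S.
  by rewrite mulrBl mulrBr !(@cg_anti _ b) 1?eq_sym //; lin C.
by rewrite -mulrA e mulrN mulrA tcg_anti mulNr opprK mulrA.
Qed.

Lemma sg_far a b : (a.+1 < b)%N || (b.+1 < a)%N -> sg a * sg b = sg b * sg a :> S.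
Proof.
move=> ab; rewrite /sg -!scalerAl -!scalerAr !scalerA; congr (_ *: _).
set u := cg a.+1 - _; set v := cg b.+1 - _.
have uv : u * v = - (v * u).
  rewrite /u /v mulrBr !mulrBl !mulrBr !(@cg_anti a) ?(@cg_anti a.+1); try lia.
  by lin C.
have -> : tg a * u * (tg b * v) = tg a * (u * tg b) * v by rewrite !mulrA.
have -> : tg b * v * (tg a * u) = tg b * (v * tg a) * u by rewrite !mulrA.
have -> : u * tg b = - (tg b * u) by rewrite tcgB'.
have -> : v * tg a = - (tg a * v) by rewrite tcgB'.
by rewrite !(mulrN, mulNr) !mulrA tg_far // !mulNr opprK -(mulrA _ u) uv mulrN mulrA.
Qed.

Lemma sg_braid a : (a.+2 < n)%N ->
  sg a * sg a.+1 * sg a = sg a.+1 * sg a * sg a.+1 :> S.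
Proof.
move=> h; rewrite /sg -!scalerAl -!scalerAr -!scalerAl !scalerA; congr (_ *: _).
set u := cg a.+1 - _; set v := cg a.+2 - _; set t := tg a; set r := tg a.+1.
have ut : u * t = - (t * u) by rewrite tcgB'.
have ur : u * r = - (r * u) by rewrite tcgB'.
have vt : v * t = - (t * v) by rewrite tcgB'.
have vr : v * r = - (r * v) by rewrite tcgB'.
have uu : u * u = (-2)%:A by rewrite cgSubCg_sq // ltnW.
have vv : v * v = (-2)%:A by rewrite cgSubCg_sq.
have uv : u * v = 2%:A - v * u.
  rewrite /u /v mulrBr !mulrBl !mulrBr (@cg_anti a.+1 a.+2) ?ltn_eqF //.
  rewrite (@cg_anti a a.+2) ?ltn_eqF // (@cg_anti a a.+1) ?ltn_eqF //.
  by rewrite cg_sq ?(ltnW h) //; lin C.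
have -> : t * u * (r * v) * (t * u) = - (t * r * t * (u * v * u)).
  have -> : t * u * (r * v) * (t * u) = t * (u * r) * (v * t) * u by rewrite !mulrA.
  rewrite ur vt !(mulrN, mulNr) opprK.
  have -> : t * (r * u) * (t * v) * u = t * r * (u * t) * v * u by rewrite !mulrA.
  by rewrite ut !(mulrN, mulNr) !mulrA.
have -> : r * v * (t * u) * (r * v) = - (r * t * r * (v * u * v)).
  have -> : r * v * (t * u) * (r * v) = r * (v * t) * (u * r) * v by rewrite !mulrA.
  rewrite ur vt !(mulrN, mulNr) opprK.
  have -> : r * (t * v) * (r * u) * v = r * t * (v * r) * u * v by rewrite !mulrA.
  by rewrite vr !(mulrN, mulNr) !mulrA.
have br : t * r * t = r * t * r := tg_braid a.
rewrite br; congr (- (_ * _)).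
rewrite uv mulrBl -(mulrA v u u) uu -(mulrA v u v) uv (mulrBr v 2%:A) (mulrA v v) vv.
by rewrite -!scalerAl -!scalerAr mul1r mulr1; lin C.
Qed.

Lemma jm_cgB_anti a b : (cg b.+1 - cg b) * jm a = - (jm a * (cg b.+1 - cg b)) :> S.
Proof. by rewrite mulrBr mulrBl !(cjm_anti a); lin C. Qed.

Lemma xg_cg a b : b != a -> xg a * cg b = cg b * xg a :> S.
Proof.
move=> ba; rewrite /xg -scalerAl -scalerAr; congr (_ *: _).
by rewrite (mulrA (cg b)) cjm_anti mulNr -!(mulrA (jm a)) -mulrN -cg_anti // eq_sym.
Qed.

Lemma xg_cg_anti a : xg a * cg a = - (cg a * xg a) :> S.
Proof.
rewrite /xg -scalerAl -scalerAr -scalerN; congr (_ *: _).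
by rewrite mulrA cjm_anti mulNr opprK.
Qed.

Lemma sg_xg_far a b : b != a -> b != a.+1 -> sg a * xg b = xg b * sg a :> S.
Proof.
move=> ba ba1; rewrite /sg /xg -!scalerAl -!scalerAr !scalerA mulrC.
congr (_ *: _); set u := _ - _.
have uc : u * cg b = - (cg b * u).
  by rewrite mulrBl mulrBr !(@cg_anti _ b) 1?eq_sym //; lin C.
have uj : u * jm b = - (jm b * u) := jm_cgB_anti _ _.
have tj : tg a * jm b = - (jm b * tg a) :> S by apply: tjm_anti; lia.
have ct : cg b * tg a = - (tg a * cg b) :> S by rewrite tcg_anti opprK.
have cu : cg b * u = - (u * cg b) by rewrite uc opprK.
have -> : tg a * u * (jm b * cg b) = tg a * (u * jm b) * cg b by rewrite !mulrA.
have -> : jm b * cg b * (tg a * u) = jm b * (cg b * tg a) * u :> S by rewrite !mulrA.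
rewrite uj ct !(mulrN, mulNr) (mulrA (tg a)) tj !mulNr opprK.
by rewrite !mulrA -(mulrA _ (cg b)) cu mulrN opprK mulrA.
Qed.

Lemma xg_comm a b : xg a * xg b = xg b * xg a :> S.
Proof.
wlog ab : a b / (a < b)%N => [W|].
  by case: (ltngtP a b) => [/W|/W|->].
rewrite /xg -!scalerAl -!scalerAr !scalerA; congr (_ *: _).
have cj k l : cg k * jm l = - (jm l * cg k) :> S := cjm_anti _ _.
have -> : jm a * cg a * (jm b * cg b) = jm a * (cg a * jm b) * cg b :> S by rewrite !mulrA.
have -> : jm b * cg b * (jm a * cg a) = jm b * (cg b * jm a) * cg a :> S by rewrite !mulrA.
rewrite !cj !(mulrN, mulNr) !mulrA (jm_anti ab) -(mulrA _ (cg a)).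
by rewrite (@cg_anti a b) ?ltn_eqF // !(mulrN, mulNr) opprK mulrA.
Qed.

(** A relation of the degenerate affine Sergeev algebra. The inhomogeneous part $-1+c_ac_{a+1}$
    comes from the summand [tg b] of [jmS]. *)
Lemma sg_xg a : (a.+1 < n)%N ->
  sg a * xg a = xg a.+1 * sg a - 1 + cg a * cg a.+1 :> S.
Proof.
move=> h; rewrite /sg /xg jmS -!scalerAl -!scalerAr !scalerA.
rewrite mulfV ?mulVf ?sqrt2_neq0 // !scale1r.
set t := tg a; set c := cg a; set d := cg a.+1; set m := jm a.
have cc : c * c = -1 by rewrite cg_sq // ltnW.
have dd : d * d = -1 by rewrite cg_sq.
have tt : t * t = 1 by rewrite tg_sq.
have um : (d - c) * m = - (m * (d - c)) := jm_cgB_anti _ _.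
have td : d * t = - (t * d) by rewrite tcg_anti opprK.
have dc : c * d = - (d * c) by rewrite cg_anti // ltn_eqF.
have -> : t * (d - c) * (m * c) = t * ((d - c) * m) * c by rewrite !mulrA.
have -> : (t - t * m * t) * d * (t * (d - c)) = (t - t * m * t) * (d * t) * (d - c).
  by rewrite !mulrA.
rewrite um td !(mulrN, mulNr) -!mulrA !(mulrBl, mulrBr) !mulrA.
rewrite -!(mulrA _ t t) tt mulr1 -!(mulrA _ d d) dd -!(mulrA _ c c) cc.
by rewrite ?mul1r ?mulrN1 dc; lin C.
Qed.

Lemma sg_xgS a : (a.+1 < n)%N ->
  sg a * xg a.+1 = xg a * sg a + 1 + cg a * cg a.+1 :> S.
Proof.
move=> h; have ss := sg_sq h.
have e : sg a * (sg a * xg a) * sg a = xg a * sg a :> S by rewrite mulrA ss mul1r.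
have f : sg a * (cg a * cg a.+1) * sg a = cg a.+1 * cg a :> S.
  by rewrite mulrA sg_cg // -(mulrA (cg _)) sg_cgS // -!mulrA ss mulr1.
move: e; rewrite sg_xg // mulrDr mulrBr mulrDl mulrBl f mulr1 ss.
rewrite -(mulrA (sg a) (_ * _)) -(mulrA (xg _)) ss mulr1 => <-.
by rewrite (@cg_anti a a.+1) ?ltn_eqF //; lin C.
Qed.

End Relations.

(** * Intertwiners in ranks two and three *)

Section RankTwo.
Variables (K : comNzRingType) (A : algType K) (s x y c d : A).
Hypotheses (ss : s * s = 1) (sc : s * c = d * s) (sd : s * d = c * s)
  (xc : x * c = - (c * x)) (xd : x * d = d * x)
  (yc : y * c = c * y) (yd : y * d = - (d * y)) (yx : y * x = x * y)
  (cc : c * c = -1) (dd : d * d = -1) (dc : d * c = - (c * d))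
  (sx : s * x = y * s - 1 + c * d) (sy : s * y = x * s + 1 + c * d).

Let ssA z : s * (s * z) = z. Proof. by rewrite mulrA ss mul1r. Qed.
Let scA z : s * (c * z) = d * (s * z). Proof. by rewrite mulrA sc mulrA. Qed.
Let sdA z : s * (d * z) = c * (s * z). Proof. by rewrite mulrA sd mulrA. Qed.
Let xcA z : x * (c * z) = - (c * (x * z)).
Proof. by rewrite mulrA xc mulNr mulrA. Qed.
Let xdA z : x * (d * z) = d * (x * z). Proof. by rewrite mulrA xd mulrA. Qed.
Let ycA z : y * (c * z) = c * (y * z). Proof. by rewrite mulrA yc mulrA. Qed.
Let ydA z : y * (d * z) = - (d * (y * z)).
Proof. by rewrite mulrA yd mulNr mulrA. Qed.
Let yxA z : y * (x * z) = x * (y * z). Proof. by rewrite mulrA yx mulrA. Qed.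
Let ccA z : c * (c * z) = - z. Proof. by rewrite mulrA cc mulN1r. Qed.
Let ddA z : d * (d * z) = - z. Proof. by rewrite mulrA dd mulN1r. Qed.
Let dcA z : d * (c * z) = - (c * (d * z)).
Proof. by rewrite mulrA dc mulNr mulrA. Qed.
Let sxA z : s * (x * z) = y * (s * z) - z + c * (d * z).
Proof. by rewrite mulrA sx !mulrDl mulN1r -!mulrA. Qed.
Let syA z : s * (y * z) = x * (s * z) + z + c * (d * z).
Proof. by rewrite mulrA sy !mulrDl mul1r -!mulrA. Qed.

(** Oriented rules: products are associated to the right and sorted as [c], [d], [x], [y], [s]. The
    rules ending in [A] repeat the others with a trailing factor, so that they also apply inside a
    longer product. *)
Let nf := (@mulrDl A, @mulrDr A, @mulrN A, @mulNr A, @opprK A, @mulr1 A, @mul1r A,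
  (ss, sc, sd, xc, xd, yc, yd), (yx, cc, dd, dc, sx, sy),
  (ssA, scA, sdA, xcA, xdA, ycA, ydA), (yxA, ccA, ddA, dcA, sxA, syA)).

Definition intertwiner : A := s * (x * x - y * y) + x + y - c * d * (x - y).
Local Notation f := intertwiner.

Let fE : f = x * (x * s) * -1 + y * (y * s) - x - y + c * (d * x) - c * (d * y).
Proof. by rewrite /f; rewrite !(nf, =^~ mulrA); lin K. Qed.

Lemma intertwiner_x : f * x = y * f.
Proof. by rewrite fE; rewrite !(nf, =^~ mulrA); lin K. Qed.

Lemma intertwiner_y : f * y = x * f.
Proof. by rewrite fE; rewrite !(nf, =^~ mulrA); lin K. Qed.

Lemma intertwiner_c : f * c = d * f.
Proof. by rewrite fE; rewrite !(nf, =^~ mulrA); lin K. Qed.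

Lemma intertwiner_d : f * d = c * f.
Proof. by rewrite fE; rewrite !(nf, =^~ mulrA); lin K. Qed.

Lemma intertwiner_sq :
  f * f = 2 *: (x * x + y * y) - (x * x - y * y) * (x * x - y * y).
Proof.
(* One factor is hidden behind [g], of which only the commutation rules are used while the other is
   expanded; this keeps the normal forms small. *)
have [g gE] : exists g, g = f by exists f.
have [gx gy gc gd] : [/\ g * x = y * g, g * y = x * g, g * c = d * g & g * d = c * g].
  by rewrite gE intertwiner_x intertwiner_y intertwiner_c intertwiner_d.
have gA z : [/\ g * (x * z) = y * (g * z), g * (y * z) = x * (g * z),
    g * (c * z) = d * (g * z) & g * (d * z) = c * (g * z)].
  by rewrite !mulrA gx gy gc gd.
have {gA} [gxA gyA] : (forall z, g * (x * z) = y * (g * z)) /\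
  (forall z, g * (y * z) = x * (g * z)) by split=> z; case: (gA z).
have gcdA z : g * (c * (d * z)) = d * (c * (g * z)).
  by rewrite mulrA gc -mulrA (mulrA g) gd !mulrA.
have -> : f * f = y * (y * (g * s)) * -1 + x * (x * (g * s)) - y * g - x * g
     + d * (c * (y * g)) - d * (c * (x * g)).
  rewrite -{1}gE fE !(mulrDr, mulrN, mulr1) !(gxA, gyA, gcdA) gx gy.
  by [].
by rewrite gE fE; rewrite !(nf, =^~ mulrA); lin K.
Qed.

End RankTwo.

(* [a], [b], [d] stand for the products c_1 c_2, c_2 c_3, c_1 c_3 of three
   Clifford generators permuted by the adjacent transpositions [s] and [r]. *)
Section RankThree.
Variables (K : comNzRingType) (A : algType K) (s r a b d : A).
Hypotheses (ss : s * s = 1) (rr : r * r = 1) (srs : s * r * s = r * s * r)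
  (sa : s * a = - (a * s)) (sb : s * b = d * s) (sd : s * d = b * s)
  (ra : r * a = d * r) (rb : r * b = - (b * r)) (rd : r * d = a * r)
  (aa : a * a = -1) (bb : b * b = -1) (dd : d * d = -1)
  (ab : a * b = - d) (ba : b * a = d) (bd : b * d = - a) (db : d * b = a)
  (ad : a * d = b) (da : d * a = - b).

Let mA (x y z w : A) : x * y = z * w -> forall t, x * (y * t) = z * (w * t).
Proof. by move=> e t; rewrite mulrA e mulrA. Qed.
Let mN (x y z w : A) : x * y = - (z * w) -> forall t, x * (y * t) = - (z * (w * t)).
Proof. by move=> e t; rewrite mulrA e mulNr mulrA. Qed.
Let m1 (x y z : A) : x * y = z -> forall t, x * (y * t) = z * t.
Proof. by move=> e t; rewrite mulrA e. Qed.
Let m2 (x y z : A) : x * y = - z -> forall t, x * (y * t) = - (z * t).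
Proof. by move=> e t; rewrite mulrA e mulNr. Qed.

Let rsr : r * (s * r) = s * (r * s).
Proof. by rewrite !mulrA srs. Qed.

Let nfA := (m1 ss, m1 rr, mN sa, mA sb, mA sd, mA ra, mN rb, mA rd,
  (m2 aa, m2 bb, m2 dd, m2 ab, m1 ba, m2 bd, m1 db, m1 ad, m2 da)).

Let nf1 := (@mulrDl A, @mulrDr A, @mulrN A, @mulNr A, @opprK A, @mulr1 A,
  @mul1r A, (fun k x y => esym (@scalerAl K A k x y)),
  (fun k x y => esym (@scalerAr K A k x y))).

Let nf2 := ((ss, rr, rsr, sa, sb, sd, ra, rb, rd),
  (aa, bb, dd, ab, ba, bd, db, ad, da), nfA).

Let nf := (nf1, nf2).

(* The Yang-Baxter equation satisfied by the values of the intertwiners on a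
   weight vector. *)
Lemma weight_braid (u v w : K) :
  let g (t c : A) (k l : K) :=
    (k * k - l * l) *: t + (k + l)%:A - (k - l) *: c in
  g s a v w * g r b u w * g s a u v =
  g r b u v * g s a u w * g r b v w.
Proof.
rewrite /=.
(* The nine coefficients stay opaque while words in [s], [r] and the Clifford products are
   normalized, and are opened only when coefficients are compared. *)
have [d1 e1] : exists k, k = v * v - w * w by eexists.
have [d2 e2] : exists k, k = u * u - w * w by eexists.
have [d3 e3] : exists k, k = u * u - v * v by eexists.
have [a1 f1] : exists k, k = v + w by eexists.
have [a2 f2] : exists k, k = u + w by eexists.
have [a3 f3] : exists k, k = u + v by eexists.
have [b1 g1] : exists k, k = v - w by eexists.
have [b2 g2] : exists k, k = u - w by eexists.
have [b3 g3] : exists k, k = u - v by eexists.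
rewrite -e1 -e2 -e3 -f1 -f2 -f3 -g1 -g2 -g3.
rewrite !nf1 -!mulrA !nf.
by lin_coefs K; rewrite ?(e1, e2, e3) ?(f1, f2, f3) ?(g1, g2, g3); ring.
Qed.

Variables (p q : K) (z : A).

(* A weight vector on which both intertwiners vanish spans a module over the
   Clifford algebra; the braid relation then excludes all but one value of the
   weight. *)
Lemma local_exclusion :
  s * z = p *: z + q *: (a * z) ->
  r * z = - p *: z + q *: (b * z) ->
  (2 * (p ^+ 3 - q ^+ 3)) *: z = 0.
Proof.
move=> sz rz; have e : s * (r * (s * z)) = r * (s * (r * z)).
  by rewrite !mulrA srs.
have := subrr (r * (s * (r * z))); rewrite -{1}e.
rewrite ?(sz, rz) !(nf, =^~ mulrA, sz, rz) => h.
rewrite -oppr0 -h; lin K.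
Qed.

(** The analogue of [local_exclusion] for a Jordan block, whose nilpotent part is carried by [y].
    Both coefficients equal [p] here, so that the scalar $p^3-q^3$ vanishes and gives nothing. The
    braid relation now yields [y + d * y = 0] up to a scalar, and [1 + d] is invertible because
    [d * d = -1]. *)
Lemma local_semisimple (y : A) :  s * z = p *: z + p *: (a * z) ->
  r * z = - p *: z + p *: (b * z) - y - b * y ->
  s * y = p *: y + p *: (a * y) ->
  r * y = - p *: y + p *: (b * y) ->
  (p * p * 12) *: y = 0.
Proof.
move=> sz rz sy ry; have e : s * (r * (s * z)) = r * (s * (r * z)).
  by rewrite !mulrA srs.
have := subrr (r * (s * (r * z))); rewrite -{1}e.
rewrite ?(sz, rz) !(nf, =^~ mulrA, sz, rz, sy, ry) => h.
have g : (p * p * 6) *: (y + d * y) = 0 by rewrite -oppr0 -h; lin K.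
(* [1 - d] is twice the inverse of [1 + d], whence the constant 12 from 6. *)
have := congr1 (fun t => t - d * t) g.
rewrite !(nf, =^~ mulrA, mulr0, subr0) => <-; lin K.
Qed.

End RankThree.

(** * The intertwiners of the superalgebra and their commutation rules *)

Section Intertwiners.
Variables (C : numClosedFieldType) (n : nat).
Local Notation S := (sergeev C n).
Implicit Types (a b : nat) (z : S).

Lemma phiE a : phi a = intertwiner (sg a) (xg a) (xg a.+1) (cg a) (cg a.+1) :> S.
Proof. by []. Qed.

Section AtIndex.
Variables (a : nat) (h : (a.+1 < n)%N).

Let aa1 : a != a.+1. Proof. by rewrite ltn_eqF. Qed.
Let a1a : a.+1 != a. Proof. by rewrite gtn_eqF. Qed.
Let hyps := (sg_sq C h, sg_cg C h, sg_cgS C h, sg_xg C h, sg_xgS C h).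

Lemma phi_xg : phi a * xg a = xg a.+1 * phi a :> S.
Proof.
rewrite phiE; apply: intertwiner_x; rewrite ?hyps ?xg_cg_anti ?xg_cg ?cg_sq ?(ltnW h) //;
  by [exact: xg_comm | rewrite cg_anti].
Qed.

Lemma phi_xgS : phi a * xg a.+1 = xg a * phi a :> S.
Proof.
rewrite phiE; apply: intertwiner_y; rewrite ?hyps ?xg_cg_anti ?xg_cg ?cg_sq ?(ltnW h) //;
  by [exact: xg_comm | rewrite cg_anti].
Qed.

Lemma phi_cg : phi a * cg a = cg a.+1 * phi a :> S.
Proof.
rewrite phiE; apply: intertwiner_c; rewrite ?hyps ?xg_cg_anti ?xg_cg ?cg_sq ?(ltnW h) //;
  by [exact: xg_comm | rewrite cg_anti].
Qed.

Lemma phi_cgS : phi a * cg a.+1 = cg a * phi a :> S.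
Proof.
rewrite phiE; apply: intertwiner_d; rewrite ?hyps ?xg_cg_anti ?xg_cg ?cg_sq ?(ltnW h) //;
  by [exact: xg_comm | rewrite cg_anti].
Qed.

Lemma phi_sq : phi a * phi a =
  2 *: (xg a * xg a + xg a.+1 * xg a.+1)
  - (xg a * xg a - xg a.+1 * xg a.+1) * (xg a * xg a - xg a.+1 * xg a.+1) :> S.
Proof.
rewrite phiE; apply: intertwiner_sq; rewrite ?hyps ?xg_cg_anti ?xg_cg ?cg_sq ?(ltnW h) //;
  by [exact: xg_comm | rewrite cg_anti].
Qed.
End AtIndex.

Lemma comm_phi (y : S) a : GRing.comm y (sg a) -> GRing.comm y (xg a) ->
  GRing.comm y (xg a.+1) -> GRing.comm y (cg a * cg a.+1) -> GRing.comm y (phi a).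
Proof.
move=> ys yx yx' yc; apply: commrB; last by apply: commrM => //; apply: commrB.
by do 2!apply: commrD => //; apply: commrM => //; apply: commrB; apply: commrX.
Qed.

Lemma phi_xg_far a b : b != a -> b != a.+1 -> phi a * xg b = xg b * phi a :> S.
Proof.
move=> ba ba1; apply/esym/comm_phi; try exact: xg_comm.
  exact/esym/sg_xg_far.
by apply: commrM; apply: xg_cg; rewrite eq_sym.
Qed.

Lemma phi_cg_far a b : b != a -> b != a.+1 -> phi a * cg b = cg b * phi a :> S.
Proof.
move=> ba ba1; apply/esym/comm_phi; try exact/esym/xg_cg.
  exact/esym/sg_cg_far.
rewrite /GRing.comm mulrA (@cg_anti _ _ b a) // mulNr -(mulrA (cg a) (cg b)) (@cg_anti _ _ b a.+1) //.
by rewrite mulrN opprK mulrA.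
Qed.

Lemma phi_far a b : (a.+1 < b)%N || (b.+1 < a)%N ->
  phi a * phi b = phi b * phi a :> S.
Proof.
move=> ab; apply: comm_phi.
- apply/esym/comm_phi; first by apply/sg_far; rewrite orbC.
  + by apply: sg_xg_far; lia.
  + by apply: sg_xg_far; lia.
  by apply: commrM; apply: sg_cg_far; lia.
- by apply: phi_xg_far; lia.
- by apply: phi_xg_far; lia.
by apply: commrM; apply: phi_cg_far; lia.
Qed.

(** In [phi a] the Jucys-Murphy elements stand to the right of [sg a] and of the Clifford product,
    so on [z] they become their eigenvalues. *)
Lemma phi_weight a (u w : C) z : xg a * z = u *: z -> xg a.+1 * z = w *: z ->
  phi a * z = ((u * u - w * w) *: sg a + (u + w)%:A - (u - w) *: (cg a * cg a.+1)) * z.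
Proof.
move=> zu zw.
have e1 : (xg a * xg a - xg a.+1 * xg a.+1) * z = (u * u - w * w) *: z.
  by rewrite mulrBl -!mulrA zu zw -!scalerAr zu zw; lin C.
have e2 : (xg a - xg a.+1) * z = (u - w) *: z by rewrite mulrBl zu zw; lin C.
rewrite phiE /intertwiner !(mulrDl _ _ z) !(mulNr _ z) -(mulrA _ _ z) e1.
rewrite -(mulrA (cg a * _) _ z) e2 zu zw -!scalerAr -!scalerAl mul1r.
by lin C.
Qed.

End Intertwiners.

(** * Lattice words and weight vectors *)

Section LatticeWords.
Implicit Types (w p : seq nat) (i j l : nat).

(* A standard shifted tableau is encoded by the word of the rows of its
   entries; the box added in row [i] to the shape of [w] has content
   [rowlen w i]. *)
Definition rowlen w i : nat := count_mem i w.

Definition addable_row w i :=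
  (i == 0)%N || ((rowlen w i).+1 < rowlen w i.-1)%N.

Fixpoint lattice_from p w :=
  if w is i :: w' then addable_row p i && lattice_from (rcons p i) w' else true.

(** The shifted analogue of a Yamanouchi word: the row lengths of every prefix form a strict
    partition. *)
Definition lattice w := lattice_from [::] w.

Definition wcont w k := rowlen (take k w) (nth 0%N w k).

Lemma lattice_from_cat p w1 w2 :
  lattice_from p (w1 ++ w2) = lattice_from p w1 && lattice_from (p ++ w1) w2.
Proof.
elim: w1 p => [|i w1 IH] p /=; first by rewrite cats0.
by rewrite IH -andbA cat_rcons.
Qed.

Lemma lattice_cat w1 w2 : lattice (w1 ++ w2) = lattice w1 && lattice_from w1 w2.
Proof. exact: lattice_from_cat. Qed.

Lemma lattice_rcons w i : lattice (rcons w i) = lattice w && addable_row w i.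
Proof. by rewrite -cats1 lattice_cat /= andbT. Qed.

Lemma perm_addable_row w w' i : perm_eq w w' -> addable_row w i = addable_row w' i.
Proof. by move/seq.permP=> e; rewrite /addable_row /rowlen !e. Qed.

Lemma perm_lattice_from p p' w : perm_eq p p' -> lattice_from p w = lattice_from p' w.
Proof.
elim: w p p' => //= i w IH p p' pp'; rewrite (perm_addable_row _ pp').
by rewrite (IH _ (rcons p' i)) // -!cats1 perm_cat2r.
Qed.

Lemma rowlen_rcons i j w : rowlen (rcons w j) i = (rowlen w i + (j == i))%N.
Proof. by rewrite /rowlen -cats1 count_cat /= addn0. Qed.

Lemma lattice_decr w i : lattice w ->
  (rowlen w i.+1 <= (rowlen w i).-1)%N.
Proof.
elim/last_ind: w => [//|w j IH]; rewrite lattice_rcons => /andP[/IH le].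
rewrite /addable_row !rowlen_rcons.
case: (eqVneq j i.+1) => [-> /=|ji] .
  by rewrite gtn_eqF //; lia.
by case: (j == i) => _ /=; lia.
Qed.

Lemma lattice_mono w i j : lattice w -> (i <= j)%N -> (rowlen w j <= rowlen w i)%N.
Proof.
move=> hw; elim: j => [|j IH]; first by rewrite leqn0 => /eqP->.
rewrite leq_eqVlt => /orP[/eqP->//|]; rewrite ltnS => /IH.
by have := lattice_decr j hw; lia.
Qed.

Lemma addable_gap w i j : lattice w -> (i < j)%N -> addable_row w j ->
  ((rowlen w j).+2 <= rowlen w i)%N.
Proof.
case: j => // j hw; rewrite ltnS => /(lattice_mono hw) le.
by rewrite /addable_row /= => h; apply: leq_trans le.
Qed.

(** The combinatorial source of all exclusions: a content at distance 1 from that of an addable box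
    is never the content of another addable box. *)
Lemma addable_gap2 w i j : lattice w -> i != j -> addable_row w i -> addable_row w j ->
  ((rowlen w j).+2 <= rowlen w i)%N || ((rowlen w i).+2 <= rowlen w j)%N.
Proof.
move=> hw ij ai aj; case: (ltngtP i j) ij => // ij _.
  by rewrite addable_gap.
by rewrite orbC addable_gap.
Qed.

Lemma addable_inj w i j : lattice w -> addable_row w i -> addable_row w j ->
  rowlen w i = rowlen w j -> i = j.
Proof.
move=> hw ai aj e; apply/eqP; apply: contraT => ij.
by have := addable_gap2 hw ij ai aj; rewrite e ltnNge leqnSn.
Qed.

Lemma addable_row_rcons w i l : i != l -> addable_row w i -> addable_row (rcons w l) i.
Proof.
by move=> il; rewrite /addable_row !rowlen_rcons (eq_sym l i) (negbTE il) => /orP[->//|h]; lia.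
Qed.

(** A box of row [h] can depend on the box of row [j] placed just before it only if [h = j.+1]; the
    second hypothesis says that row [j] was long enough without it. *)
Lemma lattice_swap w0 j h w1 : lattice (w0 ++ [:: j, h & w1]) -> h != j ->
  (h = j.+1 -> ((rowlen w0 h).+1 < rowlen w0 j)%N) ->
  [/\ lattice (w0 ++ [:: h, j & w1]), addable_row w0 j & addable_row w0 h].
Proof.
move=> L hj E; move: L; rewrite !lattice_cat /= => /andP[L0 /and3P[aj ah L1]].
have ah0 : addable_row w0 h.
  move: ah; rewrite /addable_row !rowlen_rcons (eq_sym j) (negbTE hj) addn0.
  case: eqP => //= h0; case: eqP => [e|_]; last by rewrite addn0.
  have e' : h = j.+1 by rewrite e prednK // lt0n; apply/eqP.
  by move=> _; rewrite -e E.
have aj1 : addable_row (rcons w0 h) j by rewrite addable_row_rcons // eq_sym.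
split=> //; rewrite L0 ah0 aj1 /= -(perm_lattice_from _ (_ : perm_eq (rcons (rcons w0 j) h) _)) //.
by rewrite -!cats1 -!catA perm_cat2l (perm_catC [:: j]).
Qed.

Lemma last_occurrence (i : nat) w : i \in w ->
  exists w0 w1, w = w0 ++ i :: w1 /\ i \notin w1.
Proof.
elim: w => // j w IH; rewrite inE.
case: (boolP (i \in w)) => [/IH [w0 [w1 [-> n1]]] _|niw].
  by exists (j :: w0), w1.
by rewrite orbF => /eqP <-; exists [::], w.
Qed.

End LatticeWords.

(** * Contents and the square of an intertwiner *)

Section Scalars.
Variable C : numClosedFieldType.

Definition kq (s : nat) : C := sqrtC (s * s.+1)%:R.

Lemma kq_sq s : kq s * kq s = (s * s.+1)%:R.
Proof. by rewrite -expr2 sqrtCK. Qed.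

Lemma natr_inj (s t : nat) : s%:R = t%:R :> C -> s = t.
Proof. by move/eqP; rewrite eqr_nat => /eqP. Qed.

Lemma kq_sq_inj s t : kq s * kq s = kq t * kq t -> s = t.
Proof. by rewrite !kq_sq => /natr_inj; nia. Qed.

Lemma kq_eq0 s : (kq s == 0) = (s == 0)%N.
Proof. by rewrite /kq sqrtC_eq0 pnatr_eq0 muln_eq0 orbF. Qed.

Lemma kq0 : kq 0 = 0. Proof. by apply/eqP; rewrite kq_eq0. Qed.

(* The value of the square of an intertwiner on a vector on which the first
   Jucys--Murphy element is [kq s] and the second has square [B]. *)
Definition phi_scalar (s : nat) (B : C) : C :=
  2 * ((s * s.+1)%:R + B) - ((s * s.+1)%:R - B) * ((s * s.+1)%:R - B).

(** The roots are the squares of the contents [kq s.+1] and [kq s.-1], so an intertwiner degenerates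
    at neighbouring contents. For [s = 0] the second root is 0, since [0.-1] is 0. *)
Lemma phi_scalarE s B :
  phi_scalar s B = - ((B - (s.+1 * s.+2)%:R) * (B - (s * s.-1)%:R)).
Proof.
case: s => [|s]; rewrite /phi_scalar /= ?mul0n; first by rewrite -!natr1; ring.
by rewrite !natrM -!natr1; ring.
Qed.

Lemma phi_scalar_neq0 s t : (s.+2 <= t)%N || (t.+2 <= s)%N ->
  phi_scalar s (kq t * kq t) != 0.
Proof.
move=> st; rewrite phi_scalarE kq_sq oppr_eq0 mulf_eq0 !subr_eq0 !eqr_nat.
by apply/norP; split; apply/eqP; nia.
Qed.

Lemma phi_scalar_eq0 s B : phi_scalar s B = 0 ->
  B = (s.+1 * s.+2)%:R \/ B = (s * s.-1)%:R.
Proof.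
rewrite phi_scalarE => /eqP; rewrite oppr_eq0 mulf_eq0 !subr_eq0.
by case/orP=> /eqP; [left | right].
Qed.
End Scalars.

Arguments kq {C} s.

Section Weights.
Variables (C : numClosedFieldType) (n : nat).
Local Notation S := (sergeev C n).
Implicit Types (w : seq nat) (z y : S) (b : C).

Definition weight w z := forall k, (k < size w)%N -> xg k * z = kq (wcont w k) *: z.

Lemma wcont_cat w1 w2 k : (k < size w1)%N -> wcont (w1 ++ w2) k = wcont w1 k.
Proof. by move=> h; rewrite /wcont nth_cat h takel_cat // ltnW. Qed.

Lemma wcont_mid w1 i w2 : wcont (w1 ++ i :: w2) (size w1) = rowlen w1 i.
Proof. by rewrite /wcont nth_cat ltnn subnn /= take_size_cat. Qed.

Lemma wcont_rcons w i : wcont (rcons w i) (size w) = rowlen w i.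
Proof. by rewrite -cats1 wcont_mid. Qed.

Lemma perm_wcont p p' w k : perm_eq p p' -> (size p <= k)%N ->
  wcont (p ++ w) k = wcont (p' ++ w) k.
Proof.
move=> pp' hk; rewrite /wcont !nth_cat !take_cat -(perm_size pp') ltnNge hk /=.
by rewrite /rowlen !count_cat (seq.permP pp').
Qed.

Lemma weight_catl w1 w2 z : weight (w1 ++ w2) z -> weight w1 z.
Proof.
by move=> wz k hk; rewrite wz ?size_cat ?wcont_cat // ltn_addr.
Qed.

Lemma weight_rcons w i z :
  weight (rcons w i) z <-> weight w z /\ xg (size w) * z = kq (rowlen w i) *: z.
Proof.
split=> [wz|[wz e] k].
  split; first by move: wz; rewrite -cats1 => /weight_catl.
  by rewrite wz ?size_rcons // wcont_rcons.
rewrite size_rcons ltnS leq_eqVlt => /orP[/eqP->|hk]; first by rewrite wcont_rcons.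
by rewrite -cats1 wcont_cat // wz.
Qed.

Lemma weightZ w z k : weight w z -> weight w (k *: z).
Proof. by move=> wz j hj; rewrite -scalerAr wz // !scalerA mulrC. Qed.

Lemma weightD w z y : weight w z -> weight w y -> weight w (z + y).
Proof. by move=> wz wy j hj; rewrite mulrDr wz // wy // scalerDr. Qed.

Lemma weight_comm w u z : (forall k, (k < size w)%N -> GRing.comm (xg k) u) ->
  weight w z -> weight w (u * z).
Proof. by move=> cu wz k hk; rewrite mulrA cu // -mulrA wz // -scalerAr. Qed.

Lemma weight_xg w k z : weight w z -> weight w (xg k * z).
Proof. by apply: weight_comm => j _; apply: xg_comm. Qed.

Lemma weight_cg w k z : (size w <= k)%N -> weight w z -> weight w (cg k * z).
Proof. by move=> wk; apply: weight_comm => j hj; apply: xg_cg; lia. Qed.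

Lemma weight_sg w k z : (size w <= k)%N -> weight w z -> weight w (sg k * z).
Proof. by move=> wk; apply: weight_comm => j hj; apply/esym/sg_xg_far; lia. Qed.

Lemma weight_phi_last w k z : (size w <= k)%N -> weight w z -> weight w (phi k * z).
Proof. by move=> wk; apply: weight_comm => j hj; apply/esym/phi_xg_far; lia. Qed.

Lemma phi_xg_far' k a : k != a -> k != a.+1 -> xg k * phi a = phi a * xg k :> S.
Proof. by move=> h1 h2; apply/esym/phi_xg_far. Qed.

(** As [h != j], the two rows are filled independently: their contents are merely exchanged, and the
    later contents only see a permuted prefix. *)
Lemma weight_phi w0 j h w1 z : ((size w0).+1 < n)%N -> h != j ->
  weight (w0 ++ [:: j, h & w1]) z ->
  weight (w0 ++ [:: h, j & w1]) (phi (size w0) * z).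
Proof.
move=> sn hj wz k; rewrite size_cat /= => hk.
have hk' : (k < size (w0 ++ [:: j, h & w1]))%N by rewrite size_cat.
have [k0|k0|->] := ltngtP k (size w0).
- have d1 : k != size w0 by rewrite ltn_eqF.
  have d2 : k != (size w0).+1 by rewrite ltn_eqF // ltnS ltnW.
  rewrite wcont_cat // mulrA phi_xg_far' //.
  by rewrite -mulrA wz // wcont_cat // scalerAr.
- have [k1|k1] := eqVneq k (size w0).+1.
    rewrite k1 in hk' *; rewrite mulrA -phi_xg // -mulrA wz ?wcont_mid ?size_cat //=; last by lia.
    rewrite scalerAr; congr (_ * (kq _ *: _)).
    rewrite -cat_rcons -(size_rcons w0 h) wcont_mid.
    by rewrite rowlen_rcons (negbTE hj) addn0.
  have k2 : (size (w0 ++ [:: j; h]) <= k)%N.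
    by rewrite size_cat /= addn2 ltn_neqAle eq_sym k1.
  rewrite mulrA phi_xg_far' ?(gtn_eqF k0) // -mulrA wz // scalerAr; congr (_ * (kq _ *: _)).
  have catr (l m : nat) : w0 ++ [:: l, m & w1] = (w0 ++ [:: l; m]) ++ w1.
    by rewrite -catA.
  rewrite !catr.
  by apply: perm_wcont => //; rewrite perm_cat2l (perm_catC [:: j]).
rewrite mulrA -phi_xgS // -mulrA wz ?size_cat /=; last by lia.
rewrite scalerAr wcont_mid; congr (_ * (kq _ *: _)).
rewrite -cat_rcons -(size_rcons w0 j) wcont_mid.
by rewrite rowlen_rcons eq_sym (negbTE hj) addn0.
Qed.

Lemma phi_sq_weight a (u w : C) z : (a.+1 < n)%N ->
  xg a * z = u *: z -> xg a.+1 * (xg a.+1 * z) = w *: z ->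
  phi a * (phi a * z) = (2 * (u * u + w) - (u * u - w) * (u * u - w)) *: z.
Proof.
move=> h zu zw; rewrite mulrA phi_sq //.
have e1 : xg a * (xg a * z) = (u * u) *: z by rewrite zu -scalerAr zu scalerA.
have e2 : (xg a * xg a - xg a.+1 * xg a.+1) * z = (u * u - w) *: z.
  by rewrite mulrBl -!mulrA e1 zw; lin C.
rewrite mulrBl -scalerAl mulrDl -!mulrA e1 zw mulrA.
by rewrite -mulrA e2 -scalerAr e2; lin C.
Qed.

Lemma phi_sq_kq a s B z : (a.+1 < n)%N -> xg a * z = kq s *: z ->
  xg a.+1 * (xg a.+1 * z) = B *: z ->
  phi a * (phi a * z) = phi_scalar s B *: z.
Proof. by move=> h zu zw; rewrite (phi_sq_weight h zu zw) kq_sq. Qed.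

Lemma phi_eq0 a s B z : (a.+1 < n)%N -> xg a * z = kq s *: z ->
  xg a.+1 * (xg a.+1 * z) = B *: z -> phi_scalar s B != 0 ->
  phi a * z = 0 -> z = 0.
Proof.
move=> h zu zw nz e; have := phi_sq_kq h zu zw; rewrite e mulr0 => /esym/eqP.
by rewrite scaler_eq0 (negbTE nz) => /eqP.
Qed.

Lemma eigen2 (x z : S) (b : C) : x * z = b *: z -> x * (x * z) = (b * b) *: z.
Proof. by move=> e; rewrite e -scalerAr e scalerA. Qed.

Lemma cg_eq0 k z : (k < n)%N -> cg k * z = 0 -> z = 0.
Proof.
move=> hk e; have := cg_sq C hk; move/(congr1 (fun t => t * z)).
by rewrite -mulrA e mulr0 mulN1r => /esym/eqP; rewrite oppr_eq0 => /eqP.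
Qed.

(** Squares cover the unbarred and the barred entry of a box at once; multiplication by the Clifford
    generator of the same index exchanges the two signs. *)
Definition weight_root w b :=
  exists2 i, addable_row w i & b * b = kq (rowlen w i) * kq (rowlen w i).

End Weights.

(** * The spectrum of the Jucys--Murphy elements *)

Section ThreeStrands.
Variables (C : numClosedFieldType) (n m : nat) (h : (m.+2 < n)%N).
Local Notation S := (sergeev C n).
Let h1 : (m.+1 < n)%N. Proof. exact: ltnW. Qed.
Let h0 : (m < n)%N. Proof. exact: ltnW. Qed.
Local Notation s := (sg m : S).
Local Notation r := (sg m.+1 : S).
Local Notation a := (cg m * cg m.+1 : S).
Local Notation b := (cg m.+1 * cg m.+2 : S).
Local Notation d := (cg m * cg m.+2 : S).

Let c01 : cg m.+1 * cg m = - (cg m * cg m.+1) :> S.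
Proof. by rewrite cg_anti // gtn_eqF. Qed.
Let c02 : cg m.+2 * cg m = - (cg m * cg m.+2) :> S.
Proof. by rewrite cg_anti // gtn_eqF // ltnW. Qed.
Let c12 : cg m.+2 * cg m.+1 = - (cg m.+1 * cg m.+2) :> S.
Proof. by rewrite cg_anti // gtn_eqF. Qed.
Let cA (k l : nat) : cg k * cg l = - (cg l * cg k) :> S ->
  forall z : S, cg k * (cg l * z) = - (cg l * (cg k * z)).
Proof. by move=> e z; rewrite mulrA e mulNr mulrA. Qed.
Let qA (k : nat) : (k < n)%N -> forall z : S, cg k * (cg k * z) = - z.
Proof. by move=> hk z; rewrite mulrA cg_sq // mulN1r. Qed.

Let sA (t : S) (k l : nat) : t * cg k = cg l * t ->
  forall z, t * (cg k * z) = cg l * (t * z).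
Proof. by move=> e z; rewrite mulrA e mulrA. Qed.

Let s0 := sg_cg C h1.
Let s1 := sg_cgS C h1.
Let s2 : s * cg m.+2 = cg m.+2 * s.
Proof. by apply: sg_cg_far; rewrite gtn_eqF // ltnW. Qed.
Let r0 : r * cg m = cg m * r.
Proof. by apply: sg_cg_far; rewrite ltn_eqF // ltnW. Qed.
Let r1 := sg_cg C h.
Let r2 := sg_cgS C h.

Let nf := (sA s0, sA s1, sA s2, sA r0, sA r1, sA r2,
  (s0, s1, s2, r0, r1, r2),
  (cA c01, cA c02, cA c12, qA h, qA h1, qA h0),
  (c01, c02, c12, cg_sq C h, cg_sq C h1, cg_sq C h0),
  (@mulrN S, @mulNr S, @opprK S, @mulr1 S, @mul1r S)).

Let ss : s * s = 1. Proof. exact: sg_sq. Qed.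
Let rr : r * r = 1. Proof. exact: sg_sq. Qed.
Let srs : s * r * s = r * s * r. Proof. exact: sg_braid. Qed.
Let sa : s * a = - (a * s).
Proof. by rewrite !(nf, =^~ mulrA). Qed.
Let sb : s * b = d * s.
Proof. by rewrite !(nf, =^~ mulrA). Qed.
Let sd : s * d = b * s.
Proof. by rewrite !(nf, =^~ mulrA). Qed.
Let ra : r * a = d * r.
Proof. by rewrite !(nf, =^~ mulrA). Qed.
Let rb : r * b = - (b * r).
Proof. by rewrite !(nf, =^~ mulrA). Qed.
Let rd : r * d = a * r.
Proof. by rewrite !(nf, =^~ mulrA). Qed.
Let aa : a * a = -1.
Proof. by rewrite !(nf, =^~ mulrA). Qed.
Let bb : b * b = -1.
Proof. by rewrite !(nf, =^~ mulrA). Qed.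
Let dd : d * d = -1.
Proof. by rewrite !(nf, =^~ mulrA). Qed.
Let ab : a * b = - d.
Proof. by rewrite !(nf, =^~ mulrA). Qed.
Let ba : b * a = d.
Proof. by rewrite !(nf, =^~ mulrA). Qed.
Let bd : b * d = - a.
Proof. by rewrite !(nf, =^~ mulrA). Qed.
Let db : d * b = a.
Proof. by rewrite !(nf, =^~ mulrA). Qed.
Let ad : a * d = b.
Proof. by rewrite !(nf, =^~ mulrA). Qed.
Let da : d * a = - b.
Proof. by rewrite !(nf, =^~ mulrA). Qed.

Lemma sg_weight_braid (u v w : C) :
  let g (t c : S) (k l : C) :=
    (k * k - l * l) *: t + (k + l)%:A - (k - l) *: c in
  g s a v w * g r b u w * g s a u v = g r b u v * g s a u w * g r b v w.
Proof. exact: (@weight_braid _ _ s r a b d). Qed.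

Lemma sg_local_exclusion (p q : C) (z : S) :
  s * z = p *: z + q *: (a * z) -> r * z = - p *: z + q *: (b * z) ->
  (2 * (p ^+ 3 - q ^+ 3)) *: z = 0.
Proof. exact: (@local_exclusion _ _ s r a b d). Qed.

Lemma sg_local_semisimple (p : C) (z y : S) :
  s * z = p *: z + p *: (a * z) ->
  r * z = - p *: z + p *: (b * z) - y - b * y ->
  s * y = p *: y + p *: (a * y) -> r * y = - p *: y + p *: (b * y) ->
  (p * p * 12) *: y = 0.
Proof. exact: (@local_semisimple _ _ s r a b d). Qed.

End ThreeStrands.

(** * Exclusion of contents on three adjacent strands *)

Section LocalVanishing.
Variables (C : numClosedFieldType) (n : nat).
Local Notation S := (sergeev C n).
Implicit Types (z : S) (u v b : C).

Lemma phi0_sg a u v z : xg a * z = u *: z -> xg a.+1 * z = v *: z ->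
  u * u != v * v -> phi a * z = 0 ->
  sg a * z = (v - u)^-1 *: z + (v + u)^-1 *: (cg a * cg a.+1 * z).
Proof.
move=> zu zv uv; rewrite (phi_weight zu zv) !mulrDl mulNr -!scalerAl mul1r => e.
have uv0 : u * u - v * v != 0 by rewrite subr_eq0.
have /norP[n1 n2] : ~~ ((v - u == 0) || (v + u == 0)).
  by rewrite -mulf_eq0 (_ : _ * _ = - (u * u - v * v)) ?oppr_eq0 //; ring.
apply: (scalerI uv0); rewrite -[LHS]subr0 -e.
by lin_coefs C; field; rewrite n1 n2 sqrt2_neq0.
Qed.

(** This is the scalar of [sg_local_exclusion]. It would vanish for [t = 0], and rightly so:
    contents 0, 1, 0 do occur, when the second row is opened. *)
Lemma kq_cube_neq (s t : nat) : t != 0%N -> s != t ->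
  ((kq s - kq t)^-1 ^+ 3 - (kq s + kq t)^-1 ^+ 3 : C) != 0.
Proof.
move=> t0 st; have st2 : (kq t * kq t : C) != kq s * kq s.
  by apply: contra st => /eqP/kq_sq_inj->.
have /norP[n1 n2] : ~~ ((kq s - kq t == 0 :> C) || (kq s + kq t == 0 :> C)).
  rewrite -mulf_eq0 (_ : _ * _ = - (kq t * kq t - kq s * kq s)); last by ring.
  by rewrite oppr_eq0 subr_eq0.
have -> : ((kq s - kq t)^-1 ^+ 3 - (kq s + kq t)^-1 ^+ 3 : C) =
  kq t * (2 * (3 * (kq s * kq s) + kq t * kq t)) / (kq s - kq t) ^+ 3 / (kq s + kq t) ^+ 3.
  by field; rewrite n1 n2.
rewrite !mulf_neq0 ?invr_eq0 ?expf_eq0 ?kq_eq0 ?n1 ?n2 ?pnatr_eq0 //.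
by rewrite !kq_sq -natrM -natrD pnatr_eq0; lia.
Qed.

Section Local.
Variables (w0 : seq nat) (j l : nat) (hn : ((size w0).+2 < n)%N).
Local Notation m := (size w0).
Local Notation t := (rowlen w0 j).
Local Notation s := (rowlen (rcons w0 j) l).
Hypothesis st : s != t.

Let st2 : (kq t * kq t : C) != kq s * kq s.
Proof. by apply: contra st => /eqP/kq_sq_inj->. Qed.

Let weight_pair z : weight (w0 ++ [:: j; l]) z ->
  xg m * z = kq t *: z /\ xg m.+1 * z = kq s *: z.
Proof.
have -> : w0 ++ [:: j; l] = rcons (rcons w0 j) l by rewrite -!cats1 -catA.
by case/weight_rcons; rewrite size_rcons => /weight_rcons[].
Qed.

(** Where both intertwiners vanish, [phi0_sg] gives the action of [sg m] and [sg m.+1] in the form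
    required by [sg_local_exclusion], with [p] and [q] the inverses of [kq s - kq t] and
    [kq s + kq t]. *)
Lemma local_vanish (b : C) z : t != 0%N ->
  weight (w0 ++ [:: j; l]) z -> phi m * z = 0 -> phi m.+1 * z = 0 ->
  xg m.+2 * z = b *: z -> b * b = kq t * kq t -> z = 0.
Proof.
move=> t0 wz p1 p2 xz bb.
have gen (y : S) : weight (w0 ++ [:: j; l]) y -> phi m * y = 0 -> phi m.+1 * y = 0 ->
    xg m.+2 * y = kq t *: y -> y = 0.
  move=> /weight_pair[x0 x1] f0 f1 x2.
  have e0 := phi0_sg x0 x1 st2 f0; have e1 := phi0_sg x1 x2 _ f1.
  move: e1; rewrite eq_sym => /(_ st2); rewrite -opprB invrN (addrC (kq t)) => e1.
  have := sg_local_exclusion hn e0 e1.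
  move/eqP; rewrite scaler_eq0 mulf_eq0 pnatr_eq0 /=.
  by rewrite (negbTE (kq_cube_neq t0 st)) => /eqP.
have : (b - kq t) * (b + kq t) = 0.
  have -> : (b - kq t) * (b + kq t) = b * b - kq t * kq t by ring.
  by rewrite bb subrr.
move/eqP; rewrite mulf_eq0 subr_eq0 addr_eq0 => /orP[|]/eqP eb; subst b.
  exact: gen.
have hn1 : (m.+1 < n)%N by apply: ltnW.
(* The eigenvalue [- kq t] becomes [kq t] after multiplication by [cg m.+2], which is invertible and
   anticommutes with [xg m.+2]. *)
apply: (cg_eq0 hn); apply: gen.
- by apply: weight_cg wz; rewrite size_cat /= addn2.
- by rewrite mulrA phi_cg_far ?gtn_eqF // -?mulrA ?p1 ?mulr0 // ltnW.
- by rewrite mulrA phi_cgS // -mulrA p2 mulr0.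
by rewrite mulrA xg_cg_anti mulNr -mulrA xz -scalerAr scaleNr opprK.
Qed.

(** Contents 0, 1, 0 are legitimate, so only a Jordan block has to be excluded. Half of
    [xg m.+2 * z] plays the role of [y] in [sg_local_semisimple]. *)
Lemma local_nilpotent z : t = 0%N -> s = 1%N ->
  weight (w0 ++ [:: j; l]) z -> phi m * z = 0 -> phi m.+1 * z = 0 ->
  phi m * (xg m.+2 * z) = 0 -> phi m.+1 * (xg m.+2 * z) = 0 ->
  xg m.+2 * (xg m.+2 * z) = 0 -> xg m.+2 * z = 0.
Proof.
move=> t0 s1 wz p0 p1 q0 q1 xxz.
have kt : kq t = 0 :> C by rewrite t0 kq0.
set a : C := kq 1.
have aa : a * a = 2 by rewrite /a kq_sq.
have a0 : a != 0 by rewrite /a kq_eq0.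
have ks : kq s = a by rewrite s1.
pose y := xg m.+2 * z.
have wy : weight (w0 ++ [:: j; l]) y by apply: weight_xg.
have [x0 x1] := weight_pair wz; have [y0 y1] := weight_pair wy.
have y2 : xg m.+2 * y = kq t *: y by rewrite kt scale0r.
have e0 := phi0_sg x0 x1 st2 p0; have f0 := phi0_sg y0 y1 st2 q0.
have st2' : (kq s * kq s : C) != kq t * kq t by rewrite eq_sym.
have f1 := phi0_sg y1 y2 st2' q1.
move: e0 f0 f1; rewrite kt ks !(subr0, addr0, sub0r, add0r) invrN => e0 f0 f1.
(* This is [phi m.+1 * z = 0] solved for [sg m.+1 * z], with [y] in place of a multiple of [z].
   Since [a * a = 2], the halves of [a] become [a^-1]. *)
have e1 : sg m.+1 * z = - a^-1 *: z + a^-1 *: (cg m.+1 * cg m.+2 * z)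
    - 2^-1 *: y - cg m.+1 * cg m.+2 * (2^-1 *: y).
  have q : (xg m.+1 * xg m.+1 - xg m.+2 * xg m.+2) * z = (a * a) *: z.
    by rewrite mulrBl -!mulrA xxz subr0 x1 ks -scalerAr x1 ks scalerA.
  have q' : (xg m.+1 - xg m.+2) * z = a *: z - y by rewrite mulrBl x1 ks.
  have a2 : a^-1 = 2^-1 * a by rewrite -aa invfM -mulrA mulVf ?mulr1.
  have n2 : (2 : C) != 0 by rewrite pnatr_eq0.
  have := p1; rewrite phiE /intertwiner !(mulrDl _ _ z) !(mulNr _ z).
  rewrite -(mulrA (sg _) _ z) q -(mulrA (cg _ * _) (_ - _) z) q' x1 ks -/y aa.
  rewrite mulrBr -!scalerAr => e; apply: (scalerI n2); rewrite -[LHS]subr0 -e a2.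
  by lin_coefs C; field; rewrite ?sqrt2_neq0 ?n2.
have g0 : sg m * (2^-1 *: y) =
    a^-1 *: (2^-1 *: y) + a^-1 *: (cg m * cg m.+1 * (2^-1 *: y)).
  by rewrite -!scalerAr f0; lin C.
have g1 : sg m.+1 * (2^-1 *: y) =
    - a^-1 *: (2^-1 *: y) + a^-1 *: (cg m.+1 * cg m.+2 * (2^-1 *: y)).
  by rewrite -!scalerAr f1; lin C.
have := sg_local_semisimple hn e0 e1 g0 g1.
move/eqP; rewrite !scaler_eq0 !mulf_eq0 !invr_eq0 (negbTE a0) !pnatr_eq0 /=.
by move/eqP.
Qed.
End Local.
End LocalVanishing.

(** * Transport of exclusions along swaps *)

Section Spectral.
Variables (C : numClosedFieldType) (n : nat).
Local Notation S := (sergeev C n).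
Implicit Types (w : seq nat) (z y : S) (b : C).

Definition eigen_roots w := forall b z, weight w z ->
  xg (size w) * z = b *: z -> ~ weight_root w b -> z = 0.

Definition eigen_simple w := forall b z, weight w z ->
  xg (size w) * (xg (size w) * z - b *: z) = b *: (xg (size w) * z - b *: z) ->
  xg (size w) * z = b *: z.

Definition eigen_finite w := forall z, weight w z ->
  exists L : seq C, (\prod_(b <- L) (xg (size w) - b%:A)) * z = 0.

Lemma weight_cons2 w0 j l z : weight (w0 ++ [:: j; l]) z ->
  [/\ weight (rcons w0 j) z, xg (size w0) * z = kq (rowlen w0 j) *: z &
      xg (size w0).+1 * z = kq (rowlen (rcons w0 j) l) *: z].
Proof.
have -> : w0 ++ [:: j; l] = rcons (rcons w0 j) l by rewrite -!cats1 -catA.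
by case/weight_rcons => wz; rewrite size_rcons; have /weight_rcons[] := wz.
Qed.

Lemma no_root_of_gap w i b s : lattice w -> addable_row w i ->
  b * b = kq s * kq s -> (s = (rowlen w i).+1 \/ rowlen w i = s.+1) ->
  ~ weight_root w b.
Proof.
move=> lw ai bb hs [i' ai' bb'].
have e : s = rowlen w i' by apply: (@kq_sq_inj C); rewrite -bb.
case: (eqVneq i i') => [ii|ii]; first by rewrite e -ii in hs; lia.
by have := addable_gap2 lw ii ai ai'; rewrite e in hs; lia.
Qed.

Section Excl.
Variables (G : S -> S -> Prop) (k : nat).
Hypothesis G_comm : forall u z y, GRing.comm u (xg k) -> G z y -> G (u * z) (u * y).

(** Two arguments share this form: with [y = z] an eigenvector of [xg k] it excludes an eigenvalue,
    with [y = xg k * z] and [xg k * y = 0] a Jordan block at zero. *)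
Definition excl w := forall z y, weight w z -> weight w y -> G z y -> y = 0.

(** [phi (size w0)] commutes with [xg k] and so preserves [G]. Both rows are addable to [w0], so its
    square is a nonzero scalar on [y], and a counterexample for one word is carried to one for the
    other. *)
Lemma excl_swap w0 j h w1 : size (w0 ++ [:: j, h & w1]) = k -> (k < n)%N ->
  lattice (w0 ++ [:: j, h & w1]) -> h != j ->
  (h = j.+1 -> ((rowlen w0 h).+1 < rowlen w0 j)%N) ->
  excl (w0 ++ [:: h, j & w1]) -> excl (w0 ++ [:: j, h & w1]).
Proof.
move=> sk kn lw hj gap ex z y wz wy Gzy.
have [_ aj ah] := lattice_swap lw hj gap.
have sn : ((size w0).+1 < n)%N by move: kn; rewrite -sk size_cat /=; lia.
have cx : GRing.comm (phi (size w0)) (xg k : S).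
  by apply: phi_xg_far; rewrite -sk size_cat /=; lia.
have lw0 : lattice w0 by move: lw; rewrite lattice_cat => /andP[].
have /weight_cons2[_ x0 x1] : weight (w0 ++ [:: j; h]) y.
  by move: wy; rewrite -[[:: j, h & w1]]/([:: j; h] ++ w1) catA; apply: weight_catl.
rewrite rowlen_rcons eq_sym (negbTE hj) addn0 in x1.
apply: (phi_eq0 sn x0 (eigen2 x1)).
  by apply: phi_scalar_neq0; have := addable_gap2 lw0 hj ah aj; lia.
by apply: (ex _ _ _ _ (G_comm cx Gzy)); apply: weight_phi.
Qed.

(** The letter [j] is pushed to the right through [w1], one swap at a time. A letter [j.+1] met on
    the way can pass it because row [j] is long enough without this last box. *)
Lemma excl_move w0 j w1 l : size (w0 ++ j :: rcons w1 l) = k -> (k < n)%N ->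
  lattice (w0 ++ j :: rcons w1 l) -> j \notin w1 ->
  (j.+1 \in w1 -> (rowlen (w0 ++ w1) j.+1 < rowlen w0 j)%N) ->
  (forall w0', lattice (w0' ++ [:: j; l]) -> size (w0' ++ [:: j; l]) = k ->
      perm_eq w0' (w0 ++ w1) -> excl (w0' ++ [:: j; l])) ->
  excl (w0 ++ j :: rcons w1 l).
Proof.
elim: w1 w0 => [|h w1 IH] w0 sk kn lw jw1 hj ex.
  by apply: ex => //; rewrite cats0.
move: jw1; rewrite inE negb_or eq_sym => /andP[jh jw1].
have gap : h = j.+1 -> ((rowlen w0 h).+1 < rowlen w0 j)%N.
  move=> e; subst h; have := hj (mem_head _ _).
  by rewrite /rowlen count_cat /= eqxx; lia.
apply: excl_swap => //.
have [lw' _ _] := lattice_swap lw jh gap.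
rewrite -cat_rcons; apply: IH => //.
- by move: sk; rewrite !size_cat size_rcons /=; lia.
- by rewrite cat_rcons.
- move=> jw; rewrite cat_rcons; apply: leq_trans (hj _) _; first by rewrite inE jw orbT.
  by rewrite rowlen_rcons leq_addr.
by move=> w0' l0 s0 p0; apply: ex => //; rewrite -cat_rcons.
Qed.
End Excl.

Lemma rowlen_cat w1 w2 i : rowlen (w1 ++ w2) i = (rowlen w1 i + rowlen w2 i)%N.
Proof. by rewrite /rowlen count_cat. Qed.

Lemma rowlen_cons j w i : rowlen (j :: w) i = ((j == i) + rowlen w i)%N.
Proof. by []. Qed.

Lemma rowlen_notin w i : i \notin w -> rowlen w i = 0%N.
Proof. by move=> h; apply/count_memPn. Qed.

Lemma perm_rowlen w w' i : perm_eq w w' -> rowlen w i = rowlen w' i.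
Proof. by move/seq.permP; apply. Qed.

Section Step.
Variables (w : seq nat) (l : nat).
Local Notation m := (size w).
Local Notation t := (rowlen w l).
Local Notation wl := (rcons w l).
Hypotheses (lw : lattice wl) (hn : (m.+1 < n)%N).
Hypothesis IH : forall w', (size w' <= m)%N -> lattice w' ->
  eigen_roots w' /\ eigen_simple w'.

Let lw' : lattice w. Proof. by move: lw; rewrite lattice_rcons => /andP[]. Qed.
Let al : addable_row w l. Proof. by move: lw; rewrite lattice_rcons => /andP[]. Qed.

(* The common situation of all exclusions: up to moving the last box [j] of a
   neighbouring row to the right, the last two boxes and the new one have
   contents [t'], [t], [t'] with [t'] next to [t]. *)
Lemma excl_neighbour (G : S -> S -> Prop) j :
  (forall u z y, GRing.comm u (xg m.+1) -> G z y -> G (u * z) (u * y)) ->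
  (0 < rowlen w j)%N ->
  (l = j \/ l = j.+1) ->
  ((rowlen w j.+1).+1 < rowlen w j \/ rowlen w j.+1 = 0)%N ->
  (forall w0, lattice (w0 ++ [:: j; l]) -> size (w0 ++ [:: j; l]) = m.+1 ->
     rowlen w0 j = (rowlen w j).-1 -> rowlen (rcons w0 j) l = t ->
     excl G (w0 ++ [:: j; l])) ->
  excl G wl.
Proof.
move=> Gc wj _ hgap ex.
have [w0 [w1 [ew jw1]]] : exists w0 w1, w = w0 ++ j :: w1 /\ j \notin w1.
  by apply: last_occurrence; rewrite -has_pred1 has_count.
have rj : rowlen w j = (rowlen w0 j).+1.
  by rewrite ew rowlen_cat rowlen_cons eqxx (rowlen_notin jw1); lia.
have rj1 : rowlen (w0 ++ w1) j.+1 = rowlen w j.+1.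
  by rewrite ew !rowlen_cat rowlen_cons ltn_eqF.
have ewl : wl = w0 ++ j :: rcons w1 l by rewrite ew rcons_cat.
have sw : size (w0 ++ j :: rcons w1 l) = m.+1 by rewrite -ewl size_rcons.
rewrite ewl; apply: (excl_move Gc sw) => //.
- by rewrite -ewl.
- move=> j1; rewrite rj1; case: hgap; rewrite ?rj; first by lia.
  move=> e; have : (0 < rowlen w1 j.+1)%N by rewrite -has_count has_pred1.
  by move: rj1; rewrite e rowlen_cat; lia.
move=> w0' l0 s0 p0; apply: ex => //.
  by rewrite (perm_rowlen _ p0) rowlen_cat (rowlen_notin jw1) rj; lia.
rewrite ew rowlen_rcons rowlen_cat rowlen_cons (perm_rowlen _ p0) rowlen_cat; lia.
Qed.

(** The image would be a vector of weight [w0] whose next content is at distance 1 from that of the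
    addable row [j], hence not a root; the induction hypothesis excludes this. *)
Lemma phi_neighbour_vanish w0 j z : lattice (w0 ++ [:: j; l]) ->
  size (w0 ++ [:: j; l]) = m.+1 ->
  let s := rowlen w0 j in let t' := rowlen (rcons w0 j) l in
  (t' = s.+1 \/ s = t'.+1) ->
  weight (w0 ++ [:: j; l]) z -> phi (size w0) * z = 0.
Proof.
move=> l0 s0 s t' st wz; have [_ x0 x1] := weight_cons2 wz.
have [wz0 hs] : weight w0 z /\ (size w0).+2 = m.+1.
  by split; [apply: weight_catl wz | rewrite -s0 size_cat /= addn2].
have [lw0 aj] : lattice w0 /\ addable_row w0 j.
  by move: l0; rewrite lattice_cat /= => /and3P[].
have le0 : (size w0 <= m)%N by lia.
have [r0 _] := IH le0 lw0.
apply: (r0 (kq t')); first by apply: weight_phi_last.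
  by rewrite mulrA -phi_xgS -?mulrA ?x1 -?scalerAr //; lia.
by apply: (no_root_of_gap lw0 aj (erefl _)).
Qed.

Lemma phi_last_vanish z b s : weight wl z ->
  xg m.+1 * z = b *: z -> b * b = kq s * kq s -> (s = t.+1 \/ t = s.+1) ->
  phi m * z = 0.
Proof.
move=> /weight_rcons[wz _] xz bb st.
have [r0 _] := IH (leqnn _) lw'.
apply: (r0 b); first by apply: weight_phi_last.
  by rewrite mulrA -phi_xgS // -mulrA xz -scalerAr.
exact: (no_root_of_gap lw' al bb).
Qed.

End Step.

Section Step2.
Variables (w : seq nat) (l : nat).
Local Notation m := (size w).
Local Notation t := (rowlen w l).
Local Notation wl := (rcons w l).
Hypotheses (lw : lattice wl) (hn : (m.+1 < n)%N).
Hypothesis IH : forall w', (size w' <= m)%N -> lattice w' ->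
  eigen_roots w' /\ eigen_simple w'.

Let lw' : lattice w. Proof. by move: lw; rewrite lattice_rcons => /andP[]. Qed.
Let al : addable_row w l. Proof. by move: lw; rewrite lattice_rcons => /andP[]. Qed.

Lemma pair_vanish w0 j z b s : lattice (w0 ++ [:: j; l]) ->
  size (w0 ++ [:: j; l]) = m.+1 -> weight (w0 ++ [:: j; l]) z ->
  rowlen (rcons w0 j) l = t -> 
  xg m.+1 * z = b *: z -> b * b = kq s * kq s -> (s = t.+1 \/ t = s.+1) ->
  phi m * z = 0.
Proof.
move=> l0 s0 wz rt xz bb st; have sm : size (rcons w0 j) = m.
  by move: s0; rewrite size_cat size_rcons /=; lia.
have e : w0 ++ [:: j; l] = rcons (rcons w0 j) l by rewrite -!cats1 -catA.
rewrite -sm; apply: (@phi_last_vanish (rcons w0 j) l _ _ _ z b s); rewrite ?sm ?rt // -?e //.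
Qed.

(** After the last box of row [j] has been moved next to that of row [l], both intertwiners vanish
    and [local_vanish] applies. The condition [1 < rowlen w j] makes the outer content nonzero. *)
Lemma neighbour_excl j b z : (1 < rowlen w j)%N -> (l = j \/ l = j.+1) ->
  ((rowlen w j.+1).+1 < rowlen w j \/ rowlen w j.+1 = 0)%N ->
  ((rowlen w j).-1 = t.+1 \/ t = (rowlen w j).-1.+1) ->
  b * b = kq (rowlen w j).-1 * kq (rowlen w j).-1 ->
  weight wl z -> xg m.+1 * z = b *: z -> z = 0.
Proof.
move=> r1 lj gap st bb wz xz.
pose G (z y : S) := y = z /\ xg m.+1 * y = b *: y.
suff ex : excl G wl by apply: (ex z z).
apply: (excl_neighbour lw hn _ _ lj gap) => //; last first.
- move=> w0 l0 s0 rj rl z1 y wz1 wy [_ xy].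
  have s1 : (size w0).+1 = m by move: s0; rewrite size_cat /=; lia.
  apply: (@local_vanish _ _ w0 j l _ _ b) => //; rewrite ?s1 ?rj ?rl //; try lia.
  + by move: wy => /(phi_neighbour_vanish lw hn IH l0 s0); apply; rewrite rj rl; lia.
  + by apply: (pair_vanish l0 s0 wy rl xy bb); lia.
- by lia.
by move=> u z1 y cu [-> e]; split=> //; rewrite mulrA -cu -mulrA e scalerAr.
Qed.

Lemma nilpotent_excl z : t = 1%N -> (rowlen w l.+1 = 0)%N ->
  weight wl z -> xg m.+1 * (xg m.+1 * z) = 0 -> xg m.+1 * z = 0.
Proof.
move=> t1 r0 wz xz.
pose G (z y : S) := y = xg m.+1 * z /\ xg m.+1 * y = 0.
suff ex : excl G wl by apply: (ex z) => //; apply: weight_xg.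
have kq00 : (0 : C) * 0 = kq 0 * kq 0 by rewrite kq0.
apply: (excl_neighbour lw hn _ _ (or_introl (erefl l)) (or_intror r0)).
- move=> u z1 y cu [-> e]; split; first by rewrite !mulrA cu.
  by rewrite mulrA -cu -mulrA e mulr0.
- by rewrite t1.
move=> w0 l0 s0 rj rl z1 y wz1 wy [ey xy].
have s1 : (size w0).+1 = m by move: s0; rewrite size_cat /=; lia.
have rj0 : rowlen w0 l = 0%N by rewrite rj t1.
have van (u : S) : weight (w0 ++ [:: l; l]) u -> phi (size w0) * u = 0.
  by move/(phi_neighbour_vanish lw hn IH l0 s0); apply; rewrite rj0 rl t1; lia.
have last (u : S) : weight (w0 ++ [:: l; l]) u -> xg m.+1 * u = 0 -> phi m * u = 0.
  move=> wu xu; apply: (pair_vanish l0 s0 wu rl (b := 0) (s := 0%N)) => //.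
    by rewrite scale0r.
  by rewrite t1; lia.
subst y; rewrite -s1; apply: (@local_nilpotent _ _ w0 l l); rewrite ?s1 ?rl ?rj0 ?t1 //; try lia.
- exact: van.
(* [z1] need not be an eigenvector of [xg m.+1], but [phi m] already kills [xg m.+1 * z1]. So
   [phi m * z1] has eigenvalue 0 under [xg m], which is not a root of [rcons w0 l]. *)
- have /weight_cons2[wz0 x0 _] := wz1.
  have wz0' : weight (rcons w0 l) (phi m * z1).
    by apply: weight_phi_last => //; rewrite size_rcons s1.
  have l0' : lattice (rcons w0 l).
    by move: l0; rewrite lattice_cat lattice_rcons /= => /and3P[-> ->].
  have sr : size (rcons w0 l) = m by rewrite size_rcons.
  have [rr rs] := IH (eq_leq sr) l0'.
  have ar : addable_row (rcons w0 l) l.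
    by move: l0; rewrite lattice_cat /= andbT => /and3P[].
  have nr : ~ weight_root (rcons w0 l) (0 : C).
    by apply: (no_root_of_gap l0' ar kq00); rewrite rl t1; right.
  apply: (rr 0) => //; rewrite sr.
  have phx : xg m * (phi m * z1) = phi m * (xg m.+1 * z1).
    by rewrite mulrA -phi_xgS // mulrA.
  rewrite scale0r phx; apply: last => //.
- exact: van.
exact: last.
Qed.

Lemma phi_scalar_root i : addable_row w i -> i != l ->
  phi_scalar t (kq (rowlen w i) * kq (rowlen w i) : C) != 0.
Proof.
by move=> ai il; apply: phi_scalar_neq0; have := addable_gap2 lw' il ai al; lia.
Qed.

(** By [sg_xgS], two equal consecutive contents create a Jordan block of [xg m] on vectors of weight
    [w], against [eigen_simple w]. *)
Lemma equal_excl b z : b * b = kq t * kq t -> weight wl z ->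
  xg m.+1 * z = b *: z -> z = 0.
Proof.
move=> bb wz xz.
have gen (y : S) : weight wl y -> xg m.+1 * y = kq t *: y -> y = 0.
  move=> /weight_rcons[wy x0] x1; have [_ rs] := IH (leqnn _) lw'.
  have xs : xg m * (sg m * y) = kq t *: (sg m * y) - y - cg m * cg m.+1 * y.
    have := sg_xgS C hn; move/(congr1 (fun u => u * y)).
    rewrite -mulrA x1 !mulrDl -mulrA mul1r -scalerAr => ->.
    by lin C.
  have xcc : xg m * (cg m * cg m.+1 * y) = - (kq t *: (cg m * cg m.+1 * y)).
    rewrite !mulrA xg_cg_anti !mulNr -(mulrA (cg m) (xg m)) xg_cg ?gtn_eqF //.
    by rewrite mulrA -(mulrA _ (xg m)) x0 -scalerAr.
  have wsy : weight w (sg m * y) by apply: weight_sg.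
  (* At content zero the block is generated by [sg m * y], and semisimplicity gives
     [cg m * cg m.+1 * y = - y], although this Clifford product squares to -1. *)
  case: (eqVneq (kq t : C) 0) => [e|nz].
    have := rs 0 _ wsy; rewrite !scale0r subr0 xs e scale0r sub0r.
    rewrite mulrBr mulrN x0 xcc e !scale0r !(oppr0, addr0) => /(_ erefl) h.
    have hc : cg m * cg m.+1 * y = - y by rewrite -[LHS]opprK -[y in RHS]addr0 -h; lin C.
    have : cg m * cg m.+1 * (cg m * cg m.+1 * y) = - y.
      have -> : cg m * cg m.+1 * (cg m * cg m.+1 * y) = cg m * (cg m.+1 * cg m) * (cg m.+1 * y).
        by rewrite !mulrA.
      rewrite (@cg_anti _ _ m.+1 m) ?gtn_eqF // mulrN mulNr.
      have -> : cg m * (cg m * cg m.+1) * (cg m.+1 * y) = cg m * cg m * (cg m.+1 * cg m.+1 * y).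
        by rewrite !mulrA.
      by rewrite !cg_sq ?(ltnW hn) // mulN1r mulN1r opprK.
    rewrite hc mulrN hc opprK => /eqP; rewrite -subr_eq0 opprK -mulr2n -scaler_nat.
    by rewrite scaler_eq0 pnatr_eq0 => /eqP.
  (* The factor [xg m + kq t] kills the summand with eigenvalue [- kq t], so that only a multiple of
     [y] remains as nilpotent part. *)
  pose u := xg m * (sg m * y) + kq t *: (sg m * y).
  have wu : weight w u by apply: weightD; [apply: weight_xg | apply: weightZ].
  have xu : xg m * u - kq t *: u = (- (2 * kq t)) *: y.
    by rewrite /u xs !mulrDr !mulrN -!scalerAr xs x0 xcc; lin C.
  have := rs (kq t) _ wu; rewrite xu -scalerAr x0 !scalerA mulrC => /(_ erefl).
  move=> e; move: xu; rewrite e subrr => /esym/eqP; rewrite scaler_eq0 oppr_eq0.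
  by rewrite mulf_eq0 pnatr_eq0 (negbTE nz) => /eqP.
have : (b - kq t) * (b + kq t) = 0.
  have -> : (b - kq t) * (b + kq t) = b * b - kq t * kq t by ring.
  by rewrite bb subrr.
move/eqP; rewrite mulf_eq0 subr_eq0 addr_eq0 => /orP[|]/eqP eb; subst b.
  exact: gen.
apply: (cg_eq0 hn); apply: gen; first by apply: weight_cg wz; rewrite size_rcons.
by rewrite mulrA xg_cg_anti mulNr -mulrA xz -scalerAr scaleNr opprK.
Qed.

End Step2.
End Spectral.

Section SpectralInduction.
Variables (C : numClosedFieldType) (n : nat).
Local Notation S := (sergeev C n).
Implicit Types (w : seq nat) (z y : S) (b : C).

Lemma xg0 : xg 0 = 0 :> S.
Proof. by rewrite /xg jm0 mul0r scaler0. Qed.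

Lemma addable_rcons_new w l i : addable_row (rcons w l) i -> i != l ->
  ~~ addable_row w i -> i = l.+1 /\ (rowlen w i).+1 = rowlen w l.
Proof.
rewrite /addable_row !rowlen_rcons => + il; rewrite (eq_sym l i) (negbTE il) addn0.
case: i il => //= i il.
case: (eqVneq l i) => [->|li] /=; last by rewrite addn0 => ->.
by rewrite addn1 ltnS -leqNgt => h1 h2; split=> //; lia.
Qed.

(** On a Jordan block, the square of the intertwiner acts by its scalar plus a derivative. The
    scalar is zero at a neighbouring content, and the derivative is $4b(1+s(s+1)-b^2)$, nonzero
    since neighbouring contents are simple roots in $b^2$ and [b != 0]. *)
Lemma phi_sq_nilpotent a s t b z y : (a.+1 < n)%N ->
  xg a * z = kq s *: z -> xg a.+1 * z = b *: z + y -> xg a.+1 * y = b *: y ->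
  xg a * y = kq s *: y -> phi a * z = 0 -> (t = s.+1 \/ s = t.+1) ->
  b * b = kq t * kq t -> b != 0 -> y = 0.
Proof.
move=> h x0 x1 y1 y0 e st bb b0.
have := phi_sq C h; move/(congr1 (fun u => u * z)); rewrite -mulrA e mulr0.
have xx : xg a * (xg a * z) = (kq s * kq s) *: z by rewrite x0 -scalerAr x0 scalerA.
have yy : xg a.+1 * (xg a.+1 * z) = (b * b) *: z + (2 * b) *: y.
  by rewrite x1 mulrDr -scalerAr x1 y1; lin C.
have d1 (u : S) (k : C) (u' : S) : xg a * (xg a * u) = (kq s * kq s) *: u ->
    xg a.+1 * (xg a.+1 * u) = (b * b) *: u + u' ->
    (xg a * xg a - xg a.+1 * xg a.+1) * u = (kq s * kq s - b * b) *: u - u'.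
  by move=> e1 e2; rewrite mulrBl -!mulrA e1 e2; lin C.
have ya : xg a * (xg a * y) = (kq s * kq s) *: y by rewrite y0 -scalerAr y0 scalerA.
have yb : xg a.+1 * (xg a.+1 * y) = (b * b) *: y + 0.
  by rewrite y1 -scalerAr y1 scalerA addr0.
rewrite mulrBl -scalerAl mulrDl -!mulrA xx yy (d1 z 0 _ xx yy).
rewrite (mulrBr (_ - _) (_ *: z)) -!(scalerAr _ (_ - _)) (d1 z 0 _ xx yy) (d1 y 0 _ ya yb) subr0.
rewrite !kq_sq in bb *; rewrite bb => e0.
have e1 : (b * (4 * (1 + (s * s.+1)%:R - (t * t.+1)%:R))) *: y
    + phi_scalar s (t * t.+1)%:R *: z = 0.
  by rewrite e0 /phi_scalar; lin C.
have p0 : phi_scalar s (t * t.+1)%:R = 0 :> C.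
  rewrite phi_scalarE; case: st => -> /=; first by rewrite subrr mul0r oppr0.
  by rewrite (mulnC t.+1 t) subrr mulr0 oppr0.
move/eqP: e1; rewrite p0 scale0r addr0 scaler_eq0 !mulf_eq0 (negbTE b0) pnatr_eq0 /=.
rewrite nat1r subr_eq0 eqr_nat => /orP[/eqP e2|/eqP//].
by case: st e2; nia.
Qed.

(** If the product over [L], formed with [xg m], kills [phi m * z], the same product formed with
    [xg m.+1] sends [z] to a vector killed by [phi m]. There the formula for the square of [phi m]
    is an equation of degree four for [xg m.+1]. *)
Lemma eigen_finite_rcons w l : ((size w).+1 < n)%N ->
  @eigen_finite C n w -> @eigen_finite C n (rcons w l).
Proof.
set m := size w; set t := rowlen w l => hn fw.
have xphi (u : S) : xg m * (phi m * u) = phi m * (xg m.+1 * u).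
  by rewrite mulrA -phi_xgS // mulrA.
move=> z wz; rewrite size_rcons -/m.
have [L hL] := fw (phi m * z) (weight_phi_last (leqnn _) ((weight_rcons w l z).1 wz).1).
pose P := \prod_(b <- L) (xg m.+1 - b%:A) : S.
have xP k : GRing.comm (xg k) P.
  apply: commr_prod => b _; apply: commrB; first exact: xg_comm.
  by rewrite /GRing.comm mulr_algl mulr_algr.
have pP : phi m * P = \prod_(b <- L) (xg m - b%:A) * phi m.
  rewrite /P; elim: (L) => [|b L' IHL]; first by rewrite !big_nil mulr1 mul1r.
  rewrite !big_cons mulrA mulrBr phi_xgS // mulr_algr.
  have -> : xg m * phi m - b *: phi m = (xg m - b%:A) * phi m :> S.
    by rewrite mulrBl mulr_algl.
  by rewrite -!mulrA IHL.
have pPz : phi m * (P * z) = 0 by rewrite mulrA pP -mulrA hL.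
have wP : weight (rcons w l) (P * z) by apply: weight_comm wz => k _; apply: xP.
have [_ x0] := (weight_rcons w l _).1 wP.
(* The four roots of [phi_scalar t], read as a polynomial in [xg m.+1]. *)
exists [:: kq t.+1, - kq t.+1, kq t.-1, - kq t.-1 & L].
rewrite !big_cons -!mulrA -/P.
have [_ x0'] := (weight_rcons w l _).1 wP.
move: (P * z) pPz x0' => v pv xv {x0}.
have pr (u : S) (a : C) : (xg m.+1 - a%:A) * ((xg m.+1 - (- a)%:A) * u) =
    xg m.+1 * (xg m.+1 * u) - (a * a) *: u.
  rewrite !mulrBl !mulr_algl mulrBr.
  by rewrite -(scalerAr (- a) (xg m.+1) u); lin C.
have xx : xg m * (xg m * v) = (t * t.+1)%:R *: v by rewrite (eigen2 xv) kq_sq.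
have sc (k : C) (u : S) : xg m.+1 * (xg m.+1 * (k *: u)) = k *: (xg m.+1 * (xg m.+1 * u)).
  by rewrite -!scalerAr.
have xy : (xg m * xg m) * (xg m.+1 * (xg m.+1 * v)) =
    (t * t.+1)%:R *: (xg m.+1 * (xg m.+1 * v)).
  have cx (u : S) : xg m * (xg m.+1 * u) = xg m.+1 * (xg m * u).
    by rewrite !mulrA xg_comm.
  by rewrite -mulrA !cx xx sc.
pose T : C := (t * t.+1)%:R.
pose X2 : S := xg m * xg m; pose Y2 : S := xg m.+1 * xg m.+1.
pose v2 := xg m.+1 * (xg m.+1 * v); pose v4 := xg m.+1 * (xg m.+1 * v2).
have eX : X2 * v = T *: v by rewrite -mulrA xx.
have eY : Y2 * v = v2 by rewrite -mulrA.
have d1 : (X2 - Y2) * v = T *: v - v2 by rewrite mulrBl eX eY.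
have d2 : (X2 - Y2) * v2 = T *: v2 - v4 by rewrite mulrBl [X2 * _]xy -mulrA.
have e0 : 2 *: (T *: v + v2) - (T *: (T *: v - v2) - (T *: v2 - v4)) = 0.
  have := phi_sq C hn; move/(congr1 (fun u => u * v)); rewrite -mulrA pv mulr0.
  rewrite -/m -/X2 -/Y2 mulrBl -(scalerAl 2 _ v) mulrDl eX eY.
  by rewrite -(mulrA _ _ v) d1 mulrBr -(scalerAr T _ v) d1 d2 => <-.
rewrite !pr -/v2 !mulrBr sc -/v2 -/v4 !kq_sq -oppr0 -e0 /T.
case: (t) => [|t'] /=; first by lin C.
by rewrite !natrM -!natr1; lin C.
Qed.

(* The eigenvalues of the next Jucys--Murphy element on the vectors of weight
   [w] are those of the entries that may be added to the shape of [w], and the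
   element acts semisimply there; finiteness only serves to start. *)
Theorem spectral w : lattice w -> (size w < n)%N ->
  [/\ @eigen_roots C n w, @eigen_simple C n w & @eigen_finite C n w].
Proof.
have [N] := ubnP (size w); elim: N w => // N IHN w.
case/lastP: w => [|w l].
  move=> _ _ _; have ar : addable_row [::] 0%N by [].
  split=> [b z _|b z _|z _]; rewrite /= ?xg0.
  - rewrite mul0r => e nr; apply/eqP; apply: contraT => z0; case: nr.
    exists 0%N => //; move/esym/eqP: e; rewrite scaler_eq0 (negbTE z0) orbF.
    by move/eqP->; rewrite kq0.
  - rewrite !mul0r sub0r scalerN scalerA => /esym/eqP.
    rewrite oppr_eq0 scaler_eq0 mulf_eq0 orbb => /orP[/eqP->|/eqP->].
      by rewrite scale0r.
    by rewrite scaler0.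
  by exists [:: 0]; rewrite big_seq1 scale0r subr0 mul0r.
rewrite size_rcons ltnS => sN lw hn.
have IH3 w' : (size w' <= size w)%N -> lattice w' ->
    [/\ @eigen_roots C n w', @eigen_simple C n w' & @eigen_finite C n w'].
  by move=> h1 h2; apply: IHN => //; lia.
have IH w' : (size w' <= size w)%N -> lattice w' ->
    @eigen_roots C n w' /\ @eigen_simple C n w'.
  by move=> h1 h2; have [] := IH3 w' h1 h2.
have [lw' al] : lattice w /\ addable_row w l.
  by move: lw; rewrite lattice_rcons => /andP[].
have [rw sw fw] := IH3 w (leqnn _) lw'.
set m := size w; set t := rowlen w l.
have xphi (u : S) : xg m * (phi m * u) = phi m * (xg m.+1 * u).
  by rewrite mulrA -phi_xgS // mulrA.
have roots : @eigen_roots C n (rcons w l).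
  move=> b z wz xz nr; rewrite size_rcons -/m in xz.
  have [wz0 x0] := (weight_rcons w l z).1 wz.
  case: (pselect (weight_root w b)) => [[i ai bi]|nr0].
    case: (eqVneq i l) => [il|il]; last first.
      case: nr; exists i; first exact: addable_row_rcons.
      by rewrite rowlen_rcons (eq_sym l i) (negbTE il) addn0.
    by subst i; apply: (equal_excl lw hn IH bi wz xz).
  have pz : phi m * z = 0.
    apply: (rw b) => //; first exact: weight_phi_last.
    by rewrite xphi xz -scalerAr.
  case: (eqVneq (phi_scalar t (b * b)) 0); last first.
    by move=> nz; apply: (phi_eq0 hn x0 (eigen2 xz) nz pz).
  move/phi_scalar_eq0 => [bb|bb].
  (* The content [t.+1] would prolong row [l]. As this is not allowed, row [l.-1] has length exactly
     [t.+2], and its last box has content [t.+1]. *)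
  + have l0 : (0 < l)%N.
      rewrite lt0n; apply/negP => /eqP l0; case: nr; exists l; first by rewrite l0.
      by rewrite rowlen_rcons eqxx addn1 kq_sq.
    have rl : rowlen w l.-1 = t.+2.
      apply/eqP; rewrite eqn_leq -{2}(prednK l0); apply/andP; split; last first.
        by move: al; rewrite /addable_row gtn_eqF.
      rewrite leqNgt; apply/negP => h; case: nr; exists l.
        rewrite /addable_row !rowlen_rcons eqxx (gtn_eqF l0) /=.
        by rewrite gtn_eqF ?prednK // addn1 addn0.
      by rewrite rowlen_rcons eqxx addn1 kq_sq.
    apply: (neighbour_excl (j := l.-1) lw hn IH _ _ _ _ _ wz xz); rewrite ?rl ?prednK //.
    * by right.
    * by left; rewrite -/t; lia.
    * by left.
    * by rewrite bb kq_sq.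
  + have t0 : (0 < t)%N.
      rewrite lt0n; apply/negP => /eqP t0; case: nr0; exists l => //.
      by rewrite bb kq_sq -/t t0.
    have rl : ((rowlen w l.+1).+1 < t)%N.
      have := lattice_decr l lw'; rewrite -/t => h.
      have h' : (rowlen w l.+1 < t)%N by lia.
      rewrite ltn_neqAle h' andbT; apply/negP => /eqP e; case: nr; exists l.+1.
        by rewrite /addable_row !rowlen_rcons /= eqxx ltn_eqF // addn0 e addn1.
      by rewrite rowlen_rcons ltn_eqF // addn0 kq_sq bb e mulnC -e.
    apply: (neighbour_excl (j := l) lw hn IH _ _ _ _ _ wz xz); rewrite -/t.
    * by lia.
    * by left.
    * by left.
    * by right; lia.
    * by rewrite bb kq_sq mulnC prednK.
split=> //.
- move=> b z wz; rewrite size_rcons -/m.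
  set y := xg m.+1 * z - _ => xy.
  have wy : weight (rcons w l) y.
    by rewrite /y -scaleN1r; apply: weightD; [apply: weight_xg | do 2!apply: weightZ].
  have ey : xg m.+1 * z = b *: z + y by rewrite /y; lin C.
  have [wz0 x0] := (weight_rcons w l z).1 wz.
  have [wy0 y0] := (weight_rcons w l y).1 wy.
  suff y00 : y = 0 by rewrite ey y00 addr0.
  case: (pselect (weight_root (rcons w l) b)) => [[i ai bi]|nr]; last first.
    by apply: (roots b) => //; rewrite size_rcons.
  have wpz : weight w (phi m * z) by apply: weight_phi_last.
  have e1 : xg m * (phi m * z) - b *: (phi m * z) = phi m * y.
    by rewrite xphi ey mulrDr -scalerAr; lin C.
  have e2 : xg m * (phi m * z) = b *: (phi m * z) -> phi m * y = 0.
    by move=> h; rewrite -e1 h subrr.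
  case: (boolP (addable_row w i && (i != l))) => [/andP[aiw il]|].
    have ri : rowlen (rcons w l) i = rowlen w i.
      by rewrite rowlen_rcons (eq_sym l i) (negbTE il) addn0.
    rewrite ri in bi.
    apply: (phi_eq0 hn y0 (eigen2 xy)).
      by rewrite bi; apply: phi_scalar_root.
    by apply/e2/sw => //; rewrite -/m e1 xphi xy -scalerAr.
  move=> nai.
  (* The remaining roots are those created by the box [l]: row [l] prolonged, or row [l.+1] just
     released. In both cases the content is next to [t], and [phi m] degenerates. *)
  have [s bs st] : exists2 s, b * b = kq s * kq s & (s = t.+1 \/ t = s.+1).
    case: (eqVneq i l) => [il|il].
      by exists t.+1; [rewrite bi il rowlen_rcons eqxx addn1 | left].
    have [|_ hs] := addable_rcons_new ai il; first by move: nai; rewrite il andbT.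
    exists (rowlen w i); last by right.
    by rewrite bi rowlen_rcons (eq_sym l i) (negbTE il) addn0.
  have nrw := no_root_of_gap lw' al bs st.
  have pz : phi m * z = 0.
    have py : phi m * y = 0.
      apply: (rw b) => //; first exact: weight_phi_last.
      by rewrite xphi xy -scalerAr.
    apply: (rw b) => //.
    by rewrite -/m -[LHS](subrK (b *: (phi m * z))) e1 py add0r.
  case: (eqVneq b 0) => [b0|b0].
    have s0 : s = 0%N.
      by move/eqP: bs; rewrite b0 mul0r eq_sym mulf_eq0 orbb kq_eq0 => /eqP.
    have t1 : t = 1%N by case: st; rewrite s0.
    have ey' : y = xg m.+1 * z by rewrite ey b0 scale0r add0r.
    rewrite ey'; apply: (nilpotent_excl lw hn IH) => //.
      by have := lattice_decr l lw'; rewrite -/t t1 /= leqn0 => /eqP.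
    by rewrite -/m -ey' xy b0 scale0r.
  exact: (phi_sq_nilpotent hn x0 ey xy y0 pz st bs b0).
exact: eigen_finite_rcons fw.
Qed.

End SpectralInduction.

(** * Standard tableaux *)

Section Tableaux.
Implicit Types (la : seq nat) (T : tableau) (b : box) (a i j k : nat).

Lemma latticeP w : reflect (forall k, (k < size w)%N -> addable_row (take k w) (nth 0%N w k))
  (lattice w).
Proof.
apply: (iffP idP).
  move=> h k hk; move: h; rewrite -{1}(cat_take_drop k w) (drop_nth 0%N hk) lattice_cat /=.
  by case/and3P.
elim/last_ind: w => [//|w i IH] h; rewrite lattice_rcons; apply/andP; split.
  apply: IH => k hk; have := h k; rewrite size_rcons ltnS ltnW // nth_rcons hk => /(_ erefl).
  by rewrite -cats1 takel_cat // ltnW.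
have := h (size w); rewrite size_rcons ltnSn nth_rcons ltnn eqxx => /(_ erefl).
by rewrite -cats1 take_size_cat.
Qed.

Lemma mem_diagram la i j : ((i, j) \in diagram la) =
  (i < size la)%N && (i <= j < i + nth 0%N la i)%N.
Proof.
apply/allpairsPdep/andP => [[i' [j' [hi hj [-> ->]]]]|[hi hj]].
  by move: hi hj; rewrite !mem_iota /= add0n.
by exists i, j; rewrite !mem_iota /= add0n.
Qed.

Lemma diagram_uniq la : uniq (diagram la).
Proof.
apply: allpairs_uniq_dep => [|i _|]; [exact: iota_uniq | exact: iota_uniq |].
by case=> [i j] [i' j'] _ _ /= [-> ->].
Qed.

Lemma size_diagram la : size (diagram la) = sumn la.
Proof.
rewrite /diagram size_allpairs_dep; congr sumn.
rewrite -[RHS](mkseq_nth 0%N) /mkseq; apply: eq_map => i.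
by rewrite size_iota.
Qed.

Definition row_word T : seq nat := map fst T.

Definition box_lt b b' :=
  ((b.1 == b'.1) && (b.2 < b'.2) || (b.2 == b'.2) && (b.1 < b'.1))%N.

Lemma std_tableauxP la T : reflect
  (perm_eq T (diagram la) /\
   forall b b', b \in T -> b' \in T -> box_lt b b' -> (index b T < index b' T)%N)
  (T \in std_tableaux la).
Proof.
rewrite mem_filter mem_permutations andbC; apply: (iffP andP) => -[pT h]; split=> //.
  by move=> b b' hb hb' lt; have /allP/(_ b hb)/allP/(_ b' hb')/implyP := h; apply.
apply/allP => b hb; apply/allP => b' hb'; apply/implyP => lt.
exact: h.
Qed.

Section Standard.
Variables (la : seq nat) (T : tableau).
Hypotheses (hla : strict_partition la) (hT : T \in std_tableaux la).
Local Notation n := (sumn la).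
Local Notation w := (row_word T).

Lemma std_perm : perm_eq T (diagram la).
Proof. by case/std_tableauxP: hT. Qed.

Lemma std_lt b b' : b \in T -> b' \in T -> box_lt b b' -> (index b T < index b' T)%N.
Proof. by case/std_tableauxP: hT => _; apply. Qed.

Lemma std_mem b : (b \in T) = (b \in diagram la).
Proof. exact/perm_mem/std_perm. Qed.

Lemma std_uniq : uniq T.
Proof. by rewrite (perm_uniq std_perm) diagram_uniq. Qed.

Lemma std_size : size T = n.
Proof. by rewrite (perm_size std_perm) size_diagram. Qed.

Lemma size_row_word : size w = n.
Proof. by rewrite size_map std_size. Qed.

Lemma box_of_mem k : (k < n)%N -> box_of T k \in T.
Proof. by move=> hk; rewrite mem_nth // std_size. Qed.

Lemma index_box_of k : (k < n)%N -> index (box_of T k) T = k.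
Proof. by move=> hk; rewrite index_uniq ?std_uniq // std_size. Qed.

Lemma nth_row_word k : (k < n)%N -> nth 0%N w k = (box_of T k).1.
Proof. by move=> hk; rewrite (nth_map (0, 0)%N) // std_size. Qed.

Lemma la_decr i : (i.+1 < size la)%N -> (nth 0 la i.+1 < nth 0 la i)%N.
Proof. by move: hla => /andP[/(sortedP 0%N) h _]; apply: h. Qed.

(** Entries increase along rows, so the earlier entries of row [i] are exactly those in the boxes to
    the left of the box of [k]. *)
Lemma rowlen_take k i j : (k < n)%N -> box_of T k = (i, j) ->
  (i <= j)%N /\ rowlen (take k w) i = (j - i)%N.
Proof.
move=> hk e; have := box_of_mem hk; rewrite std_mem e mem_diagram => /and3P[hi ij jl].
split=> //; rewrite -map_take /rowlen count_map -size_filter.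
rewrite -(size_iota i (j - i)) -(size_map (fun j' => (i, j'))).
apply/perm_size/uniq_perm; first by rewrite filter_uniq // take_uniq // std_uniq.
  by rewrite map_inj_uniq ?iota_uniq // => x y [].
have ek : index (i, j) T = k by rewrite -e index_box_of.
have mT j' : (i <= j')%N -> (j' < i + nth 0 la i)%N -> (i, j') \in T.
  by move=> h1 h2; rewrite std_mem mem_diagram hi h1.
move=> [i' j']; rewrite mem_filter /=; apply/andP/mapP => [[/eqP-> b']|[j1]].
  have hb := mem_take b'; have := hb; rewrite std_mem mem_diagram => /and3P[_ ij' jl'].
  exists j' => //; rewrite mem_iota ij' subnKC //= ltnNge; apply/negP => jj'.
  move: b'; rewrite in_take // -ek ltnNge => /negP; apply.
  move: jj'; rewrite leq_eqVlt => /orP[/eqP->//|jj']; apply/ltnW/std_lt => //.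
    by rewrite mT.
  by rewrite /box_lt /= eqxx jj'.
rewrite mem_iota subnKC // => /andP[h1 h2] [-> ->]; split=> //.
have h3 : (j1 < i + nth 0 la i)%N by apply: leq_trans jl; apply: ltnW.
rewrite in_take ?mT // -ek; apply: std_lt; rewrite ?mT //.
by rewrite /box_lt /= eqxx h2.
Qed.

Lemma wcont_row_word k : (k < n)%N ->
  wcont w k = ((box_of T k).2 - (box_of T k).1)%N.
Proof.
move=> hk; rewrite /wcont nth_row_word //.
by case e : (box_of T k) => [i j] /=; have [] := rowlen_take hk e.
Qed.

Lemma box_of_word k : (k < n)%N ->
  box_of T k = (nth 0%N w k, (nth 0%N w k + wcont w k)%N).
Proof.
move=> hk; rewrite wcont_row_word // nth_row_word //.
case e : (box_of T k) => [i j] /=; have [ij _] := rowlen_take hk e.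
by rewrite subnKC.
Qed.

(** The box above a box carries a smaller entry; hence the upper row already reaches that column,
    which in shifted coordinates makes it longer by at least 2 than the part of the lower row filled
    so far. *)
Lemma std_lattice : lattice w.
Proof.
apply/latticeP => k; rewrite size_row_word => hk; rewrite nth_row_word //.
case e : (box_of T k) => [i j] /=; have [ij rl] := rowlen_take hk e.
rewrite /addable_row rl; case: i ij e rl => // i ij e rl /=.
have := box_of_mem hk; rewrite std_mem e mem_diagram => /and3P[hi _ jl].
have ld := la_decr hi.
have mb : (i, j) \in T by rewrite std_mem mem_diagram; lia.
have lt : (index (i, j) T < k)%N.
  rewrite -(index_box_of hk) e; apply: std_lt => //; first by rewrite -e box_of_mem.
  by rewrite /box_lt /= eqxx ltnSn orbT.
set p := index _ _ in lt.
have hp : (p < n)%N by apply: ltn_trans hk.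
have ep : box_of T p = (i, j) by rewrite /box_of nth_index.
have [ij' rp] := rowlen_take hp ep.
have : (rowlen (take p.+1 w) i <= rowlen (take k w) i)%N.
  rewrite -(subnKC lt) takeD /rowlen [in X in (_ <= X)%N]count_cat; exact: leq_addr.
rewrite (take_nth 0%N) ?size_row_word // rowlen_rcons rp nth_row_word // ep eqxx /=.
by move: ij; clear; lia.
Qed.

End Standard.

Lemma row_word_inj la T T' : strict_partition la -> T \in std_tableaux la ->
  T' \in std_tableaux la -> row_word T = row_word T' -> T = T'.
Proof.
move=> hla hT hT' e; apply: (@eq_from_nth _ (0, 0)%N).
  by rewrite !(@std_size la).
move=> k; rewrite (std_size hT) => hk; rewrite -!/(box_of _ _).
by rewrite (box_of_word hT hk) (box_of_word hT' hk) e.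
Qed.

End Tableaux.

(** * Adjacent transpositions of standard tableaux *)

Section TableauSwap.
Implicit Types (la : seq nat) (T : tableau) (b : box) (a i j k : nat).

Definition swap_idx a k := if k == a then a.+1 else if k == a.+1 then a else k.

Lemma swap_idxK a : involutive (swap_idx a).
Proof.
move=> k; rewrite /swap_idx; case: (eqVneq k a) => [->|ka].
  by rewrite gtn_eqF // eqxx.
case: (eqVneq k a.+1) => [->|kb]; first by rewrite eqxx.
by rewrite (negbTE ka) (negbTE kb).
Qed.

Lemma swap_idx_lt n a k : (a.+1 < n)%N -> (k < n)%N -> (swap_idx a k < n)%N.
Proof. by move=> ha; rewrite /swap_idx; do 2?case: eqP => //; lia. Qed.

Lemma adjE n a (h : (a.+1 < n)%N) (k : 'I_n) : adj n a k = swap_idx a k :> nat.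
Proof.
rewrite /adj !insubT /= ?(ltnW h) // => h'.
rewrite permE /= /swap_idx -!val_eqE /=.
by case: (k == a :> nat) => //; case: (k == a.+1 :> nat).
Qed.

Lemma size_tab_act n (s : 'S_n) T : size (tab_act s T) = n.
Proof. by rewrite size_map size_enum_ord. Qed.

Lemma box_of_tab_act n a T k : (a.+1 < n)%N -> (k < n)%N ->
  box_of (tab_act (adj n a) T) k = box_of T (swap_idx a k).
Proof.
move=> h hk; rewrite /box_of /tab_act (nth_map (Ordinal hk)) ?size_enum_ord //.
have -> : ((adj n a)^-1 = adj n a)%g.
  by rewrite /adj; case: (insub a : option 'I_n) => [i|]; [case: (insub a.+1 : option 'I_n) => [j|] |]; rewrite ?tpermV ?invg1.
by rewrite adjE // nth_enum_ord.
Qed.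

Section Standard.
Variables (la : seq nat) (T : tableau) (a : nat).
Hypotheses (hla : strict_partition la) (hT : T \in std_tableaux la).
Local Notation n := (sumn la).
Hypothesis ha : (a.+1 < n)%N.
Local Notation w := (row_word T).
Local Notation sT := (tab_act (adj n a) T).

Lemma perm_tab_act : perm_eq sT T.
Proof.
apply: uniq_perm; last 1 first.
- move=> b; apply/(nthP (0, 0)%N)/(nthP (0, 0)%N) => -[k hk <-].
    rewrite size_tab_act in hk; exists (swap_idx a k).
      by rewrite (std_size hT) swap_idx_lt.
    by rewrite -/(box_of _ _) -/(box_of _ _) box_of_tab_act.
  rewrite (std_size hT) in hk; exists (swap_idx a k).
    by rewrite size_tab_act swap_idx_lt.
  by rewrite -/(box_of _ _) -/(box_of _ _) box_of_tab_act ?swap_idx_lt // swap_idxK.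
- apply/(uniqP (0, 0)%N) => k l; rewrite !inE size_tab_act => hk hl.
  rewrite -!/(box_of _ _) !box_of_tab_act //.
  move/(congr1 (index^~ T)); rewrite !(index_box_of hT) ?swap_idx_lt //.
  exact: (can_inj (swap_idxK a)).
exact: (std_uniq hT).
Qed.

Lemma index_tab_act b : b \in T -> index b sT = swap_idx a (index b T).
Proof.
move=> hb; have hi : (index b T < n)%N by rewrite -(std_size hT) index_mem.
have us : uniq sT by rewrite (perm_uniq perm_tab_act) (std_uniq hT).
have e : b = box_of sT (swap_idx a (index b T)).
  by rewrite box_of_tab_act ?swap_idx_lt // swap_idxK /box_of nth_index.
by rewrite {1}e index_uniq // size_tab_act swap_idx_lt.
Qed.

(** Exchanging two consecutive entries reverses no comparison other than the one between
    themselves. *)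
Lemma std_swap : (sT \in std_tableaux la) = ~~ box_lt (box_of T a) (box_of T a.+1).
Proof.
have ha' : (a < n)%N by apply: ltnW.
apply/std_tableauxP/idP => [[_ lt]|nlt].
  apply/negP => /lt; rewrite !(perm_mem perm_tab_act) !(box_of_mem hT) //.
  move=> /(_ erefl erefl); rewrite !index_tab_act ?(box_of_mem hT) //.
  by rewrite !(index_box_of hT) // /swap_idx !eqxx gtn_eqF // ltnNge leqW.
split; first by rewrite (perm_trans perm_tab_act) // (std_perm hT).
move=> b b'; rewrite !(perm_mem perm_tab_act) => hb hb' lt.
have := std_lt hT hb hb' lt; rewrite !index_tab_act //.
have : ~~ ((index b T == a) && (index b' T == a.+1)).
  apply: contra nlt => /andP[/eqP e /eqP e'].
  by rewrite -e' -e /box_of !nth_index.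
move: (index b T) (index b' T) => x y; rewrite /swap_idx.
by case: (x =P a); case: (x =P a.+1); case: (y =P a); case: (y =P a.+1) => /=; lia.
Qed.

Lemma row_word_swap : row_word sT =
  take a w ++ [:: nth 0%N w a.+1, nth 0%N w a & drop a.+2 w].
Proof.
have sw : size w = n := size_row_word hT.
apply: (@eq_from_nth _ 0%N).
  by rewrite size_map size_tab_act size_cat /= size_take size_drop sw; case: ltnP; lia.
move=> k; rewrite size_map size_tab_act => hk.
rewrite (nth_map (0, 0)%N) ?size_tab_act // -/(box_of _ _) box_of_tab_act //.
rewrite -(nth_row_word hT) ?swap_idx_lt // nth_cat size_takel ?sw ?(ltnW (ltnW ha)) //.
rewrite /swap_idx; case: (ltngtP k a) => [h|h|->].
- by rewrite nth_take // ltn_eqF // ltnW.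
- case: eqVneq => [->|h']; first by rewrite subSnn.
  have -> : (k - a = (k - a.+2).+2)%N by lia.
  by rewrite /= nth_drop subnKC //; lia.
by rewrite subnn.
Qed.

Lemma row_word_split : w =
  take a w ++ [:: nth 0%N w a, nth 0%N w a.+1 & drop a.+2 w].
Proof.
have sw : size w = n := size_row_word hT.
by rewrite -!drop_nth ?sw ?cat_take_drop // ltnW.
Qed.

(** A box between these two in their common row or column would carry an entry strictly between [a]
    and [a.+1], so the two boxes are adjacent. *)
Lemma box_lt_content : box_lt (box_of T a) (box_of T a.+1) ->
  wcont w a.+1 = (wcont w a).+1 \/ wcont w a = (wcont w a.+1).+1.
Proof.
have ha' : (a < n)%N by apply: ltnW.
move=> lt; rewrite !(wcont_row_word hT) //.
case ea : (box_of T a) lt => [i j]; case eb : (box_of T a.+1) => [i' j'].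
have [ij _] := rowlen_take hT ha' ea; have [ij' _] := rowlen_take hT ha eb.
have ma := box_of_mem hT ha'; have mb := box_of_mem hT ha.
have between b : b \in T -> box_lt (i, j) b -> box_lt b (i', j') -> False.
  move=> hb l1 l2; have h1 := std_lt hT ma hb; have h2 := std_lt hT hb mb.
  rewrite (index_box_of hT) // ea in h1; rewrite (index_box_of hT) // eb in h2.
  by have := h1 l1; have := h2 l2; lia.
rewrite ea eb !(std_mem hT) !mem_diagram in ma mb.
have [/and3P[ila _ jl] /and3P[ila' _ jl']] := (ma, mb).
rewrite {1}/box_lt /= => /orP[/andP[/eqP ei lt]|/andP[/eqP ej lt]].
  subst i'; left; case: (eqVneq j' j.+1) => [|nj]; first by lia.
  case: (between (i, j.+1)); rewrite /box_lt /= ?eqxx ?ltnSn //; last by lia.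
  by rewrite (std_mem hT) mem_diagram; lia.
subst j'; right; case: (eqVneq i' i.+1) => [|ni]; first by lia.
(* The right ends of the rows of a shifted diagram weakly decrease downwards, so the box just below
   [(i, j)] exists as soon as a lower one in the same column does. *)
have mono k : (i.+1 + k < size la)%N ->
    (i.+1 + k + nth 0 la (i.+1 + k) <= i.+1 + nth 0 la i.+1)%N.
  elim: k => [|k IH]; first by rewrite addn0.
  rewrite addnS => h; have := la_decr hla h; have := IH (ltnW h); lia.
case: (between (i.+1, j)); rewrite /box_lt /= ?eqxx ?ltnSn ?orbT //; last by lia.
rewrite (std_mem hT) mem_diagram; have := mono (i' - i.+1)%N.
by rewrite subnKC //; lia.
Qed.

End Standard.

Definition box_lex b b' := (b.1 < b'.1)%N || (b.1 == b'.1) && (b.2 < b'.2)%N.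

Lemma box_lex_trans : transitive box_lex.
Proof. by move=> [i j] [i1 j1] [i2 j2]; rewrite /box_lex /=; lia. Qed.

Lemma diagram_pairwise la : pairwise box_lex (diagram la).
Proof.
rewrite /diagram; move: (size la) 0%N => k; elim: k => //= k IH m.
rewrite pairwise_cat IH andbT pairwise_map; apply/andP; split.
  apply/allrelP => b b' /mapP[j _ ->] /allpairsPdep[i [j' [hi _ ->]]].
  by move: hi; rewrite /box_lex mem_iota /= => /andP[->].
apply: (@sub_pairwise _ ltn); first by move=> j j' /= h; rewrite /box_lex /= eqxx ltnn.
by rewrite -(sorted_pairwise ltn_trans) iota_ltn_sorted.
Qed.

Lemma row_tableau_std la : row_tableau la \in std_tableaux la.
Proof.
apply/std_tableauxP; split=> // b b' hb hb'.
have so : sorted box_lex (diagram la).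
  by rewrite (sorted_pairwise box_lex_trans) diagram_pairwise.
have nl c c' : box_lex c c' -> box_lex c' c -> False.
  by move: c c' => [i j] [i' j']; rewrite /box_lex /=; lia.
move=> lt; have lex : box_lex b b'.
  by move: lt; rewrite /box_lt /box_lex; lia.
rewrite ltnNge leq_eqVlt; apply/negP => /orP[/eqP e|h].
  have : b = b' by rewrite -(nth_index (0, 0)%N hb) -e nth_index.
  by move=> bb; subst b'; exact: (nl b b).
by apply: nl lex _; apply: (sorted_ltn_index box_lex_trans so).
Qed.

Lemma row_tableau_sorted la : sorted leq (row_word (row_tableau la)).
Proof.
rewrite (sorted_pairwise leq_trans) pairwise_map; apply: sub_pairwise (diagram_pairwise la).
by move=> b b'; rewrite /box_lex /=; lia.
Qed.

Lemma perm_row_word la T : T \in std_tableaux la ->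
  perm_eq (row_word T) (row_word (row_tableau la)).
Proof. by move=> hT; apply: perm_map; rewrite (std_perm hT). Qed.

End TableauSwap.

(** * The idempotent of the row tableau *)

Section Shapes.
Implicit Types (w : seq nat) (i j k : nat).

Definition word_boxes w : seq box :=
  [seq (nth 0%N w k, (nth 0%N w k + wcont w k)%N) | k <- iota 0 (size w)].

Lemma word_boxes_rcons w i :
  word_boxes (rcons w i) = rcons (word_boxes w) (i, (i + rowlen w i)%N).
Proof.
rewrite /word_boxes size_rcons -(addn1 (size w)) iotaD map_cat add0n /= cats1.
rewrite wcont_rcons nth_rcons ltnn eqxx; congr rcons.
apply/eq_in_map => k; rewrite mem_iota /= add0n => hk.
by rewrite nth_rcons hk -cats1 wcont_cat.
Qed.

Lemma is_diag_box i r : is_diag (i, (i + r)%N) = (r == 0)%N.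
Proof. by rewrite /is_diag /= -{1}(addn0 i) eqn_add2l eq_sym. Qed.

Lemma row_word_boxes w : row_word (word_boxes w) = w.
Proof. by rewrite /row_word -map_comp; apply: mkseq_nth. Qed.

Lemma std_word_boxes la T k : T \in std_tableaux la -> (k <= sumn la)%N ->
  take k T = word_boxes (take k (row_word T)).
Proof.
move=> hT hk; have sT := std_size hT; have sw := size_row_word hT.
apply: (@eq_from_nth _ (0, 0)%N).
  by rewrite size_map size_iota !size_takel ?sT ?sw.
move=> l; rewrite size_takel ?sT // => hl.
rewrite (nth_map 0%N) ?size_iota ?size_takel ?sw // nth_iota ?size_takel ?sw //.
have hn : (l < sumn la)%N by apply: leq_trans hk.
rewrite add0n !nth_take // -/(box_of T l) (box_of_word hT) // /wcont nth_take //.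
by rewrite take_takel // ltnW.
Qed.

(** A diagonal box opens a row, and only the first empty row can be opened. Hence the nonempty rows
    are initial and the diagonal boxes count them, as [shape_of] presumes. *)
Lemma count_diag w i : lattice w ->
  (0 < rowlen w i)%N = (i < count is_diag (word_boxes w))%N.
Proof.
elim/last_ind: w i => [//|w l IH] i; rewrite lattice_rcons => /andP[lw al].
rewrite word_boxes_rcons rowlen_rcons -cats1 count_cat /= addn0 is_diag_box.
have {}IH j := IH j lw; move: (count _ _) IH => L IH.
case: (posnP (rowlen w l)) => [rl|rl]; last first.
  rewrite addn0 -IH.
  by case: eqVneq => [<-|_]; rewrite ?addn0 // rl ltn_addr.
have lL : l = L.
  have := IH l; rewrite rl => /esym/negbT; rewrite -leqNgt => Ll.
  apply/eqP; rewrite eqn_leq Ll andbT; move: al; rewrite /addable_row rl.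
  case: (posnP l) => [->//|l0 /=]; rewrite -[in (l <= L)%N](prednK l0) -IH.
  by move/ltnW.
rewrite addn1 (ltnS i) (leq_eqVlt i) -IH lL (eq_sym L).
by case: eqVneq => [->|_]; rewrite ?addn1 // addn0.
Qed.

Lemma nth_shape_of w i : lattice w ->
  nth 0%N (shape_of (word_boxes w)) i = rowlen w i.
Proof.
move=> lw; rewrite /shape_of; case: (ltnP i (count is_diag (word_boxes w))) => hi.
  rewrite (nth_map 0%N) ?size_iota // nth_iota // add0n.
  by rewrite -[in RHS](row_word_boxes w) /rowlen (count_map fst).
rewrite nth_default ?size_map ?size_iota //.
by apply/esym/eqP; rewrite -leqn0 leqNgt count_diag // -leqNgt.
Qed.

Lemma size_shape_of V : size (shape_of V) = count is_diag V.
Proof. by rewrite size_map size_iota. Qed.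

Lemma shape_of_strict w : lattice w -> strict_partition (shape_of (word_boxes w)).
Proof.
move=> lw; apply/andP; split.
  apply/(sortedP 0%N) => i; rewrite size_shape_of => hi; rewrite /= !nth_shape_of //.
  have := lattice_decr i lw; have : (0 < rowlen w i)%N by rewrite count_diag // ltnW.
  by lia.
apply/(all_nthP 0%N) => i; rewrite size_shape_of => hi.
by rewrite /= nth_shape_of // count_diag.
Qed.

Lemma incr_shape_strict w i : lattice w ->
  ((i <= count is_diag (word_boxes w))%N
   && strict_partition (incr_nth (shape_of (word_boxes w)) i)) = addable_row w i.
Proof.
move=> lw; set L := count _ _; set mu := shape_of _.
have nmu j : nth 0%N (incr_nth mu i) j = ((i == j) + rowlen w j)%N.
  by rewrite nth_incr_nth nth_shape_of.
apply/andP/idP => [[hi st]|ai].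
  rewrite /addable_row; case: i hi st nmu => //= i hi /andP[/(sortedP 0%N) st _] nmu.
  have := st i; rewrite !nmu eqxx gtn_eqF // add0n add1n; apply.
  by rewrite size_incr_nth size_shape_of -/L; case: ifP.
have hi : (i <= L)%N.
  move: ai; rewrite /addable_row; case: (posnP i) => [->//|i0 /=].
  move=> h; have : (0 < rowlen w i.-1)%N by apply: leq_ltn_trans h.
  by rewrite count_diag // -/L prednK.
split=> //; have lwi : lattice (rcons w i) by rewrite lattice_rcons lw.
rewrite (_ : incr_nth mu i = shape_of (word_boxes (rcons w i))) ?shape_of_strict //.
have e j : nth 0%N (incr_nth mu i) j = nth 0%N (shape_of (word_boxes (rcons w i))) j.
  by rewrite nmu nth_shape_of // rowlen_rcons addnC.
apply: (@eq_from_nth _ 0%N) => // ; apply/eqP.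
rewrite size_incr_nth !size_shape_of -/L word_boxes_rcons -cats1 count_cat -/L /=.
rewrite is_diag_box addn0.
case: (posnP (rowlen w i)) => r0 /=; last by rewrite addn0 /L -count_diag // r0.
have := count_diag i lw; rewrite r0 -/L => <-; rewrite addn1.
have := count_diag i lw; rewrite r0 -/L => /esym/negbT; rewrite -leqNgt => h.
by rewrite eqSS eqn_leq hi h.
Qed.

Lemma mem_possible_entries w (q : barred_box) : lattice w -> reflect
  (exists2 i, addable_row w i & q.1 = (i, (i + rowlen w i)%N) /\ (q.2 -> (0 < rowlen w i)%N))
  (q \in possible_entries (shape_of (word_boxes w))).
Proof.
move=> lw; rewrite mem_filter /addable.
apply: (iffP andP) => [[hq /allpairsP[[b e] [hb _ eq]]]|[i ai [eq hq]]].
  case/mapP: hb => i; rewrite mem_filter mem_iota leq0n add0n size_shape_of ltnS andbC.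
  rewrite incr_shape_strict // nth_shape_of // => ai eb; exists i => //.
  by move: hq; rewrite eq eb /= is_diag_box; split=> //; rewrite lt0n; apply/implyP.
split; first by rewrite eq is_diag_box -lt0n; apply/implyP.
case: q eq hq => b e eb _; apply/allpairsP; exists (b, e); split=> //.
  rewrite [(b, e).1]/= in eb *.
  rewrite eb; apply/mapP; exists i; last by rewrite nth_shape_of.
  by rewrite mem_filter mem_iota leq0n add0n size_shape_of ltnS andbC incr_shape_strict.
by case: (e).
Qed.

End Shapes.

(** * Annihilating products of linear factors *)

Section ProductsOfEigenvalues.
Variables (C : numClosedFieldType) (n : nat).
Local Notation S := (sergeev C n).

Lemma algM (a b : C) : a%:A * b%:A = (a * b)%:A :> S.
Proof. by rewrite mulr_algl scalerA. Qed.

Lemma prod_eval (U : lmodType S) (x : S) (b : C) (L : seq C) (u : U) :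
  x *: u = b%:A *: u ->
  (\prod_(c <- L) (x - c%:A)) *: u = (\prod_(c <- L) (b - c))%:A *: u.
Proof.
move=> e; elim: L => [|c L IH]; first by rewrite !big_nil !scale1r.
rewrite !big_cons -scalerA IH scalerA; set p := \prod_(_ <- L) (b - _).
have -> : (x - c%:A) * p%:A = p%:A * (x - c%:A) by rewrite mulr_algl mulr_algr.
by rewrite -(scalerA p%:A) scalerBl e -!scalerBl scalerA algM mulrC.
Qed.

Lemma prod_eval_right (x : S) (b : C) (L : seq C) (z : S) : z * x = b *: z ->
  z * (\prod_(c <- L) (x - c%:A)) = (\prod_(c <- L) (b - c)) *: z.
Proof.
move=> e; elim: L => [|c L IH]; first by rewrite !big_nil mulr1 scale1r.
rewrite !big_cons mulrA mulrBr e mulr_algr -scalerBl -scalerAl IH scalerA.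
by [].
Qed.

Lemma prod_rem (x : S) (b : C) (L : seq C) : b \in L ->
  \prod_(c <- L) (x - c%:A) = (x - b%:A) * \prod_(c <- rem b L) (x - c%:A).
Proof.
elim: L => // c L IH; rewrite inE big_cons /=; case: eqVneq => [->//|_ /= bL].
rewrite big_cons IH // !mulrA; congr (_ * _).
apply: commrB; last by rewrite /GRing.comm mulr_algl mulr_algr.
apply/commr_sym/commrB; first by [].
by rewrite /GRing.comm mulr_algl mulr_algr.
Qed.

(** From an annihilating list given by [eigen_finite] the factors are discarded one by one: a value
    outside [L] by [eigen_roots], and a value in [L], which is then a repeated factor, by
    [eigen_simple]. *)
Lemma prod_roots w (L : seq C) (z : S) : lattice w -> (size w < n)%N -> weight w z ->
  (forall b, weight_root w b -> b \in L) ->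
  (\prod_(c <- L) (xg (size w) - c%:A)) * z = 0.
Proof.
move=> lw hn + hL; have [rw sw fw] := @spectral C n w lw hn => wz.
have [L0] := fw z wz; elim: L0 z wz => [|b L0 IH] z wz.
  by rewrite big_nil mul1r => ->; rewrite mulr0.
set X := xg (size w); set P := fun L' : seq C => (\prod_(c <- L') (X - c%:A) : S).
have cX L' k : GRing.comm (xg k) (P L').
  apply: commr_prod => c _; apply: commrB; first exact: xg_comm.
  by rewrite /GRing.comm mulr_algl mulr_algr.
have cA (c : C) L' : GRing.comm (P L') (X - c%:A).
  apply: commrB; first exact/esym/cX.
  by rewrite /GRing.comm mulr_algl mulr_algr.
have wP L' (u : S) : weight w u -> weight w (P L' * u).
  by apply: weight_comm => k _; apply: cX.
have wB (c : C) (u : S) : weight w u -> weight w ((X - c%:A) * u).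
  apply: weight_comm => k _; apply: commrB; first exact: xg_comm.
  by rewrite /GRing.comm mulr_algl mulr_algr.
have XB (c : C) (u : S) : (X - c%:A) * u = X * u - c *: u.
  by rewrite mulrBl mulr_algl.
rewrite big_cons -[\prod_(c <- L0) _]/(P L0) -cA -mulrA => /(IH _ (wB b z wz)).
rewrite -/(P L) mulrA cA -mulrA XB => e.
have {}e : X * (P L * z) = b *: (P L * z) by apply/eqP; rewrite -subr_eq0 e.
case: (boolP (b \in L)) => bL; last first.
  by apply: (rw b) => //; [exact: wP | move/hL; apply/negP].
have PL : P L = (X - b%:A) * P (rem b L).
  exact: prod_rem.
set P' := P (rem b L) in PL *.
have XP' : X * (P' * z) = b *: (P' * z).
  apply: sw; rewrite -/X; first exact: wP.
  by rewrite -XB (mulrA (X - b%:A)) -PL e.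
by rewrite PL -mulrA XB XP' subrr.
Qed.

End ProductsOfEigenvalues.

(** * The element attached to an unbarred standard tableau *)

Section PrimitiveIdempotent.
Variables (C : numClosedFieldType) (la : seq nat) (T : tableau).
Hypotheses (hla : strict_partition la) (hT : T \in std_tableaux la).
Local Notation n := (sumn la).
Local Notation S := (sergeev C n).
Local Notation w := (row_word T).
Local Notation U := [seq (b, false) | b <- T].
Local Notation entries k := (possible_entries (shape_of (take k T))).
Local Notation others k := [seq q <- entries k | q != (box_of T k, false)].

Lemma kappaE k : (k < n)%N -> kappa C T k = kq (wcont w k).
Proof. by move=> hk; rewrite /kappa /content /= expr0 mul1r (wcont_row_word hT). Qed.

Let lattice_take k : lattice (take k w).
Proof.
have := std_lattice hla hT; rewrite -{1}(cat_take_drop k w) lattice_cat.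
by case/andP.
Qed.

Let addable_nth k : (k < n)%N -> addable_row (take k w) (nth 0%N w k).
Proof.
by move=> hk; apply: (elimT (latticeP w) (std_lattice hla hT)); rewrite (size_row_word hT).
Qed.

Lemma e_factorE k : (k < n)%N -> e_factor C n U k =
  (\prod_(q <- others k) (kappa C T k - content C q))^-1 *:
  \prod_(c <- [seq content C q | q <- others k]) (xg k - c%:A).
Proof.
move=> hk; have hs : (k < size T)%N by rewrite (std_size hT).
rewrite /e_factor (nth_map (0, 0)%N) // -map_take -map_comp map_id_in //.
by rewrite big_map.
Qed.

Lemma entryP k (q : barred_box) : (k < n)%N -> reflect
  (exists2 i, addable_row (take k w) i &
     q.1 = (i, (i + rowlen (take k w) i)%N) /\ (q.2 -> (0 < rowlen (take k w) i)%N))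
  (q \in entries k).
Proof.
by move=> hk; rewrite (std_word_boxes hT) ?(ltnW hk) //; apply: mem_possible_entries.
Qed.

Lemma content_entry i r (e : bool) : content C ((i, (i + r)%N), e) = (-1) ^+ e * kq r.
Proof. by rewrite /content /= addKn. Qed.

Lemma entry_nth k : (k < n)%N -> (box_of T k, false) \in entries k.
Proof.
move=> hk; apply/entryP => //; exists (nth 0%N w k); first exact: addable_nth.
by split=> //; rewrite (box_of_word hT).
Qed.

Lemma content_inj k : (k < n)%N -> {in entries k &, injective (content C)}.
Proof.
move=> hk [b e] [b' e'] /(entryP _ hk)[i ai [/= -> he]] /(entryP _ hk)[i' ai' [/= -> he']].
rewrite !content_entry => ec.
have ii : i = i'.
  apply: (addable_inj (lattice_take k) ai ai'); apply: (@kq_sq_inj C).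
  have := congr1 (fun x => x * x) ec.
  by rewrite /= mulrACA [RHS]mulrACA -!(expr2 (_ ^+ _)) !sqrr_sign !mul1r.
subst i'; congr (_, _); move: he he' ec; case: (posnP (rowlen (take k w) i)) => [->|r0 _ _].
  by case: e e' => [|] [|] // => [/(_ erefl) | _ /(_ erefl)].
have kz : kq (rowlen (take k w) i) != 0 :> C by rewrite kq_eq0 -lt0n.
have k2 : - kq (rowlen (take k w) i) != kq (rowlen (take k w) i) :> C.
  by rewrite eq_sym -addr_eq0 -mulr2n mulrn_eq0.
case: e e' => [|] [|] //; rewrite ?expr0 ?expr1 ?mul1r ?mulN1r => ec.
  by rewrite ec eqxx in k2.
by rewrite -ec eqxx in k2.
Qed.

Lemma e_factor_den k : (k < n)%N ->
  \prod_(q <- others k) (kappa C T k - content C q) != 0.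
Proof.
move=> hk; rewrite prodf_seq_neq0; apply/allP => q; rewrite mem_filter => /andP[nq hq] /=.
rewrite subr_eq0 -[kappa _ _ _]/(content C (box_of T k, false)).
by apply: contra nq => /eqP/(content_inj hk (entry_nth hk) hq)->.
Qed.

Lemma root_entry k b : (k < n)%N -> weight_root (take k w) b ->
  b \in kappa C T k :: [seq content C q | q <- others k].
Proof.
move=> hk [i ai bi]; rewrite inE.
suff [e he eb] : exists2 e : bool, (e -> (0 < rowlen (take k w) i)%N)
    & b = content C ((i, (i + rowlen (take k w) i)%N), e).
  have : ((i, (i + rowlen (take k w) i)%N), e) \in entries k.
    by apply/entryP => //; exists i.
  case: (eqVneq ((i, (i + rowlen (take k w) i)%N), e) (box_of T k, false)) => [eq _|ne hq].
    by rewrite eb eq eqxx.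
  by rewrite eb map_f ?orbT // mem_filter ne.
have : (b - kq (rowlen (take k w) i)) * (b + kq (rowlen (take k w) i)) = 0.
  rewrite (_ : _ * _ = b * b - kq (rowlen (take k w) i) * kq (rowlen (take k w) i)); last by ring.
  by rewrite bi subrr.
move/eqP; rewrite mulf_eq0 subr_eq0 addr_eq0 => h.
case: (posnP (rowlen (take k w) i)) => r0.
  exists false => //; move: h; rewrite content_entry r0 kq0 oppr0 orbb mulr0 => /eqP->.
  by [].
case/orP: h => /eqP->; [exists false | exists true] => //; rewrite content_entry.
  by rewrite mul1r.
by rewrite expr1 mulN1r.
Qed.

Lemma comm_e_factor k a : (k < n)%N -> GRing.comm (xg a) (e_factor C n U k).
Proof.
move=> hk; rewrite e_factorE // /GRing.comm -(scalerAr _ (xg a)) -(scalerAl _ _ (xg a)).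
congr (_ *: _); apply: commr_prod => c _; apply: commrB; first exact: xg_comm.
by rewrite /GRing.comm mulr_algl mulr_algr.
Qed.

Lemma comm_e_elt a : GRing.comm (xg a) (e_elt C n U).
Proof.
rewrite /e_elt size_map (std_size hT) big_nat; apply: commr_prod => k /andP[_ hk].
exact: comm_e_factor.
Qed.

(** Multiplied by [xg k - (kappa C T k)%:A], the factor of index [k] becomes a product over all
    possible entries, hence over all roots, and [prod_roots] kills it on the product of the earlier
    factors. *)
Lemma weight_e_elt : weight w (e_elt C n U).
Proof.
rewrite /e_elt size_map (std_size hT).
suff E k : (k <= n)%N -> weight (take k w) (\prod_(1 <= j < k) e_factor C n U j).
  by have := E n (leqnn _); rewrite take_oversize ?(size_row_word hT).
elim: k => [_|k IH hk]; first by rewrite take0.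
have sw : size (take k w) = k by rewrite size_takel // (size_row_word hT) ltnW.
rewrite (take_nth 0%N) ?(size_row_word hT) //; apply/weight_rcons; rewrite sw.
(* There is no factor of index 0: the first content is 0 and [xg 0] vanishes. *)
case: k => [|k] in IH hk sw *.
  rewrite big_geq // xg0 mul0r take0 /rowlen /= kq0 scale0r; split=> //.
set P := \prod_(1 <= j < k.+1) _ in IH; rewrite big_nat_recr //= -/P.
have wP := IH (ltnW hk).
have cf : P * e_factor C n U k.+1 = e_factor C n U k.+1 * P.
  have := hk; rewrite e_factorE // => _; rewrite -(scalerAr _ P) -(scalerAl _ _ P).
  congr (_ *: _); apply: commr_prod => c _; apply: commrB; last first.
    by rewrite /GRing.comm mulr_algl mulr_algr.
  apply: commr_sym; rewrite /P big_nat; apply: commr_prod => j /andP[_ hj].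
  by apply: comm_e_factor; lia.
rewrite cf; split; first by apply: weight_comm wP => a _; apply: comm_e_factor.
have /(_ _ wP) := @prod_roots C n _ (kappa C T k.+1 :: [seq content C q | q <- others k.+1]) P (lattice_take k.+1).
rewrite sw => /(_ hk (fun b => @root_entry _ b hk)).
rewrite big_cons -mulrA mulrBl mulr_algl => /eqP; rewrite subr_eq0 => /eqP e.
rewrite -/(wcont w k.+1) -kappaE // e_factorE // -(scalerAl _ _ P) -(scalerAr _ (xg _)) e.
by rewrite !scalerA mulrC.
Qed.

Lemma e_elt_left (V : lmodType S) (v : V) :
  (forall k, (k < n)%N -> xg k *: v = (kappa C T k)%:A *: v) -> e_elt C n U *: v = v.
Proof.
move=> hv; rewrite /e_elt size_map (std_size hT) big_nat.
apply: (big_ind (fun x => x *: v = v)) => [|x y hx hy|k /andP[_ hk]].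
- by rewrite scale1r.
- by rewrite -scalerA hy.
rewrite e_factorE // -mulr_algl -scalerA (prod_eval _ (hv k hk)) big_map scalerA algM.
by rewrite mulVf ?e_factor_den // !scale1r.
Qed.

Lemma e_elt_mull (z : S) : weight w z -> e_elt C n U * z = z.
Proof.
move=> wz; apply: (@e_elt_left S^o) => k hk; rewrite kappaE //.
rewrite -[LHS]/(xg k * z) -[RHS]/((kq (wcont w k))%:A * z) mulr_algl.
by apply: wz; rewrite (size_row_word hT).
Qed.

Lemma e_elt_mulr (z : S) : (forall k, (k < n)%N -> z * xg k = kappa C T k *: z) ->
  z * e_elt C n U = z.
Proof.
move=> hz; rewrite /e_elt size_map (std_size hT) big_nat.
apply: (big_ind (fun x => z * x = z)) => [|x y hx hy|k /andP[_ hk]].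
- by rewrite mulr1.
- by rewrite mulrA hx.
rewrite e_factorE // -(scalerAr _ z) (prod_eval_right _ (hz k hk)) big_map scalerA.
by rewrite mulVf ?e_factor_den // scale1r.
Qed.

(** The content at [d] is 0, so the sign in [xg_cg_anti] is invisible. Thus [cg d * e] is a weight
    vector from the left and [e * cg d] from the right, and both equal [e * cg d * e]. *)
Lemma e_elt_cg d : (d < n)%N -> is_diag (box_of T d) ->
  cg d * e_elt C n U = e_elt C n U * cg d.
Proof.
move=> hd dd; have kd : kappa C T d = 0.
  move: dd; rewrite /is_diag => /eqP dd.
  by rewrite /kappa /content /= dd subnn mul0n sqrtC0 mulr0.
have we k : (k < n)%N -> xg k * e_elt C n U = kappa C T k *: e_elt C n U.
  by move=> hk; rewrite kappaE // weight_e_elt ?(size_row_word hT).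
have kc k : (k < n)%N -> xg k * (cg d * e_elt C n U) = kappa C T k *: (cg d * e_elt C n U).
  move=> hk; rewrite mulrA; case: (eqVneq d k) => [<-|dk].
    by rewrite xg_cg_anti mulNr -mulrA we // kd !scale0r mulr0 oppr0.
  by rewrite xg_cg // -mulrA we // -(scalerAr _ (cg d)).
rewrite -[LHS]e_elt_mull; last by move=> k; rewrite (size_row_word hT) => hk; rewrite kc // kappaE.
rewrite mulrA e_elt_mulr // => k hk.
have ew : e_elt C n U * xg k = kappa C T k *: e_elt C n U by rewrite -comm_e_elt we.
rewrite -mulrA; case: (eqVneq d k) => [<-|dk].
  have -> : cg d * xg d = - (xg d * cg d) :> S by rewrite xg_cg_anti opprK.
  by rewrite mulrN mulrA -comm_e_elt we // kd !scale0r mul0r oppr0.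
by rewrite -xg_cg // mulrA ew -(scalerAl _ _ (cg d)).
Qed.

End PrimitiveIdempotent.

(** * Chains of intertwiners *)

Section DescendingPaths.
Variables (C : numClosedFieldType) (n : nat).
Local Notation S := (sergeev C n).
Implicit Types (w : seq nat) (z y : S).

(** Each intertwiner permutes the eigenvalues, so every factor can be replaced by its form in
    [phi_weight], and the identity becomes [sg_weight_braid]. *)
Lemma phi_braid_weight m y (u v w : C) : (m.+2 < n)%N ->
  xg m * y = u *: y -> xg m.+1 * y = v *: y -> xg m.+2 * y = w *: y ->
  phi m * (phi m.+1 * (phi m * y)) = phi m.+1 * (phi m * (phi m.+1 * y)).
Proof.
move=> h yu yv yw; have h1 : (m.+1 < n)%N by apply: ltnW.
have sw k (z : S) (a b : C) : (k.+1 < n)%N -> xg k * z = a *: z -> xg k.+1 * z = b *: z ->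
    xg k * (phi k * z) = b *: (phi k * z) /\ xg k.+1 * (phi k * z) = a *: (phi k * z).
  move=> hk za zb; split; rewrite mulrA -(phi_xgS, phi_xg) // -?phi_xg // -mulrA ?za ?zb.
    by rewrite -(scalerAr b (phi k)).
  by rewrite -(scalerAr a (phi k)).
have far k l (z : S) (a : C) : l != k -> l != k.+1 -> xg l * z = a *: z ->
    xg l * (phi k * z) = a *: (phi k * z).
  by move=> lk lk1 za; rewrite mulrA -phi_xg_far // -mulrA za -(scalerAr a (phi k)).
have [a0 a1] := sw _ _ _ _ h1 yu yv.
have a2 : xg m.+2 * (phi m * y) = w *: (phi m * y).
  by apply: far yw; rewrite gtn_eqF // ltnW.
have [b1 b2] := sw _ _ _ _ h a1 a2.
have b0 : xg m * (phi m.+1 * (phi m * y)) = v *: (phi m.+1 * (phi m * y)).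
  by apply: far a0; rewrite ltn_eqF // ltnW.
have [c1 c2] := sw _ _ _ _ h yv yw.
have c0 : xg m * (phi m.+1 * y) = u *: (phi m.+1 * y).
  by apply: far yu; rewrite ltn_eqF // ltnW.
have [d0 d1] := sw _ _ _ _ h1 c0 c1.
have d2 : xg m.+2 * (phi m * (phi m.+1 * y)) = v *: (phi m * (phi m.+1 * y)).
  by apply: far c2; rewrite gtn_eqF // ltnW.
rewrite (phi_weight b0 b1) (phi_weight a1 a2) (phi_weight yu yv).
rewrite (phi_weight d1 d2) (phi_weight c0 c1) (phi_weight yv yw).
by rewrite !mulrA sg_weight_braid.
Qed.

Variables (wR : seq nat) (z0 : S).
Hypotheses (sR : sorted leq wR) (lR : lattice wR) (nR : size wR = n) (wz0 : weight wR z0).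

(* [desc_path w z]: [z] is obtained from [z0] by intertwiners along a chain of
   lattice words from [wR] to [w], each step creating a descent. *)
Inductive desc_path : seq nat -> S -> Prop :=
| desc_path_refl : desc_path wR z0
| desc_path_step w0 j h w1 z : (h < j)%N -> lattice (w0 ++ [:: j, h & w1]) ->
    desc_path (w0 ++ [:: h, j & w1]) z ->
    desc_path (w0 ++ [:: j, h & w1]) (phi (size w0) * z).

Lemma perm_swap2 w0 (j h : nat) w1 : perm_eq (w0 ++ [:: j, h & w1]) (w0 ++ [:: h, j & w1]).
Proof. by rewrite perm_cat2l -cat1s -(cat1s h) -(cat1s h (j :: _)) -(cat1s j w1) perm_catCA. Qed.

Lemma desc_path_perm w z : desc_path w z -> perm_eq w wR.
Proof.
by elim=> // w0 j h w1 z' _ _ _; apply: perm_trans; apply: perm_swap2.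
Qed.

Lemma desc_path_lattice w z : desc_path w z -> lattice w.
Proof. by case. Qed.

Lemma desc_path_weight w z : desc_path w z -> weight w z.
Proof.
elim=> // w0 j h w1 z' hj _ dp wz'; apply: weight_phi => //.
  by rewrite -nR -(perm_size (desc_path_perm dp)) size_cat /=; lia.
by rewrite gtn_eqF.
Qed.

(** A measure for inductions on sorting: exchanging a descent lowers it. *)
Fixpoint word_height w : nat :=
  if w is i :: w' then (size w * i + word_height w')%N else 0%N.

Lemma word_height_swap w0 (j h : nat) w1 : (h < j)%N ->
  (word_height (w0 ++ [:: h, j & w1]) < word_height (w0 ++ [:: j, h & w1]))%N.
Proof.
move=> hj; elim: w0 => [|i w0 IH] /=; first by nia.
by rewrite (perm_size (perm_swap2 w0 h j w1)) ltn_add2l.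
Qed.

Lemma sorted_no_descent w0 (j h : nat) w1 : sorted leq (w0 ++ [:: j, h & w1]) -> (h < j)%N -> False.
Proof.
case/cat_sorted2 => _ /= /andP[jh _] hj; by rewrite ltnNge jh in hj.
Qed.

Lemma exists_descent w : ~~ sorted leq w ->
  exists w0 j h w1, w = w0 ++ [:: j, h & w1] /\ (h < j)%N.
Proof.
elim: w => [//|x [//|y w] IH] /=; rewrite negb_and -ltnNge.
case: (ltnP y x) => [yx _|xy /= nw]; first by exists [::], x, y, w.
have [w0 [j [h [w1 [e hj]]]]] := IH nw.
by exists (x :: w0), j, h, w1; rewrite e.
Qed.

Lemma lattice_swap_descent w0 (j h : nat) w1 : lattice (w0 ++ [:: j, h & w1]) -> (h < j)%N ->
  lattice (w0 ++ [:: h, j & w1]).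
Proof.
move=> lw hj; have hj' : h != j by rewrite ltn_eqF.
have gap : h = j.+1 -> ((rowlen w0 h).+1 < rowlen w0 j)%N by lia.
by have [] := lattice_swap lw hj' gap.
Qed.

(** Bubble sort: exchanging a descent leads to a lattice word again, and the only sorted
    rearrangement is [wR]. *)
Lemma desc_path_exists w : perm_eq w wR -> lattice w -> exists z, desc_path w z.
Proof.
have [N] := ubnP (word_height w); elim: N w => // N IH w hN pw lw.
case: (boolP (sorted leq w)) => [sw|/exists_descent [w0 [j [h [w1 [e hj]]]]]].
  exists z0; rewrite (_ : w = wR) //; first exact: desc_path_refl.
  exact: (sorted_eq leq_trans anti_leq).
subst w; have [|||z dz] := IH (w0 ++ [:: h, j & w1]).
- by apply: leq_trans (word_height_swap w0 w1 hj) _; rewrite -ltnS.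
- by rewrite (perm_trans (perm_swap2 w0 h j w1)).
- exact: lattice_swap_descent.
by exists (phi (size w0) * z); apply: desc_path_step.
Qed.

Lemma desc_path_inv w z : desc_path w z -> (w = wR /\ z = z0) \/
  exists w0 j h w1 z1, [/\ w = w0 ++ [:: j, h & w1], (h < j)%N,
    desc_path (w0 ++ [:: h, j & w1]) z1 & z = phi (size w0) * z1].
Proof.
by case=> [|w0 j h w1 z1 hj lw dz]; [left | right; exists w0, j, h, w1, z1].
Qed.

Lemma cat_split (s s' t t' : seq nat) : s ++ t = s' ++ t' -> (size s <= size s')%N ->
  exists2 m, s' = s ++ m & t = m ++ t'.
Proof.
move=> e le; exists (drop (size s) s').
  have := congr1 (take (size s)) e; rewrite take_size_cat // takel_cat // => {1}->.
  by rewrite cat_take_drop.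
by have := congr1 (drop (size s)) e; rewrite drop_size_cat // drop_cat; case: ltngtP le => // ->; rewrite subnn drop0 drop_size.
Qed.

(** Confluence, in the role of Matsumoto's theorem: two last steps coincide, overlap in three
    letters, or are disjoint. The last two cases are closed to a diamond by the braid relation and
    by commutation. *)
Theorem desc_path_unique w z z' : desc_path w z -> desc_path w z' -> z = z'.
Proof.
have [N] := ubnP (word_height w); elim: N w z z' => // N IH w z z' hN dz dz'.
have lw := desc_path_lattice dz; have pw := desc_path_perm dz.
case: (desc_path_inv dz) => [[ew ez]|[w0 [j [h [w1 [z1 [ew hj d1 ez]]]]]]];
  case: (desc_path_inv dz') => [[ew' ez']|[w0' [j' [h' [w1' [z1' [ew' hj' d1' ez']]]]]]].
- by rewrite ez ez'.
- by have := sR; rewrite -ew ew' => /sorted_no_descent/(_ hj').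
- by have := sR; rewrite -ew' ew => /sorted_no_descent/(_ hj).
wlog le : z z' w0 j h w1 z1 w0' j' h' w1' z1' {dz dz'} ew hj d1 ez ew' hj' d1' ez'
    / (size w0 <= size w0')%N => [W|].
  by case/orP: (leq_total (size w0) (size w0')) => le; [|symmetry];
    apply: W le; eassumption.
have lt1 : (word_height (w0 ++ [:: h, j & w1]) < N)%N.
  by move: hN; rewrite ltnS ew; apply: leq_trans; apply: word_height_swap.
have lt1' : (word_height (w0' ++ [:: h', j' & w1']) < N)%N.
  by move: hN; rewrite ltnS ew'; apply: leq_trans; apply: word_height_swap.
have [m em em'] : exists2 m, w0' = w0 ++ m & [:: j, h & w1] = m ++ [:: j', h' & w1'].
  by apply: cat_split le; rewrite -ew.
case: m em em' => [|x [|y m]] em /=.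
- case=> ? ? ?; subst j' h' w1'; move: em; rewrite cats0 => em; subst w0'.
  by rewrite ez ez' (IH _ _ _ lt1 d1 d1').
(* Overlap: the descents share the middle letter of three decreasing ones, and sorting all three
   leads to the common vector [y]. *)
- case=> ? ? ?; subst x j' w1; subst w0'.
  have lw1 := lattice_swap_descent (eq_ind _ lattice lw _ ew) hj.
  have lw1' := lattice_swap_descent (eq_ind _ lattice lw _ ew') hj'.
  have hj2 : (h' < j)%N by apply: ltn_trans hj.
  have r1 a t : (w0 ++ [:: a]) ++ t = w0 ++ a :: t by rewrite -catA.
  rewrite r1 in lw1' d1' lt1'.
  have s1 a : size (w0 ++ [:: a]) = (size w0).+1 by rewrite size_cat addn1.
  have l2 : lattice (w0 ++ [:: h, h', j & w1']).
    by rewrite -r1; apply: lattice_swap_descent hj2; rewrite r1.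
  have l2' : lattice (w0 ++ [:: h', j, h & w1']) by apply: lattice_swap_descent hj2.
  have l3 : lattice (w0 ++ [:: h', h, j & w1']) by apply: lattice_swap_descent hj'.
  have p3 : perm_eq (w0 ++ [:: h', h, j & w1']) wR.
    apply: perm_trans (desc_path_perm d1); apply: perm_trans (perm_swap2 _ _ _ _) _.
    by rewrite -(r1 h) -(r1 h [:: j, _ & _]); apply: perm_swap2.
  have [y dy] := desc_path_exists p3 l3.
  have e1 : z1 = phi (size w0).+1 * (phi (size w0) * y).
    apply: (IH _ _ _ lt1 d1); rewrite -r1 -(s1 h).
    apply: desc_path_step => //; rewrite r1 //.
    exact: desc_path_step.
  have e1' : z1' = phi (size w0) * (phi (size w0).+1 * y).
    apply: (IH _ _ _ lt1' d1'); apply: desc_path_step => //.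
    rewrite -r1 -(s1 h'); apply: desc_path_step => //; rewrite r1 //.
  rewrite ez ez' s1 e1 e1'.
  have wy := desc_path_weight dy; have sy := perm_size p3.
  rewrite nR size_cat /= in sy.
  have hk k : (k < 3)%N -> xg (size w0 + k) * y = kq (wcont (w0 ++ [:: h', h, j & w1']) (size w0 + k)) *: y.
    by move=> hk; rewrite wy // size_cat /=; lia.
  have := hk 0%N erefl; have := hk 1%N erefl; have := hk 2%N erefl.
  rewrite addn0 addn1 addn2 => x2 x1 x0.
  by apply: phi_braid_weight x0 x1 x2; lia.
(* Disjoint descents, with the letters [m] between them; exchanging both leads to the common vector
   [y]. *)
case=> ? ? ?; subst x y w1; subst w0'.
have r2 a b t : (w0 ++ [:: a, b & m]) ++ t = w0 ++ [:: a, b & m ++ t] by rewrite -catA.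
have r3 a b t : w0 ++ [:: a, b & m ++ t] = (w0 ++ [:: a, b & m]) ++ t by rewrite -catA.
have lw1 := lattice_swap_descent (eq_ind _ lattice lw _ ew) hj.
have lw1' := lattice_swap_descent (eq_ind _ lattice lw _ ew') hj'.
rewrite r2 in d1' lt1' lw1'.
have l2 : lattice (w0 ++ [:: h, j & m ++ [:: h', j' & w1']]).
  exact: lattice_swap_descent hj.
have p2 : perm_eq (w0 ++ [:: h, j & m ++ [:: h', j' & w1']]) wR.
  by apply: perm_trans (desc_path_perm d1'); apply: perm_swap2.
have [y dy] := desc_path_exists p2 l2.
have s2 a b : size (w0 ++ [:: a, b & m]) = (size w0 + size m).+2.
  by rewrite size_cat /= !addnS.
have e1 : z1 = phi (size w0 + size m).+2 * y.
  apply: (IH _ _ _ lt1 d1); rewrite r3 -(s2 h j); apply: desc_path_step => //.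
    by rewrite r2.
  by rewrite r2.
have e1' : z1' = phi (size w0) * y.
  by apply: (IH _ _ _ lt1' d1'); apply: desc_path_step.
rewrite ez ez' s2 e1 e1' !mulrA phi_far //; lia.
Qed.

(** If the swap creates a descent, uniqueness gives [k = 1]. Otherwise [z] is itself the image of
    [z'], and the square of the intertwiner is a nonzero scalar because both rows are addable to
    [w0]. *)
Lemma desc_path_phi w0 (j h : nat) w1 z z' : h != j ->
  desc_path (w0 ++ [:: j, h & w1]) z -> desc_path (w0 ++ [:: h, j & w1]) z' ->
  exists2 k : C, k != 0 & phi (size w0) * z = k *: z'.
Proof.
move=> hj dz dz'; case: (ltngtP j h) hj => // [jh|hj] _.
  exists 1; rewrite ?oner_eq0 // scale1r; apply: (desc_path_unique _ dz').
  by apply: desc_path_step => //; apply: desc_path_lattice dz'.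
have ez : z = phi (size w0) * z'.
  apply: (desc_path_unique dz); apply: desc_path_step => //.
  exact: desc_path_lattice dz.
have lw := desc_path_lattice dz; have hj' : h != j by rewrite ltn_eqF.
have gap : h = j.+1 -> ((rowlen w0 h).+1 < rowlen w0 j)%N by lia.
have [_ aj ah] := lattice_swap lw hj' gap.
have lw0 : lattice w0 by move: lw; rewrite lattice_cat => /andP[].
have sn : ((size w0).+1 < n)%N.
  by rewrite -nR -(perm_size (desc_path_perm dz)) size_cat /=; lia.
have /weight_cons2[_ x0 x1] : weight (w0 ++ [:: h; j]) z'.
  have := desc_path_weight dz'; rewrite -[[:: h, j & w1]]/([:: h; j] ++ w1) catA.
  exact: weight_catl.
rewrite rowlen_rcons (negbTE hj') addn0 in x1.
exists (phi_scalar (rowlen w0 h) (kq (rowlen w0 j) * kq (rowlen w0 j))).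
  by apply: phi_scalar_neq0; have := addable_gap2 lw0 hj' ah aj; lia.
by rewrite ez (phi_sq_kq sn x0 (eigen2 x1)).
Qed.

Lemma desc_path_phi0 w0 (j h : nat) w1 z : desc_path (w0 ++ [:: j, h & w1]) z ->
  let s := rowlen w0 j in let t := rowlen (rcons w0 j) h in
  (t = s.+1 \/ s = t.+1) -> phi (size w0) * z = 0.
Proof.
move=> dz s t st; have lw := desc_path_lattice dz.
have [lw0 aj] : lattice w0 /\ addable_row w0 j.
  by move: lw; rewrite lattice_cat /= => /and3P[].
have sn : ((size w0).+1 < n)%N.
  by rewrite -nR -(perm_size (desc_path_perm dz)) size_cat /=; lia.
have wz : weight (w0 ++ [:: j; h]) z.
  have := desc_path_weight dz; rewrite -[[:: j, h & w1]]/([:: j; h] ++ w1) catA.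
  exact: weight_catl.
have [_ x0 x1] := weight_cons2 wz.
have [r0 _ _] := @spectral C n w0 lw0 (ltnW sn).
apply: (r0 (kq t)); first by apply: weight_phi_last; last exact: weight_catl wz.
  by rewrite mulrA -phi_xgS // -mulrA x1 -(scalerAr _ (phi _)).
exact: (no_root_of_gap lw0 aj (erefl _)).
Qed.

End DescendingPaths.

(** * The Clifford algebra *)

Section Parity.
Variables (C : numClosedFieldType) (n : nat).
Local Notation S := (sergeev C n).
Implicit Types (x y : S) (a b : nat).

(* The parity automorphism. *)
Definition theta x : S :=
  seval (fun i => - scl (St i) : S) (fun i => - scl (Sc i) : S) (srep x).

Lemma theta_scl e : theta (scl e) =
  seval (fun i => - scl (St i) : S) (fun i => - scl (Sc i) : S) e.
Proof.
apply: sevalP (seqv_rep e); rewrite /= => *; rewrite ?mulrNN ?mulNr ?mulrN ?opprK.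
- by rewrite sclM; apply/sclP/seqv_tt.
- congr (- _); rewrite !(sclM (St _)) !(sclM (Smul _ _)).
  by apply/sclP; apply: seqv_braid.
- by rewrite !sclM sclN; apply/sclP; apply: seqv_far.
- by rewrite sclM -[1]/(scl Sone) sclN; apply/sclP/seqv_cc.
- by rewrite !sclM sclN; apply/sclP; apply: seqv_cC.
by rewrite !sclM sclN; apply/sclP/seqv_tc.
Qed.

Lemma thetaD x y : theta (x + y) = theta x + theta y.
Proof.
by elim/sclW: x => x; elim/sclW: y => y; rewrite [scl x + scl y]scl_add !theta_scl.
Qed.

Lemma thetaM x y : theta (x * y) = theta x * theta y.
Proof. by elim/sclW: x => x; elim/sclW: y => y; rewrite sclM !theta_scl. Qed.

Lemma thetaZ k x : theta (k *: x) = k *: theta x.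
Proof. by elim/sclW: x => x; rewrite [k *: scl x]scl_scale !theta_scl. Qed.

Lemma theta1 : theta 1 = 1.
Proof. by rewrite -[1]/(scl Sone) theta_scl. Qed.

Lemma theta0 : theta 0 = 0.
Proof. by rewrite -[0]/(scl Szero) theta_scl. Qed.

Lemma thetaN x : theta (- x) = - theta x.
Proof. by rewrite -scaleN1r thetaZ scaleN1r. Qed.

Lemma theta_tg a : theta (tg a) = - tg a.
Proof.
case: (ltnP a n.-1) => h; last by rewrite tg_out // theta0 oppr0.
by rewrite tgE theta_scl.
Qed.

Lemma theta_cg a : theta (cg a) = - cg a.
Proof.
case: (ltnP a n) => h; last by rewrite cg_out // theta0 oppr0.
by rewrite cgE theta_scl.
Qed.

Lemma homog_theta p x : homog p x -> theta x = (-1) ^+ p *: x.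
Proof.
elim=> [q||a|a|q y z _ e1 _ e2|q k y _ e|q q' y z _ e1 _ e2].
- by rewrite theta0 scaler0.
- by rewrite theta1 scale1r.
- by rewrite theta_tg expr1 scaleN1r.
- by rewrite theta_cg expr1 scaleN1r.
- by rewrite thetaD e1 e2 scalerDr.
- by rewrite thetaZ e !scalerA mulrC.
by rewrite thetaM e1 e2 signr_addb -scalerAl -scalerAr scalerA.
Qed.

Lemma homogN p x : homog p x -> homog p (- x).
Proof. by rewrite -scaleN1r; apply: homogZ. Qed.

Lemma homogB p x y : homog p x -> homog p y -> homog p (x - y).
Proof. by move=> hx hy; apply: homogD => //; apply: homogN. Qed.

Lemma homog_even_prod (I : eqType) (r : seq I) (F : I -> S) :
  (forall i, i \in r -> homog false (F i)) -> homog false (\prod_(i <- r) F i).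
Proof.
elim: r => [|i r IH] h; first by rewrite big_nil; apply: homog_1.
rewrite big_cons; apply: (@homogM _ _ false false); first exact: h (mem_head _ _).
by apply: IH => j hj; apply: h; rewrite inE hj orbT.
Qed.

Lemma homog_split x : exists x0 x1, [/\ homog false x0, homog true x1 & x = x0 + x1].
Proof.
elim/sergeev_ind: x => [||x y [x0 [x1 [h0 h1 ->]]] [y0 [y1 [k0 k1 ->]]]|
  k x [x0 [x1 [h0 h1 ->]]]|x y [x0 [x1 [h0 h1 ->]]] [y0 [y1 [k0 k1 ->]]]|a|a].
- by exists 0, 0; rewrite addr0; split=> //; apply: homog_0.
- by exists 1, 0; rewrite addr0; split; [apply: homog_1 | apply: homog_0 | ].
- by exists (x0 + y0), (x1 + y1); split; [apply: homogD | apply: homogD | rewrite addrACA].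
- by exists (k *: x0), (k *: x1); split; [apply: homogZ | apply: homogZ | rewrite scalerDr].
- exists (x0 * y0 + x1 * y1), (x0 * y1 + x1 * y0); split.
  + by apply: homogD; [exact: (@homogM _ _ false false) | exact: (@homogM _ _ true true)].
  + by apply: homogD; [exact: (@homogM _ _ false true) | exact: (@homogM _ _ true false)].
  by rewrite mulrDl !mulrDr; lin C.
- by exists 0, (tg a); rewrite add0r; split; [apply: homog_0 | apply: homog_t | ].
by exists 0, (cg a); rewrite add0r; split; [apply: homog_0 | apply: homog_c | ].
Qed.

Lemma homog_jm a : homog true (jm a : S).
Proof.
elim: a => [|a IH]; first by rewrite jm0; apply: homog_0.
rewrite jmS; apply: homogB; first exact: homog_t.
apply: (@homogM _ _ false true); last exact: homog_t.
by apply: (@homogM _ _ true true) => //; exact: homog_t.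
Qed.

Lemma homog_xg a : homog false (xg a : S).
Proof. by apply/homogZ/(@homogM _ _ true true); [apply: homog_jm | apply: homog_c]. Qed.

Lemma homog_sg a : homog false (sg a : S).
Proof.
apply/homogZ/(@homogM _ _ true true); first exact: homog_t.
by apply: homogB; apply: homog_c.
Qed.

Lemma homog_phi a : homog false (phi a : S).
Proof.
have x2 b : homog false (xg b ^+ 2 : S).
  by apply: (@homogM _ _ false false); apply: homog_xg.
apply: homogB; first apply: homogD; first apply: homogD; try exact: homog_xg.
  by apply: (@homogM _ _ false false); [apply: homog_sg | apply: homogB].
apply: (@homogM _ _ false false); last by apply: homogB; apply: homog_xg.
by apply: (@homogM _ _ true true); apply: homog_c.
Qed.

End Parity.

Section Clifford.
Variables (C : numClosedFieldType) (n : nat).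
Local Notation S := (sergeev C n).
Implicit Types (x y p q : S) (a b : nat) (P Q : pred nat) (l : seq nat).

(* On the Clifford algebra, the automorphism changing the sign of [cg b] only. *)
Definition flip b x : S := - (cg b * theta x * cg b).

Lemma flipD b x y : flip b (x + y) = flip b x + flip b y.
Proof. by rewrite /flip thetaD mulrDr mulrDl opprD. Qed.

Lemma flipZ b k x : flip b (k *: x) = k *: flip b x.
Proof. by rewrite /flip thetaZ -(scalerAr k (cg b)) -(scalerAl k _ (cg b)) scalerN. Qed.

Lemma flipM b x y : (b < n)%N -> flip b (x * y) = flip b x * flip b y.
Proof.
move=> hb; rewrite /flip thetaM mulrNN.
have -> : cg b * theta x * cg b * (cg b * theta y * cg b) =
    cg b * theta x * (cg b * cg b) * (theta y * cg b) by rewrite !mulrA.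
by rewrite cg_sq // mulrN1 mulNr !mulrA.
Qed.

Lemma flip1 b : (b < n)%N -> flip b 1 = 1.
Proof. by move=> hb; rewrite /flip theta1 mulr1 cg_sq // opprK. Qed.

Lemma flip_cg a b : (b < n)%N -> flip b (cg a) = if a == b then - cg a else cg a.
Proof.
move=> hb; rewrite /flip theta_cg mulrN mulNr opprK; case: eqVneq => [->|ab].
  by rewrite cg_sq // mulN1r.
by rewrite (cg_anti _ _ (_ : b != a)) 1?eq_sym // mulNr -mulrA cg_sq // mulrN1 opprK.
Qed.

Definition cl P : set S := subalg [set z | exists2 a, P a & z = cg a]%classic.

Lemma cl0 P : cl P 0.
Proof. by rewrite -(scale0r 1); apply/subalgZ/subalg_1. Qed.

Lemma cl1 P : cl P 1. Proof. exact: subalg_1. Qed.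

Lemma clA P (k : C) : cl P k%:A. Proof. exact/subalgZ/subalg_1. Qed.

Lemma cl_cg P a : P a -> cl P (cg a).
Proof. by move=> h; apply: subalg_gen; exists a. Qed.

Lemma clB P x y : cl P x -> cl P y -> cl P (x - y).
Proof. by move=> hx hy; rewrite -scaleN1r; apply: subalgD => //; apply: subalgZ. Qed.

Lemma sub_cl P Q x : {subset P <= Q} -> cl P x -> cl Q x.
Proof.
move=> PQ; elim=> [y [a Pa ->]||y z _ h1 _ h2|k y _ h|y z _ h1 _ h2].
- by apply: cl_cg; apply: PQ.
- exact: cl1.
- exact: subalgD.
- exact: subalgZ.
exact: subalgM.
Qed.

Lemma theta_cl P x : cl P x -> cl P (theta x).
Proof.
elim=> [y [a Pa ->]||y z _ h1 _ h2|k y _ h|y z _ h1 _ h2].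
- by rewrite theta_cg -scaleN1r; apply/subalgZ/cl_cg.
- by rewrite theta1; apply: cl1.
- by rewrite thetaD; apply: subalgD.
- by rewrite thetaZ; apply: subalgZ.
by rewrite thetaM; apply: subalgM.
Qed.

Lemma cg_cl P b x : ~~ P b -> cl P x -> cg b * x = theta x * cg b.
Proof.
move=> Pb; elim=> [y [a Pa ->]||y z _ h1 _ h2|k y _ h|y z _ h1 _ h2].
- by rewrite theta_cg mulNr cg_anti //; apply: contraNneq Pb => ->.
- by rewrite theta1 mulr1 mul1r.
- by rewrite thetaD mulrDr mulrDl h1 h2.
- by rewrite thetaZ -(scalerAr k (cg b)) -(scalerAl k _ (cg b)) h.
by rewrite thetaM mulrA h1 -mulrA h2 mulrA.
Qed.

Lemma flip_cl P b x : (b < n)%N -> ~~ P b -> cl P x -> flip b x = x.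
Proof.
move=> hb Pb hx; rewrite /flip -mulrA -(cg_cl Pb hx).
by rewrite mulrA cg_sq // mulN1r opprK.
Qed.

Lemma cl_flip P b x : (b < n)%N -> cl P x -> cl P (flip b x).
Proof.
move=> hb; elim=> [y [a Pa ->]||y z _ h1 _ h2|k y _ h|y z _ h1 _ h2].
- rewrite flip_cg //; case: ifP => _; last exact: cl_cg.
  by rewrite -scaleN1r; apply/subalgZ/cl_cg.
- by rewrite flip1 //; apply: cl1.
- by rewrite flipD; apply: subalgD.
- by rewrite flipZ; apply: subalgZ.
by rewrite flipM //; apply: subalgM.
Qed.

Lemma xg_cl P a x : (a < n)%N -> cl P x -> xg a * x = flip a x * xg a.
Proof.
move=> ha; elim=> [y [b Pb ->]||y z _ h1 _ h2|k y _ h|y z _ h1 _ h2].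
- rewrite flip_cg //; case: eqVneq => [->|ba]; first by rewrite mulNr xg_cg_anti.
  by rewrite xg_cg.
- by rewrite flip1 // mulr1 mul1r.
- by rewrite flipD mulrDr mulrDl h1 h2.
- by rewrite flipZ -(scalerAr k (xg a)) -(scalerAl k _ (xg a)) h.
by rewrite flipM // mulrA h1 -mulrA h2 mulrA.
Qed.

(** The sums [p0 + cg b * p1] are closed under products, since [cg b] crosses [cl Q] through the
    parity automorphism. *)
Lemma cl_split P Q b x : ~~ Q b -> (b < n)%N -> {subset P <= predU1 b Q} -> cl P x ->
  exists p0 p1, [/\ cl Q p0, cl Q p1 & x = p0 + cg b * p1].
Proof.
move=> Qb hb PQ; elim=> [y [a Pa ->]||y z _ [y0 [y1 [h0 h1 ->]]] _ [z0 [z1 [k0 k1 ->]]]|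
  k y _ [y0 [y1 [h0 h1 ->]]]|y z _ [y0 [y1 [h0 h1 ->]]] _ [z0 [z1 [k0 k1 ->]]]].
- have /predU1P[->|Qa] := PQ a Pa.
    by exists 0, 1; rewrite add0r mulr1; split=> //; [apply: cl0 | apply: cl1].
  by exists (cg a), 0; rewrite mulr0 addr0; split=> //; [apply: cl_cg | apply: cl0].
- by exists 1, 0; rewrite mulr0 addr0; split=> //; [apply: cl1 | apply: cl0].
- exists (y0 + z0), (y1 + z1); split; [exact: subalgD | exact: subalgD | ].
  by rewrite mulrDr addrACA.
- exists (k *: y0), (k *: y1); split; [exact: subalgZ | exact: subalgZ | ].
  by rewrite scalerDr -(scalerAr k (cg b)).
have tc (u : S) : cl Q u -> u * cg b = cg b * theta u.
  move=> hu; have ht := theta_cl hu; rewrite (cg_cl Qb ht); congr (_ * _).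
  elim: hu => [v [a Qa ->]||v v' _ e1 _ e2|k v _ e|v v' _ e1 _ e2].
  - by rewrite theta_cg thetaN theta_cg opprK.
  - by rewrite !theta1.
  - by rewrite !thetaD -e1 -e2.
  - by rewrite !thetaZ -e.
  by rewrite !thetaM -e1 -e2.
exists (y0 * z0 - theta y1 * z1), (y1 * z0 + theta y0 * z1); split.
- by apply: clB; apply: subalgM => //; apply: theta_cl.
- by apply: subalgD; apply: subalgM => //; apply: theta_cl.
have e1 : y0 * (cg b * z1) = cg b * (theta y0 * z1) by rewrite mulrA tc // mulrA.
have e2 : cg b * y1 * (cg b * z1) = - (theta y1 * z1).
  rewrite -mulrA (mulrA y1) tc // !mulrA cg_sq // !mulN1r mulNr //.
by rewrite mulrDl !mulrDr e1 e2 !mulrA; lin C.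
Qed.

(** Writing [x = p0 + cg b * p1], the sign change at [b] gives [p0 - cg b * p1], so the second
    summand is zero. The indices of [l] are removed in this way one at a time. *)
Lemma cl_fixed P Q l x : uniq l -> all (ltn^~ n) l -> ~~ has Q l ->
  {subset P <= [predU (mem l) & Q]} ->
  cl P x -> (forall b, b \in l -> flip b x = x) -> cl Q x.
Proof.
elim: l P x => [|b l IH] P x.
  by move=> _ _ _ PQ hx _; apply: sub_cl hx => a /PQ; rewrite inE.
move=> /= /andP[bl ul] /andP[hb hl]; rewrite negb_or => /andP[Qb Ql] PQ hx fx.
pose Q' := [predU (mem l) & Q].
have Q'b : ~~ Q' b by rewrite /= negb_or bl.
have PQ' : {subset P <= predU1 b Q'}.
  by move=> a /PQ; rewrite !inE -orbA.
have [p0 [p1 [h0 h1 e]]] := cl_split Q'b hb PQ' hx.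
have := fx b (mem_head _ _); rewrite e flipD flipM // flip_cg // eqxx.
rewrite !(flip_cl hb Q'b) // => /addrI e0.
have {}e0 : cg b * p1 = 0.
  apply/eqP; have /eqP := e0; rewrite mulNr -subr_eq0 -opprD oppr_eq0 -mulr2n -scaler_nat.
  by rewrite scaler_eq0 pnatr_eq0.
have ex : x = p0 by rewrite e e0 addr0.
by rewrite -e ex; apply: (IH Q') => // b' hb'; rewrite -ex fx // inE hb' orbT.
Qed.

(** [flip b] fixes [p] and changes the sign of [cg a * cg b]; adding the two equations leaves
    [p + p = 0]. *)
Lemma cl_kill P a b p : (a < n)%N -> (b < n)%N -> a != b -> ~~ P b -> cl P p ->
  p * (1 + 'i *: (cg a * cg b)) = 0 -> p = 0.
Proof.
move=> ha hb ab Pb hp e; have := congr1 (flip b) e.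
rewrite flipM // (flip_cl hb Pb hp) flipD flipZ flipM // flip1 // !flip_cg //.
rewrite eqxx (negbTE ab) /flip theta0 mulr0 mul0r oppr0 => e'.
have : p * (1 + 'i *: (cg a * cg b)) + p * (1 + 'i *: (cg a * - cg b)) = 0.
  by rewrite e e' addr0.
rewrite -mulrDr mulrN scalerN addrACA subrr addr0 => /eqP.
by rewrite mulrDr mulr1 -mulr2n -scaler_nat scaler_eq0 pnatr_eq0 => /eqP.
Qed.

End Clifford.

(** * Diagonal idempotents *)

Section DiagonalIdempotent.
Variables (C : numClosedFieldType) (n : nat).
Local Notation S := (sergeev C n).
Implicit Types (d : nat -> nat) (m k : nat) (p y : S).

Definition Epair a b : S := 2^-1 *: (1 + 'i *: (cg a * cg b)).

Definition Eprod d m : S := \prod_(a < m) Epair (d a.*2) (d a.*2.+1).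

Lemma EprodS d m : Eprod d m.+1 = Eprod d m * Epair (d m.*2) (d m.*2.+1).
Proof. by rewrite /Eprod big_ord_recr. Qed.

Lemma Epair_intertwine y a b a' b' : y * cg a = cg a' * y -> y * cg b = cg b' * y ->
  y * Epair a b = Epair a' b' * y.
Proof.
move=> ea eb; rewrite /Epair -(scalerAr _ y) -(scalerAl _ _ y); congr (_ *: _).
rewrite mulrDr mulrDl mulr1 mul1r -(scalerAr _ y) -(scalerAl _ _ y).
by congr (_ + _ *: _); rewrite mulrA ea -mulrA eb mulrA.
Qed.

Lemma Eprod_intertwine y d d' m :
  (forall k, (k < m.*2)%N -> y * cg (d k) = cg (d' k) * y) ->
  y * Eprod d m = Eprod d' m * y.
Proof.
elim: m => [_|m IH h]; first by rewrite /Eprod !big_ord0 mulr1 mul1r.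
rewrite !EprodS mulrA IH; last by move=> k hk; apply: h; lia.
by rewrite -mulrA (@Epair_intertwine y _ _ (d' m.*2) (d' m.*2.+1)) ?mulrA //; apply: h; lia.
Qed.

Lemma cg_Epair_comm c a b : c != a -> c != b -> cg c * Epair a b = Epair a b * cg c.
Proof.
move=> ca cb; rewrite /Epair -(scalerAr _ (cg c)) -(scalerAl _ _ (cg c)).
congr (_ *: _); rewrite mulrDr mulrDl mulr1 mul1r -(scalerAr _ (cg c)) -(scalerAl _ _ (cg c)).
by congr (_ + _ *: _); apply: anti2; apply: cg_anti.
Qed.

Lemma cg_Epair a b : (a < n)%N -> (b < n)%N -> a != b ->
  cg b * Epair a b = 'i *: (cg a * Epair a b).
Proof.
move=> ha hb ab; rewrite /Epair -(scalerAr _ (cg b)) -(scalerAr _ (cg a)).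
rewrite !mulrDr !mulr1 -(scalerAr _ (cg b)) -(scalerAr _ (cg a)) !mulrA.
rewrite (@cg_anti _ _ b a) 1?eq_sym // mulNr -(mulrA (cg a)) !cg_sq // mulN1r mulrN1.
rewrite opprK !scalerDr !scalerA scalerN -scaleNr mulrCA -expr2 sqrCi mulrN1 opprK.
by rewrite addrC (mulrC 'i).
Qed.

Section Injective.
Variables (d : nat -> nat) (m : nat).
Hypotheses (dn : forall k, (k < m.*2)%N -> (d k < n)%N)
  (dI : forall k l, (k < m.*2)%N -> (l < m.*2)%N -> d k = d l -> k = l).

Let dneq k l : (k < m.*2)%N -> (l < m.*2)%N -> k != l -> d k != d l.
Proof. by move=> hk hl; apply: contra => /eqP/(dI hk hl)->. Qed.

Lemma cg_Eprod k : (k < m)%N ->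
  cg (d k.*2.+1) * Eprod d m = 'i *: (cg (d k.*2) * Eprod d m).
Proof.
move=> km; suff H m' : (m' <= m)%N -> (k < m')%N ->
    cg (d k.*2.+1) * Eprod d m' = 'i *: (cg (d k.*2) * Eprod d m') by apply: H.
elim: m' => // m' IH hm; rewrite EprodS ltnS leq_eqVlt => /orP[/eqP ek|h]; last first.
  by rewrite mulrA IH ?(ltnW hm) // -(scalerAl _ _ (Epair _ _)) mulrA.
have cE j : (j < m.*2)%N -> (m'.*2 <= j)%N -> cg (d j) * Eprod d m' = Eprod d m' * cg (d j).
  move=> hj jm; rewrite /Eprod; apply: commr_prod => i _.
  by apply: cg_Epair_comm; apply: dneq => //; have := ltn_ord i; lia.
rewrite ek !mulrA !cE; try lia.
rewrite -!mulrA cg_Epair ?(scalerAr _ (Eprod d m')) //.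
- by apply: dn; lia.
- by apply: dn; lia.
by apply: dneq; lia.
Qed.

Lemma Eprod_cl : cl (fun a => (a < n)%N) (Eprod d m).
Proof.
rewrite /Eprod; apply: big_ind; [exact: cl1 | exact: subalgM | move=> i _].
apply/subalgZ/subalgD; first exact: cl1.
by apply/subalgZ/subalgM; apply: cl_cg; apply: dn; have := ltn_ord i; lia.
Qed.

Lemma Eprod_kill P p : cl P p -> (forall k, (k < m)%N -> ~~ P (d k.*2.+1)) ->
  p * Eprod d m = 0 -> p = 0.
Proof.
move=> hp hP; suff H m' : (m' <= m)%N -> p * Eprod d m' = 0 -> p = 0 by apply: H.
elim: m' => [_|m' IH hm]; first by rewrite /Eprod big_ord0 mulr1.
rewrite EprodS mulrA => e; apply: IH; first exact: ltnW.
(* The indices occurring in [p] and in the earlier pairs. The second index of the last pair is not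
   among them, so [cl_kill] removes that pair. *)
pose Q a := P a || has (fun j => (a == d j)) (iota 0 m'.*2).
have hQ : cl Q (p * Eprod d m').
  apply: subalgM; first by apply: sub_cl hp => a Pa; apply/orP; left.
  rewrite /Eprod; apply: big_ind; [exact: cl1 | exact: subalgM | move=> i _].
  have hi := ltn_ord i; apply/subalgZ/subalgD; first exact: cl1.
  apply/subalgZ/subalgM; apply: cl_cg; apply/orP; right; apply/hasP.
    by exists i.*2; rewrite ?mem_iota //; lia.
  by exists i.*2.+1; rewrite ?mem_iota //; lia.
apply: (cl_kill (a := d m'.*2) (b := d m'.*2.+1)) hQ _.
- by apply: dn; lia.
- by apply: dn; lia.
- by apply: dneq; lia.
- rewrite /Q negb_or hP //; apply/hasPn => j; rewrite mem_iota /= add0n => hj.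
  by apply: dneq; lia.
move: e; rewrite /Epair -(scalerAr _ (p * _)) => /eqP.
by rewrite scaler_eq0 invr_eq0 pnatr_eq0 => /eqP.
Qed.
End Injective.

Lemma homog_Eprod d m : homog false (Eprod d m).
Proof.
apply: homog_even_prod => i _; apply/homogZ/homogD; first exact: homog_1.
by apply/homogZ/(@homogM _ _ true true); apply: homog_c.
Qed.

End DiagonalIdempotent.

(** * Diagonal entries of a standard tableau *)

Section DiagonalEntries.
Variables (la : seq nat) (T : tableau).
Hypotheses (hla : strict_partition la) (hT : T \in std_tableaux la).
Local Notation n := (sumn la).

Definition dindex (T : tableau) k := index (k, k) T.

Lemma diag_mem k : (k < size la)%N -> (k, k) \in T.
Proof.
move=> hk; rewrite (std_mem hT) mem_diagram hk leqnn -{1}(addn0 k) ltn_add2l /=.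
by move: hla => /andP[_ /all_nthP]; apply.
Qed.

Lemma dindex_lt k : (k < size la)%N -> (dindex T k < n)%N.
Proof. by move=> hk; rewrite -(std_size hT) index_mem diag_mem. Qed.

Lemma dindex_inj k l : (k < size la)%N -> (l < size la)%N ->
  dindex T k = dindex T l -> k = l.
Proof.
move=> hk hl; have mk := diag_mem hk; have ml := diag_mem hl.
by move/(congr1 (nth (0, 0)%N T)); rewrite !nth_index // => -[].
Qed.

(** The box [(k, k.+1)] lies to the right of the first diagonal box and above the second. *)
Lemma dindex_mono k : (k.+1 < size la)%N -> (dindex T k < dindex T k.+1)%N.
Proof.
move=> hk; have hm : (k, k.+1) \in T.
  rewrite (std_mem hT) mem_diagram (ltnW hk) leqnSn /=.
  have := la_decr hla hk; have : (0 < nth 0 la k.+1)%N.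
    by move: hla => /andP[_ /all_nthP]; apply.
  by lia.
apply: (@ltn_trans (index (k, k.+1) T)); apply: (std_lt hT) => //.
- by apply: diag_mem; apply: ltnW.
- by rewrite /box_lt /= eqxx ltnSn.
- exact: diag_mem.
by rewrite /box_lt /= eqxx ltnSn orbT.
Qed.

Lemma diag_entriesE : diag_entries T = [seq dindex T k | k <- iota 0 (size la)].
Proof.
apply: (irr_sorted_eq ltn_trans ltnn).
- by apply: sorted_filter; [exact: ltn_trans | exact: iota_ltn_sorted].
- apply/(sortedP 0%N) => i; rewrite size_map size_iota => hi.
  by rewrite !(nth_map 0%N) ?size_iota ?nth_iota // ?(ltnW hi) // !add0n dindex_mono.
move=> a; rewrite mem_filter mem_iota add0n /=; apply/andP/mapP => [[da ha]|[k]].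
  have := mem_nth (0, 0)%N ha; rewrite -/(box_of T a).
  move: da; case e : (box_of T a) => [i j]; rewrite /is_diag /= => /eqP ij.
  rewrite (std_mem hT) mem_diagram -ij => /and3P[hi _ _].
  exists i; first by rewrite mem_iota.
  by rewrite /dindex -[X in (_, X)]/(i) {2}ij -e (index_box_of hT) // -(std_size hT).
rewrite mem_iota add0n /= => hk ->; split; last by rewrite index_mem diag_mem.
by rewrite /box_of nth_index ?diag_mem // /is_diag eqxx.
Qed.

Lemma size_diag_entries : size (diag_entries T) = size la.
Proof. by rewrite diag_entriesE size_map size_iota. Qed.

Lemma nth_diag_entries k : (k < size la)%N -> nth 0%N (diag_entries T) k = dindex T k.
Proof. by move=> hk; rewrite diag_entriesE (nth_map 0%N) ?size_iota // nth_iota. Qed.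

Lemma EdiagE (C : numClosedFieldType) : Ediag C n T = Eprod C n (dindex T) (size la)./2.
Proof.
rewrite /Ediag size_diag_entries; apply: eq_bigr => i _.
by have := ltn_ord i => hi; rewrite !nth_diag_entries //; lia.
Qed.

(* The indices of the generators of [clifford_tab T]. *)
Definition free_index (T : tableau) a :=
  (a < n)%N && (a \notin [seq dindex T k.*2.+1 | k <- iota 0 (size la)./2]).

Lemma free_index_odd k : (k < (size la)./2)%N -> ~~ free_index T (dindex T k.*2.+1).
Proof.
move=> hk; rewrite /free_index negb_and negbK; apply/orP; right.
by apply/mapP; exists k; rewrite ?mem_iota.
Qed.

Lemma free_index_even k : (k.*2 < size la)%N -> free_index T (dindex T k.*2).
Proof.
move=> hk; rewrite /free_index dindex_lt //=; apply/mapP => -[l].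
by rewrite mem_iota add0n /= => hl /dindex_inj h; have := h hk; lia.
Qed.

(** Together the two kinds of generators miss exactly the second member of each pair, which stands
    at an odd place in 0-based numbering. *)
Lemma clifford_tabE (C : numClosedFieldType) x :
  clifford_tab T x <-> cl (C := C) (n := n) (free_index T) x.
Proof.
split; elim=> [y|||k y _|] //; try by [exact: cl1 | move=> *; exact: subalgD |
   move=> *; exact: subalgZ | move=> *; exact: subalgM | exact: subalg_1].
  case=> [[a]|[a []]]; rewrite size_diag_entries.
    move=> ha ->; rewrite nth_diag_entries; last by lia.
    by apply: cl_cg; apply: free_index_even; lia.
  move=> ha na ->; apply: cl_cg; rewrite /free_index ha /=; apply: contra na.
  case/mapP=> k; rewrite mem_iota add0n /= => hk ->.
  rewrite -nth_diag_entries; last by lia.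
  have hs : (k.*2.+1 < size (take (size la)./2.*2 (diag_entries T)))%N.
    by rewrite size_takel ?size_diag_entries; lia.
  by rewrite -(nth_take 0%N (_ : k.*2.+1 < (size la)./2.*2)%N) ?mem_nth //; lia.
case=> a /andP[ha na] ->; apply: subalg_gen; rewrite size_diag_entries.
case: (boolP (a \in take (size la)./2.*2 (diag_entries T))) => h; last by right; exists a.
left; case/(nthP 0%N): h => i; rewrite size_takel ?size_diag_entries; last by lia.
move=> hi; rewrite nth_take // nth_diag_entries; last by lia.
move=> ea; exists i./2; first by lia.
have ei : i = i./2.*2.
  move: na; rewrite -ea; case: (boolP (odd i)) => oi; last first.
    by rewrite -[LHS]odd_double_half (negbTE oi).
  move/negP; case; apply/mapP; exists i./2; first by rewrite mem_iota; lia.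
  by congr dindex; rewrite -[LHS]odd_double_half oi.
by rewrite -ei nth_diag_entries ?ea //; lia.
Qed.

End DiagonalEntries.

(** * The vectors of the standard tableaux *)

Section SwapContents.
Variables (la : seq nat) (T : tableau) (a : nat).
Hypotheses (hla : strict_partition la) (hT : T \in std_tableaux la).
Local Notation n := (sumn la).
Hypothesis ha : (a.+1 < n)%N.
Local Notation w := (row_word T).
Local Notation sT := (tab_act (adj n a) T).

Lemma tab_act_adjK : tab_act (adj n a) sT = T.
Proof.
apply: (@eq_from_nth _ (0, 0)%N); first by rewrite size_tab_act (std_size hT).
move=> k; rewrite size_tab_act => hk.
have hk' : (swap_idx a k < n)%N by apply: swap_idx_lt.
by rewrite -!/(box_of _ _) box_of_tab_act // box_of_tab_act // swap_idxK.
Qed.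

Lemma wcont_split : wcont w a = rowlen (take a w) (nth 0%N w a) /\
  wcont w a.+1 = rowlen (rcons (take a w) (nth 0%N w a)) (nth 0%N w a.+1).
Proof.
have h : (a < size w)%N by rewrite (size_row_word hT) ltnW.
by split=> //; rewrite /wcont -take_nth.
Qed.

Lemma swap_gap : sT \in std_tableaux la ->
  nth 0%N w a.+1 != nth 0%N w a /\
  ((wcont w a).+2 <= wcont w a.+1)%N || ((wcont w a.+1).+2 <= wcont w a)%N.
Proof.
move=> hs; have := hs; rewrite (std_swap hla hT ha) => nlt.
have ha' : (a < n)%N by apply: ltnW.
have rne : nth 0%N w a.+1 != nth 0%N w a.
  have tri (b b' : box) : b.1 = b'.1 -> b != b' -> box_lt b b' || box_lt b' b.
    by move: b b' => [x y] [x' y'] /= <-; rewrite /box_lt -pair_eqE /pair_eq /= eqxx /=; lia.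
  rewrite !(nth_row_word hT) //; apply: contra nlt => /eqP e.
  have ne : box_of T a != box_of T a.+1.
    apply/eqP => /(congr1 (index^~ T)); rewrite !(index_box_of hT) //; lia.
  have /orP[//|lt] := tri _ _ (esym e) ne.
  have := std_lt hT (box_of_mem hT ha) (box_of_mem hT ha') lt.
  by rewrite !(index_box_of hT) // ltnNge leqnSn.
split=> //; have [-> ->] := wcont_split.
have := std_lattice hla hT; rewrite {1}(row_word_split hT ha) lattice_cat /= => /and3P[l0 a1 _].
have := std_lattice hla hs; rewrite (row_word_swap hla hT ha) lattice_cat /= => /and3P[_ a2 _].
rewrite rowlen_rcons eq_sym (negbTE rne) addn0.
by have := addable_gap2 l0 rne a2 a1; lia.
Qed.

Lemma wcont_neq : wcont w a != wcont w a.+1.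
Proof.
case: (boolP (sT \in std_tableaux la)) => [/swap_gap[_]|]; first by lia.
by rewrite (std_swap hla hT ha) negbK => /(box_lt_content hla hT ha); lia.
Qed.

Lemma dindex_tab_act k : (k < size la)%N -> dindex sT k = swap_idx a (dindex T k).
Proof. by move=> hk; rewrite /dindex (index_tab_act hT) ?(diag_mem hla hT). Qed.

End SwapContents.

Lemma phi_cg_swap (C : numClosedFieldType) n a k : (a.+1 < n)%N ->
  phi a * cg k = cg (swap_idx a k) * phi a :> sergeev C n.
Proof.
move=> ha; rewrite /swap_idx; case: (eqVneq k a) => [->|ka]; first exact: phi_cg.
by case: (eqVneq k a.+1) => [->|ka1]; [apply: phi_cgS | apply: phi_cg_far].
Qed.

(** The intertwiner permutes the Clifford generators as the transposition permutes the entries, and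
    the [k]-th diagonal box is the same in both tableaux. *)
Lemma phi_Ediag (C : numClosedFieldType) la T a : strict_partition la ->
  T \in std_tableaux la -> tab_act (adj (sumn la) a) T \in std_tableaux la ->
  (a.+1 < sumn la)%N ->
  phi a * Ediag C (sumn la) T =
  Ediag C (sumn la) (tab_act (adj (sumn la) a) T) * phi a.
Proof.
move=> hla hT hs ha; rewrite (EdiagE hla hT) (EdiagE hla hs).
apply: Eprod_intertwine => k hk; rewrite phi_cg_swap // (dindex_tab_act hla hT) //.
by lia.
Qed.

Section Paths.
Variables (C : numClosedFieldType) (la : seq nat).
Hypothesis hla : strict_partition la.
Local Notation n := (sumn la).
Local Notation S := (sergeev C n).
Local Notation R := (row_tableau la).
Local Notation std := (std_tableaux la).

Let hR : R \in std := row_tableau_std la.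

Definition row_vector : S := e_row C n la * Ediag C n R.

Lemma weight_mulr w (z y : S) : weight w z -> weight w (z * y).
Proof. by move=> wz k hk; rewrite mulrA wz // -(scalerAl _ _ y). Qed.

Lemma weight_row_vector : weight (row_word R) row_vector.
Proof. by apply: weight_mulr; apply: weight_e_elt. Qed.

Definition tab_path T (z : S) := desc_path (row_word R) row_vector (row_word T) z.

Let sR := row_tableau_sorted la.
Let lR := std_lattice hla hR.
Let nR : size (row_word R) = n := size_row_word hR.

Lemma tab_path_unique T z z' : tab_path T z -> tab_path T z' -> z = z'.
Proof. exact: (desc_path_unique sR lR nR weight_row_vector). Qed.

Lemma tab_path_exists T : T \in std -> exists z, tab_path T z.
Proof.
move=> hT; apply: desc_path_exists => //; first exact: perm_row_word.
exact: std_lattice hT.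
Qed.

Lemma tab_path_weight T z k : T \in std -> tab_path T z -> (k < n)%N ->
  xg k * z = kappa C T k *: z.
Proof.
move=> hT dz hk; rewrite (kappaE C hT hk).
apply: (desc_path_weight sR lR nR weight_row_vector dz).
by rewrite (size_row_word hT).
Qed.

(** Turns steps between words into swaps between tableaux: at a descent the entry [a.+1] sits in a
    higher row than [a], so the swapped tableau is standard. *)
Lemma tab_path_ind (P : tableau -> S -> Prop) :
  P R row_vector ->
  (forall a T z, (a.+1 < n)%N -> T \in std -> tab_act (adj n a) T \in std ->
     tab_path T z -> P T z -> P (tab_act (adj n a) T) (phi a * z)) ->
  forall T z, T \in std -> tab_path T z -> P T z.
Proof.
move=> P0 PS T z hT dz; move: dz hT; rewrite /tab_path.
move eT : (row_word T) => w dz; elim: dz T eT => [T eT hT|w0 j h w1 z' hj lw dz IH T eT hT].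
  by rewrite (row_word_inj hla hT hR eT).
have sw := size_row_word hT; set a := size w0.
have ha : (a.+1 < n)%N by rewrite -sw eT size_cat /=; lia.
have nth0 : nth 0%N (row_word T) a = j by rewrite eT nth_cat ltnn subnn.
have nth1 : nth 0%N (row_word T) a.+1 = h by rewrite eT nth_cat ltnNge leqnSn subSnn.
have hs : tab_act (adj n a) T \in std.
  rewrite (std_swap hla hT ha) /box_lt -!(nth_row_word hT) ?(ltnW ha) // nth0 nth1.
  by rewrite (gtn_eqF hj) andFb orFb (ltnNge j h) (ltnW hj) andbF.
have ws : row_word (tab_act (adj n a) T) = w0 ++ [:: h, j & w1].
  rewrite (row_word_swap hla hT ha) nth0 nth1 eT take_size_cat //; congr (_ ++ _).
  congr [:: _, _ & _]; rewrite -[[:: j, h & w1]]/([:: j; h] ++ w1) catA.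
  by rewrite drop_size_cat // size_cat addn2.
rewrite -(tab_act_adjK hT ha); apply: PS => //; rewrite ?tab_act_adjK //.
  by rewrite /tab_path ws.
exact: IH.
Qed.

Lemma tab_path_phi T a z z' : T \in std -> (a.+1 < n)%N ->
  tab_act (adj n a) T \in std -> tab_path T z -> tab_path (tab_act (adj n a) T) z' ->
  exists2 k : C, k != 0 & phi a * z = k *: z'.
Proof.
move=> hT ha hs; have [rne _] := swap_gap hla hT ha hs.
have sw : size (take a (row_word T)) = a.
  by rewrite size_takel // (size_row_word hT); apply/ltnW/ltnW.
rewrite /tab_path (row_word_swap hla hT ha) {1}(row_word_split hT ha) => dz dz'.
have := desc_path_phi sR lR nR weight_row_vector rne dz dz'.
by rewrite sw.
Qed.

Lemma tab_path_phi0 T a z : T \in std -> (a.+1 < n)%N ->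
  tab_act (adj n a) T \notin std -> tab_path T z -> phi a * z = 0.
Proof.
move=> hT ha; rewrite (std_swap hla hT ha) negbK => lt.
have sw : size (take a (row_word T)) = a.
  by rewrite size_takel // (size_row_word hT); apply/ltnW/ltnW.
rewrite /tab_path {1}(row_word_split hT ha) => dz.
have := desc_path_phi0 sR lR nR weight_row_vector dz; rewrite sw; apply.
have [e1 e2] := wcont_split hT ha; rewrite -e1 -e2.
exact: (box_lt_content hla hT ha lt).
Qed.

Lemma cg_e_row k : (k < size la)%N ->
  cg (dindex R k) * e_row C n la = e_row C n la * cg (dindex R k).
Proof.
move=> hk; apply: (e_elt_cg _ hla hR); first exact: (dindex_lt hla hR).
by rewrite /box_of nth_index ?(diag_mem hla hR) // /is_diag eqxx.
Qed.

(** For the row tableau the relation is that of the idempotent, as diagonal generators commute with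
    [e_row]; intertwiners then carry it along with the diagonal entries. *)
Lemma cg_tab_path T z k : T \in std -> tab_path T z -> (k < (size la)./2)%N ->
  cg (dindex T k.*2.+1) * z = 'i *: (cg (dindex T k.*2) * z).
Proof.
move=> hT dz hk; move: T z hT dz.
have h1 : (k.*2.+1 < size la)%N by lia.
apply: (tab_path_ind (P := fun T z => cg (dindex T k.*2.+1) * z = 'i *: (cg (dindex T k.*2) * z))).
  rewrite /row_vector (EdiagE hla hR) !mulrA !cg_e_row //; last exact: ltnW.
  rewrite -!mulrA cg_Eprod ?(scalerAr _ (e_row _ _ _)) //.
    by move=> l hl; apply: (dindex_lt hla hR); lia.
  by move=> l l' hl hl'; apply: (dindex_inj hla hR); lia.
move=> a T z ha hT hs _ IH; rewrite !(dindex_tab_act hla hT) ?(ltnW h1) //.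
by rewrite !mulrA -!phi_cg_swap // -!mulrA IH -(scalerAr _ (phi a)).
Qed.

End Paths.

(** * The vectors of the tableaux span the left ideal *)

Section Span.
Variables (C : numClosedFieldType) (la : seq nat).
Hypothesis hla : strict_partition la.
Local Notation n := (sumn la).
Local Notation S := (sergeev C n).
Local Notation R := (row_tableau la).
Local Notation std := (std_tableaux la).
Local Notation "'sq_gap' T a" :=
  (kappa C T a * kappa C T a - kappa C T a.+1 * kappa C T a.+1)
  (at level 10, T at level 8, a at level 8).

Lemma std_tableaux_uniq : uniq std.
Proof. by rewrite filter_uniq // permutations_uniq. Qed.

Definition tab_vector T : S := xget 0 [set z : S | tab_path T z]%classic.

Lemma tab_vectorP T : T \in std -> tab_path T (tab_vector T).
Proof. by move=> hT; have [z hz] := tab_path_exists C hla hT; apply: xgetPex; exists z. Qed.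

Lemma tab_vector_row : tab_vector R = row_vector C la.
Proof.
apply: (tab_path_unique hla (tab_vectorP (row_tableau_std la))).
exact: desc_path_refl.
Qed.

Lemma xg_tab_vector T a : T \in std -> (a < n)%N ->
  xg a * tab_vector T = kappa C T a *: tab_vector T.
Proof. by move=> hT; apply: tab_path_weight => //; apply: tab_vectorP. Qed.

Lemma cg_tab_vector T k : T \in std -> (k < (size la)./2)%N ->
  cg (dindex T k.*2.+1) * tab_vector T = 'i *: (cg (dindex T k.*2) * tab_vector T).
Proof. by move=> hT; apply: cg_tab_path => //; apply: tab_vectorP. Qed.

Lemma kappa_sq_neq T a : T \in std -> (a.+1 < n)%N ->
  sq_gap T a != 0.
Proof.
move=> hT ha; rewrite subr_eq0 !(kappaE C hT) ?(ltnW ha) //.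
by apply: contraNneq (wcont_neq hla hT ha) => /kq_sq_inj->.
Qed.

Lemma phi_tab_vector T a : T \in std -> (a.+1 < n)%N ->
  phi a * tab_vector T =
  (sq_gap T a *: sg a
    + (kappa C T a + kappa C T a.+1)%:A
    - (kappa C T a - kappa C T a.+1) *: (cg a * cg a.+1)) * tab_vector T.
Proof.
by move=> hT ha; apply: phi_weight; apply: xg_tab_vector => //; apply: ltnW.
Qed.

Lemma sg_tab_vector T a (y : S) : T \in std -> (a.+1 < n)%N ->
  phi a * tab_vector T =
    sq_gap T a *: y ->
  sg a * tab_vector T = s_coef C n T a * tab_vector T + y.
Proof.
move=> hT ha; have D0 := kappa_sq_neq hT ha; rewrite phi_tab_vector //.
rewrite /s_coef; move: (kappa C T a) (kappa C T a.+1) D0 => u w D0.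
rewrite mulrBl !mulrDl !mulr_algl -(scalerAl _ (sg a)) -!(scalerAl _ (cg a * cg a.+1)).
move: (sg a * _) (cg a * cg a.+1 * _) => st ct e; apply: (scalerI D0).
have /norP[n1 n2] : ~~ ((w - u == 0) || (w + u == 0)).
  by rewrite -mulf_eq0 (_ : _ * _ = - (u * u - w * w)) ?oppr_eq0 //; ring.
rewrite scalerDr -e; lin_coefs C; field; by rewrite n1 n2.
Qed.

Lemma phi_tab_vector_ex T a : T \in std -> (a.+1 < n)%N -> exists k : C,
  phi a * tab_vector T = k *: tab_vector (tab_act (adj n a) T) /\
  (tab_act (adj n a) T \in std -> k != 0) /\
  (tab_act (adj n a) T \notin std -> k = 0).
Proof.
move=> hT ha; case: (boolP (tab_act (adj n a) T \in std)) => hs.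
  have [k k0 e] := tab_path_phi hla hT ha hs (tab_vectorP hT) (tab_vectorP hs).
  by exists k.
exists 0; rewrite scale0r; split=> //.
exact: tab_path_phi0 hs (tab_vectorP hT).
Qed.

Definition spanned (u : S) : Prop := exists2 f : tableau -> S,
  forall T, cl (free_index la T) (f T) & u = \sum_(T <- std) f T * tab_vector T.

Lemma spanned0 : spanned 0.
Proof. by exists (fun=> 0) => [T|]; [apply: cl0 | rewrite big1 // => T _; rewrite mul0r]. Qed.

Lemma spannedD u u' : spanned u -> spanned u' -> spanned (u + u').
Proof.
move=> [f hf ->] [g hg ->]; exists (fun T => f T + g T) => [T|].
  by apply: subalgD; [apply: hf | apply: hg].
by rewrite -big_split; apply: eq_bigr => T _; rewrite mulrDl.
Qed.

Lemma spannedZ k u : spanned u -> spanned (k *: u).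
Proof.
move=> [f hf ->]; exists (fun T => k *: f T) => [T|]; first by apply/subalgZ/hf.
by rewrite scaler_sumr; apply: eq_bigr => T _; rewrite (scalerAl _ (f T)).
Qed.

Lemma spanned_free T q : T \in std -> cl (free_index la T) q -> spanned (q * tab_vector T).
Proof.
move=> hT hq; exists (fun T' => if T' == T then q else 0) => [T'|].
  by case: eqVneq => [->|_] //; apply: cl0.
rewrite (bigD1_seq T) ?std_tableaux_uniq //= eqxx big1 ?addr0 // => T' /negbTE->.
by rewrite mul0r.
Qed.

(** A generator outside the subalgebra is the second of a pair: it crosses [p] by parity and becomes
    ['i] times the first one on the vector. *)
Lemma free_reduce T q p : T \in std -> cl (fun a => (a < n)%N) q ->
  cl (free_index la T) p -> exists2 p', cl (free_index la T) p' &
    q * (p * tab_vector T) = p' * tab_vector T.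
Proof.
move=> hT hq; elim: hq p => [y [a ha ->]||y z _ h1 _ h2|k y _ h|y z _ h1 _ h2] p hp.
- case: (boolP (free_index la T a)) => fa.
    by exists (cg a * p); [apply: subalgM => //; apply: cl_cg | rewrite mulrA].
  move: (fa); rewrite /free_index ha /= negbK => /mapP[k].
  rewrite mem_iota add0n /= => hk ea.
  exists ('i *: (theta p * cg (dindex T k.*2))).
    apply/subalgZ/subalgM; first exact: theta_cl.
    by apply: cl_cg; apply: (free_index_even hla hT); lia.
  rewrite mulrA (cg_cl fa hp) -mulrA ea cg_tab_vector // -(scalerAr _ (theta p)).
  by rewrite -(scalerAl _ (theta p * _)) mulrA.
- by exists p; rewrite ?mul1r.
- have [p1 hp1 e1] := h1 p hp; have [p2 hp2 e2] := h2 p hp.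
  by exists (p1 + p2); [apply: subalgD | rewrite !mulrDl e1 e2].
- have [p1 hp1 e1] := h p hp.
  by exists (k *: p1); [apply: subalgZ | rewrite -(scalerAl k y) e1 scalerAl].
have [p2 hp2 e2] := h2 p hp; have [p1 hp1 e1] := h1 p2 hp2.
by exists p1; rewrite // -mulrA e2.
Qed.

Lemma spanned_cl T q : T \in std -> cl (fun a => (a < n)%N) q ->
  spanned (q * tab_vector T).
Proof.
move=> hT hq; have [p hp] := free_reduce hT hq (cl1 _ _ _).
by rewrite mul1r => ->; apply: spanned_free.
Qed.

Lemma sg_cl a q : (a.+1 < n)%N -> cl (fun a => (a < n)%N) q ->
  exists2 q' : S, cl (fun a => (a < n)%N) q' & sg a * q = q' * sg a.
Proof.
move=> ha; elim=> [y [b hb ->]||y z _ [y' h1 e1] _ [z' h2 e2]|k y _ [y' h e]|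
  y z _ [y' h1 e1] _ [z' h2 e2]].
- exists (cg (swap_idx a b)); first by apply: cl_cg; apply: swap_idx_lt.
  rewrite /swap_idx; case: (eqVneq b a) => [->|ba]; first exact: sg_cg.
  by case: (eqVneq b a.+1) => [->|ba1]; [apply: sg_cgS | apply: sg_cg_far].
- by exists 1; [apply: cl1 | rewrite mulr1 mul1r].
- by exists (y' + z'); [apply: subalgD | rewrite mulrDr mulrDl e1 e2].
- by exists (k *: y'); [apply: subalgZ | rewrite -(scalerAr k (sg a)) e scalerAl].
by exists (y' * z'); [apply: subalgM | rewrite mulrA e1 -mulrA e2 mulrA].
Qed.

Lemma spanned_sum (I : Type) (r : seq I) (P : pred I) (F : I -> S) :
  (forall i, P i -> spanned (F i)) -> spanned (\sum_(i <- r | P i) F i).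
Proof. by move=> h; apply: big_ind; [exact: spanned0 | exact: spannedD | exact: h]. Qed.

Lemma free_cl T q : cl (free_index la T) q -> cl (fun a => (a < n)%N) (q : S).
Proof. by apply: sub_cl => a /andP[]. Qed.

Lemma spanned_cg a u : spanned u -> spanned (cg a * u).
Proof.
move=> [f hf ->]; rewrite mulr_sumr big_seq; apply: spanned_sum => T hT.
case: (ltnP a n) => [ha|/cg_out->]; last by rewrite mul0r; apply: spanned0.
rewrite mulrA; apply: spanned_cl => //; apply: subalgM; first exact: cl_cg.
exact: free_cl (hf T).
Qed.

Lemma s_coef_cl T a : (a.+1 < n)%N -> cl (fun a => (a < n)%N) (s_coef C n T a).
Proof.
move=> ha; apply: subalgD; first exact: clA.
by apply/subalgZ/subalgM; apply: cl_cg => //; apply: ltnW.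
Qed.

Lemma spanned_sg a u : (a.+1 < n)%N -> spanned u -> spanned (sg a * u).
Proof.
move=> ha [f hf ->]; rewrite mulr_sumr big_seq; apply: spanned_sum => T hT.
have [q hq e] := sg_cl ha (free_cl (hf T)); rewrite mulrA e -mulrA.
have [k [ek [_ k0]]] := phi_tab_vector_ex hT ha.
have D0 := kappa_sq_neq hT ha; set D := _ - _ in D0.
rewrite (@sg_tab_vector T a ((D^-1 * k) *: tab_vector (tab_act (adj n a) T))) //; last first.
  by rewrite ek scalerA mulrA mulfV // mul1r.
rewrite mulrDr; apply: spannedD.
  by rewrite mulrA; apply: spanned_cl => //; apply: subalgM => //; apply: s_coef_cl.
case: (boolP (tab_act (adj n a) T \in std)) => hs; last first.
  by rewrite (k0 hs) mulr0 scale0r mulr0; apply: spanned0.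
by rewrite -(scalerAr _ q); apply/spannedZ/spanned_cl.
Qed.

(** The square of [cg a.+1 - cg a] is -2, so [tg a] is recovered from [sg a]; stability under [sg]
    and [cg] thus suffices. *)
Lemma tgE_sg a : (a.+1 < n)%N ->
  tg a = (- (sqrtC 2 / 2)) *: (sg a * (cg a.+1 - cg a)) :> S.
Proof.
move=> ha; rewrite /sg -(scalerAl _ (tg a * _)) -mulrA cgSubCg_sq // mulr_algr !scalerA.
have s2 := sqrt2_neq0 C; rewrite (_ : _ * _ * _ = 1) ?scale1r //.
by field; rewrite s2.
Qed.

Lemma spanned_tg a u : spanned u -> spanned (tg a * u).
Proof.
move=> hu; case: (ltnP a n.-1) => ha; last by rewrite tg_out // mul0r; apply: spanned0.
have ha' : (a.+1 < n)%N by rewrite -ltn_predRL.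
rewrite tgE_sg // -(scalerAl _ (sg a * _)) -mulrA mulrBl -scaleN1r.
by apply/spannedZ/spanned_sg => //; apply: spannedD; [|apply: spannedZ]; apply: spanned_cg.
Qed.

Lemma spanned_mull y u : spanned u -> spanned (y * u).
Proof.
elim/sergeev_ind: y u => [||x y hx hy|k x hx|x y hx hy|a|a] u hu.
- by rewrite mul0r; apply: spanned0.
- by rewrite mul1r.
- by rewrite mulrDl; apply: spannedD; [apply: hx | apply: hy].
- by rewrite -scalerAl; apply/spannedZ/hx.
- by rewrite -mulrA; apply/hx/hy.
- exact: spanned_tg.
exact: spanned_cg.
Qed.

Lemma tab_vector_J T : T \in std -> Jideal la (tab_vector T).
Proof.
move=> hT; apply: (tab_path_ind (P := fun T (z : S) => Jideal la z) hla _ _ hT (tab_vectorP hT)).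
  by exists 1; rewrite mul1r.
by move=> a T' z _ _ _ _ [y ->]; exists (phi a * y); rewrite mulrA.
Qed.

Lemma JidealD (u u' : S) : Jideal la u -> Jideal la u' -> Jideal la (u + u').
Proof. by move=> [y ->] [y' ->]; exists (y + y'); rewrite mulrDl. Qed.

Lemma JidealM (y u : S) : Jideal la u -> Jideal la (y * u).
Proof. by move=> [z ->]; exists (y * z); rewrite mulrA. Qed.

Lemma JidealP (u : S) : Jideal la u <-> spanned u.
Proof.
split=> [[y ->]|[f hf ->]].
  rewrite -/(row_vector C la) -tab_vector_row; apply: spanned_mull.
  by rewrite -[tab_vector R]mul1r; apply: spanned_free (cl1 _ _ _); apply: row_tableau_std.
rewrite big_seq; apply: big_ind; first by exists 0; rewrite mul0r.
  exact: JidealD.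
by move=> T hT; apply/JidealM/tab_vector_J.
Qed.

End Span.

(** * Comparison with the module U *)

Section ModuleSide.
Variables (C : numClosedFieldType) (la : seq nat).
Hypothesis hla : strict_partition la.
Local Notation n := (sumn la).
Local Notation S := (sergeev C n).
Local Notation R := (row_tableau la).
Local Notation std := (std_tableaux la).
Local Notation "'sq_gap' T a" :=
  (kappa C T a * kappa C T a - kappa C T a.+1 * kappa C T a.+1)
  (at level 10, T at level 8, a at level 8).
Variables (U : lmodType S) (v : tableau -> U).
Hypothesis hU : is_Uhat la v.
Local Notation E T := (Ediag C n T).

Let hR : R \in std := row_tableau_std la.

Lemma phi_weight_mod a (u w : C) (z : U) :
  xg a *: z = u%:A *: z -> xg a.+1 *: z = w%:A *: z ->
  phi a *: z = ((u * u - w * w) *: sg a + (u + w)%:A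
     - (u - w) *: (cg a * cg a.+1)) *: z.
Proof.
move=> zu zw.
have sq (x : S) (k : C) : x *: z = k%:A *: z -> (x * x) *: z = (k * k)%:A *: z.
  by move=> e; rewrite -scalerA e scalerA mulr_algr -(mulr_algl k x) -(scalerA k%:A x) e scalerA algM.
have e1 : (xg a * xg a - xg a.+1 * xg a.+1) *: z = (u * u - w * w)%:A *: z.
  by rewrite scalerBl (sq _ _ zu) (sq _ _ zw) -!scalerBl.
have e2 : (xg a - xg a.+1) *: z = (u - w)%:A *: z by rewrite scalerBl zu zw -!scalerBl.
have gen (A x y B P Q M : S) : A *: z = P *: z -> x *: z + y *: z = Q *: z ->
    B *: z = M *: z -> (A + x + y - B) *: z = (P + Q - M) *: z.
  by move=> hP hQ hM; rewrite !scalerBl !scalerDl hP hM -hQ addrA.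
rewrite phiE /intertwiner; apply: gen.
- by rewrite -scalerA e1 scalerA mulr_algr.
- by rewrite zu zw -!scalerDl.
by rewrite -scalerA e2 scalerA mulr_algr.
Qed.

Lemma Uhat_indep (f : tableau -> S) :
  (forall T, T \in std -> cl (fun a => (a < n)%N) (f T)) ->
  \sum_(T <- std) f T *: v T = 0 -> forall T, T \in std -> f T = 0.
Proof. by case: hU => -[_ h] _ _ _; apply: h. Qed.

Let ind (T : tableau) (p : S) (T' : tableau) : S := if T' == T then p else 0.

Let ind_cl T p T' : cl (fun a => (a < n)%N) p -> cl (fun a => (a < n)%N) (ind T p T').
Proof. by rewrite /ind; case: eqP => // _ _; apply: cl0. Qed.

Let sum_ind T p : T \in std -> \sum_(T' <- std) ind T p T' *: v T' = p *: v T.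
Proof.
move=> hT; rewrite (bigD1_seq T) ?std_tableaux_uniq //= {1}/ind eqxx big1 ?addr0 //.
by move=> T' /negbTE h; rewrite /ind h scale0r.
Qed.

Lemma Uhat_indep1 T p : T \in std -> cl (fun a => (a < n)%N) p ->
  p *: v T = 0 -> p = 0.
Proof.
move=> hT hp e; have : ind T p T = 0; last by rewrite /ind eqxx.
apply: (@Uhat_indep (ind T p)) => // [T' _|]; first exact: ind_cl.
by rewrite sum_ind.
Qed.

Lemma alg_eq0 (k : C) : (k%:A == 0 :> S) = (k == 0).
Proof. by rewrite scaler_eq0 oner_eq0 orbF. Qed.

Lemma Uhat_inj T (b k : C) T' : T \in std -> T' \in std -> b != 0 ->
  b%:A *: v T = k%:A *: v T' -> T = T' /\ b = k.
Proof.
move=> hT hT' b0 e; pose f T1 := ind T b%:A T1 - ind T' k%:A T1.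
have fT : f T = 0.
  apply: (@Uhat_indep f) => // [T1 _|]; first by apply: clB; apply/ind_cl/clA.
  rewrite -[RHS](subrr (k%:A *: v T')) -{1}e -!sum_ind // -sumrB.
  by apply: eq_bigr => T1 _; rewrite scalerBl.
move: fT; rewrite /f /ind eqxx; case: (eqVneq T T') => [->|_] /eqP.
  by rewrite -scalerBl alg_eq0 subr_eq0 => /eqP.
by rewrite subr0 alg_eq0 (negbTE b0).
Qed.

(** $(u^2-w^2)^2A(u,w)$ is the negative of [phi_scalar], and contents at distance at least 2, as
    they are when the swap is standard, make it nonzero. *)
Lemma Yfun_neq0 T a : T \in std -> (a.+1 < n)%N -> tab_act (adj n a) T \in std ->
  Yfun C T a != 0.
Proof.
move=> hT ha hs; rewrite /Yfun sqrtC_eq0 /Afun.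
have D0 := kappa_sq_neq C hla hT ha; have [_ gap] := swap_gap hla hT ha hs.
have P0 : phi_scalar (wcont (row_word T) a) (kq (wcont (row_word T) a.+1) * kq (wcont (row_word T) a.+1)) != 0 :> C.
  by apply: phi_scalar_neq0; lia.
apply: contraNneq P0; move: D0; rewrite !(kappaE C hT) ?(ltnW ha) // /phi_scalar -kq_sq.
move: (kq _) (kq _) => w u D0 e.
have /norP[n1 n2] : ~~ ((u - w == 0) || (u + w == 0)).
  by rewrite -mulf_eq0; have -> : (u - w) * (u + w) = u * u - w * w by ring.
have h : (u * u - w * w) ^+ 2 * (1 - (u - w) ^- 2 - (u + w) ^- 2) = 0 by rewrite e mulr0.
apply/eqP/oppr_inj; rewrite oppr0 -[RHS]h; field; by rewrite n1 n2.
Qed.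

Lemma phi_Uhat T a : T \in std -> (a.+1 < n)%N ->
  phi a *: v T = (sq_gap T a
    * Yfun C T a)%:A *: v (tab_act (adj n a) T).
Proof.
move=> hT ha; have D0 := kappa_sq_neq C hla hT ha.
have [_ _ hx hs] := hU.
rewrite (phi_weight_mod (hx T a hT (ltnW ha)) (hx T a.+1 hT ha)).
have := hs T a hT ha; rewrite /s_coef.
move: (kappa C T a) (kappa C T a.+1) D0 (Yfun C T a) (sg a) => u w D0 y s e.
have /norP[n1 n2] : ~~ ((w - u == 0) || (w + u == 0)).
  by rewrite -mulf_eq0 (_ : _ * _ = - (u * u - w * w)) ?oppr_eq0 //; ring.
rewrite -addrA (scalerDl (v T)) -(mulr_algl _ s) -(scalerA _ s) e scalerDr scalerA scalerA.
rewrite addrAC -scalerDl addrC algM -[RHS]addr0; congr (_ + _).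
rewrite -[RHS](scale0r (v T)); congr (_ *: _).
move: (cg a * cg a.+1) => c; rewrite mulr_algl; lin_coefs C; field; by rewrite n1 n2.
Qed.

Lemma phi_Ediag_Uhat T a : T \in std -> (a.+1 < n)%N -> tab_act (adj n a) T \in std ->
  phi a *: (E T *: v T) = (sq_gap T a
    * Yfun C T a)%:A *: (E (tab_act (adj n a) T) *: v (tab_act (adj n a) T)).
Proof.
move=> hT ha hs; rewrite (scalerA (phi a)) phi_Ediag // -(scalerA (E _)) phi_Uhat //.
by rewrite !(scalerA _ _ (v _)) mulr_algr mulr_algl.
Qed.

Lemma Ediag_e_row (z : S) : z * e_row C n la * E R = z * E R * e_row C n la.
Proof.
rewrite -!mulrA; congr (_ * _).
rewrite (EdiagE hla hR); apply: Eprod_intertwine => k hk.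
by rewrite cg_e_row //; lia.
Qed.

Lemma e_row_Uhat : e_row C n la *: v R = v R.
Proof. by apply: (e_elt_left hla hR) => k hk; have [_ _ hx _] := hU; apply: hx. Qed.

Lemma tab_path_Uhat T z : T \in std -> tab_path T z ->
  exists2 k : C, k != 0 & z *: v R = k%:A *: (E T *: v T).
Proof.
move: T z; apply: (tab_path_ind (P := fun T z => exists2 k : C, k != 0 &
  z *: v R = k%:A *: (E T *: v T)) hla).
  exists 1; rewrite ?oner_eq0 // !scale1r /row_vector.
  by rewrite -[e_row _ _ _]mul1r Ediag_e_row mul1r -scalerA e_row_Uhat.
move=> a T z ha hT hs _ [k k0 e].
have D0 := kappa_sq_neq C hla hT ha; have Y0 := Yfun_neq0 hT ha hs.
exists (k * (sq_gap T a * Yfun C T a)).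
  by rewrite !mulf_neq0.
rewrite -scalerA e (scalerA (phi a)) mulr_algr -(mulr_algl k) -(scalerA k%:A).
by rewrite phi_Ediag_Uhat // (scalerA k%:A) algM.
Qed.

(** Freeness of [U] gives [f T * E T = 0] for each tableau, and [Eprod_kill] cancels the
    idempotent. *)
Lemma Uhat_Ediag_indep (f : tableau -> S) :
  (forall T, T \in std -> cl (free_index la T) (f T)) ->
  \sum_(T <- std) f T *: (E T *: v T) = 0 -> forall T, T \in std -> f T = 0.
Proof.
move=> hf e T hT; have gT : f T * E T = 0.
  apply: (@Uhat_indep (fun T' => f T' * E T')) hT => [T' hT'|].
    apply: subalgM; first exact: free_cl (hf T' hT').
    rewrite (EdiagE hla hT'); apply: Eprod_cl => j hj.
    by apply: (dindex_lt hla hT'); lia.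
  by rewrite -[RHS]e; apply: eq_bigr => T' _; rewrite scalerA.
move: gT; rewrite (EdiagE hla hT).
apply: (Eprod_kill _ _ (hf T hT)) => [j hj|j l hj hl|j hj].
- by apply: (dindex_lt hla hT); lia.
- by apply: (dindex_inj hla hT); lia.
exact: free_index_odd.
Qed.

(** [JidealP] supplies coefficients and independence in [U] makes them vanish. From here on, an
    identity in the left ideal is checked on [v R]. *)
Lemma Jideal_inj (u : S) : Jideal la u -> u *: v R = 0 -> u = 0.
Proof.
move/(JidealP hla) => [f hf ->] e; rewrite big_seq big1 // => T hT.
have ex T' : exists k : C, T' \in std -> k != 0 /\
    tab_vector C la T' *: v R = k%:A *: (E T' *: v T').
  case: (boolP (T' \in std)) => hT'; last by exists 0.
  by have [k k0 ek] := tab_path_Uhat hT' (tab_vectorP C hla hT'); exists k.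
pose k T' := projT1 (cid (ex T')).
have hk T' : T' \in std -> k T' != 0 /\
    tab_vector C la T' *: v R = (k T')%:A *: (E T' *: v T').
  by move=> hT'; apply: (projT2 (cid (ex T'))).
have [kT _] := hk T hT.
suff /eqP : k T *: f T = 0.
  by rewrite scaler_eq0 (negbTE kT) /= => /eqP ->; rewrite mul0r.
apply: (@Uhat_Ediag_indep (fun T' => k T' *: f T')) hT => [T' hT'|].
  exact/subalgZ/hf.
rewrite -[RHS]e scaler_suml big_seq [RHS]big_seq; apply: eq_bigr => T' hT'.
by have [_ ek] := hk T' hT'; rewrite -(scalerA (f T')) ek (scalerA (f T')) mulr_algr.
Qed.

Lemma row_vector_neq0 : row_vector C la != 0.
Proof.
apply/eqP => e; have dR : tab_path R (row_vector C la) by apply: desc_path_refl.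
have [k k0] := tab_path_Uhat hR dR; rewrite e scale0r => /esym e0.
pose f (T : tableau) : S := if T == R then k%:A else 0.
have : f R = 0.
  apply: (@Uhat_Ediag_indep f) => // [T _|].
    by rewrite /f; case: eqP => _; [apply: clA | apply: cl0].
  rewrite (bigD1_seq R) ?std_tableaux_uniq //= {1}/f eqxx e0 big1 ?addr0 //.
  by move=> T /negbTE h; rewrite /f h scale0r.
by move/eqP; rewrite /f eqxx alg_eq0 (negbTE k0).
Qed.

(** Holds for every word in range, hence for the one chosen in [phi_perm]. The same scalar occurs
    with and without the idempotent because intertwiners carry the idempotent along. *)
Lemma word_Uhat (s : seq nat) : all (fun a => (a.+1 < n)%N) s ->
  (\prod_(a <- s) phi a) *: v R = 0 \/ exists2 T, T \in std & exists k : C,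
    (\prod_(a <- s) phi a) *: v R = k%:A *: v T /\
    (\prod_(a <- s) phi a) *: (E R *: v R) = k%:A *: (E T *: v T).
Proof.
elim: s => [_|a s IH /= /andP[ha hs]].
  by right; exists R => //; exists 1; rewrite big_nil !scale1r.
rewrite !big_cons; case: (IH hs) => [e|[T hT [k [e1 e2]]]].
  by left; rewrite -scalerA e scaler0.
rewrite -!(scalerA (phi a)) e1 e2 !(scalerA (phi a) k%:A) mulr_algr -(mulr_algl k).
rewrite -!(scalerA k%:A) phi_Uhat //; case: (boolP (tab_act (adj n a) T \in std)) => h.
  right; exists (tab_act (adj n a) T) => //.
  exists (k * (sq_gap T a * Yfun C T a)).
  by rewrite phi_Ediag_Uhat // !(scalerA k%:A) algM.
by left; have [_ hv _ _] := hU; rewrite hv // !scaler0.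
Qed.

(** [word_Uhat] leads to some tableau and some scalar; the hypothesis and the independence of the
    vectors in [U] identify them as [T] and [b]. *)
Lemma zeta_Uhat T (b : C) : T \in std -> b != 0 ->
  phi_perm C (tab_perm n la T) *: v R = b%:A *: v T ->
  zeta C n la T *: v R = b%:A *: (E T *: v T).
Proof.
move=> hT b0; rewrite /zeta Ediag_e_row -scalerA e_row_Uhat -scalerA /phi_perm.
set s := xget _ _; have hs : all (fun a => (a.+1 < n)%N) s.
  by rewrite /s; case: xgetP => [w _ [[]]|].
move=> e; case: (word_Uhat hs) => [e0|[T' hT' [k [e1 e2]]]].
  move: e; rewrite e0 => /esym e1; have /eqP := Uhat_indep1 hT (clA _ _ b) e1.
  by rewrite alg_eq0 (negbTE b0).
have [eT ek] := Uhat_inj hT hT' b0 (etrans (esym e) e1).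
by rewrite e2 -eT -ek.
Qed.

Section NormalizedVectors.
Variable xi : tableau -> S.
Hypotheses (xiJ : forall T, T \in std -> Jideal la (xi T))
  (xi_Uhat : forall T, T \in std -> xi T *: v R = E T *: v T)
  (xi0 : forall T, T \notin std -> xi T = 0).

Lemma xi_tab_vector T : T \in std ->
  exists2 k : C, k != 0 & xi T = k *: tab_vector C la T.
Proof.
move=> hT; have hz := tab_vectorP C hla hT; have [k k0 e] := tab_path_Uhat hT hz.
exists k^-1; first by rewrite invr_eq0.
apply/eqP; rewrite -subr_eq0; apply/eqP/Jideal_inj.
  apply: JidealD; first exact: xiJ.
  by rewrite -scaleNr -mulr_algl; apply/JidealM/tab_vector_J.
rewrite scalerBl xi_Uhat // -mulr_algl -scalerA e scalerA algM mulVf //.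
by rewrite !scale1r subrr.
Qed.

Lemma xg_xi T a : T \in std -> (a < n)%N -> xg a * xi T = kappa C T a *: xi T.
Proof.
move=> hT ha; have [k _ ->] := xi_tab_vector hT.
by rewrite -(scalerAr k (xg a)) xg_tab_vector // !scalerA mulrC.
Qed.

Lemma cg_xi T k : T \in std -> (k < (size la)./2)%N ->
  cg (dindex T k.*2.+1) * xi T = 'i *: (cg (dindex T k.*2) * xi T).
Proof.
move=> hT hk; have [b _ ->] := xi_tab_vector hT.
by rewrite -!(scalerAr b (cg _)) cg_tab_vector // !scalerA mulrC.
Qed.

(** If the swap is standard, both sides lie in the left ideal and agree on [v R]. This fixes the
    coefficient, which the chains of intertwiners determine only up to a nonzero scalar. *)
Lemma phi_xi T a : T \in std -> (a.+1 < n)%N ->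
  phi a * xi T = sq_gap T a
    *: (Yfun C T a *: xi (tab_act (adj n a) T)).
Proof.
move=> hT ha; case: (boolP (tab_act (adj n a) T \in std)) => hs; last first.
  have [k _ ->] := xi_tab_vector hT; rewrite (xi0 hs) !scaler0 -(scalerAr k (phi a)).
  have [l [-> [_ h]]] := phi_tab_vector_ex C hla hT ha.
  by rewrite (h hs) scale0r scaler0.
rewrite scalerA; apply/eqP; rewrite -subr_eq0; apply/eqP/Jideal_inj.
  apply: JidealD; first by apply/JidealM/xiJ.
  by rewrite -scaleNr -mulr_algl; apply/JidealM/xiJ.
rewrite scalerBl -(scalerA (phi a)) xi_Uhat // phi_Ediag_Uhat //.
by rewrite -(mulr_algl _ (xi _)) -(scalerA _ (xi _)) xi_Uhat // subrr.
Qed.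

Lemma sg_xi T a : T \in std -> (a.+1 < n)%N ->
  sg a * xi T = s_coef C n T a * xi T + Yfun C T a *: xi (tab_act (adj n a) T).
Proof.
move=> hT ha; have := phi_xi hT ha; have [k k0 ->] := xi_tab_vector hT.
move: (_ *: xi _) => y e.
have {}e : phi a * tab_vector C la T = sq_gap T a *: (k^-1 *: y).
  apply: (scalerI k0); rewrite (scalerAr k (phi a)) e !scalerA; congr (_ *: _).
  by rewrite [RHS]mulrAC mulfV // mul1r.
rewrite -(scalerAr k (sg a)) (sg_tab_vector hla hT ha e) scalerDr scalerA mulfV //.
by rewrite scale1r -(scalerAr k).
Qed.

Lemma xi_decomposition : free_decomposition std (fun T => clifford_tab T)
  (xi : tableau -> S^o) (Jideal la : set S).
Proof.
have ex T : exists k : C, k != 0 /\ (T \in std -> xi T = k *: tab_vector C la T).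
  case: (boolP (T \in std)) => hT; last by exists 1; rewrite oner_eq0.
  by have [k k0 e] := xi_tab_vector hT; exists k.
pose k T := projT1 (cid (ex T)).
have k0 T : k T != 0 by case: (projT2 (cid (ex T))).
have ek T : T \in std -> xi T = k T *: tab_vector C la T by case: (projT2 (cid (ex T))).
split=> [u|f hf e]; last first.
  apply: Uhat_Ediag_indep => [T hT|]; first by apply/clifford_tabE/hf.
  transitivity ((\sum_(T <- std) f T * xi T) *: v R); last by rewrite [X in X *: _]e scale0r.
  rewrite scaler_suml big_seq [RHS]big_seq; apply: eq_bigr => T hT.
  by rewrite -[RHS]scalerA xi_Uhat.
split=> [/(JidealP hla)[f hf ->]|[f hf ->]].
  exists (fun T => (k T)^-1 *: f T) => [T hT|].
    by apply/(clifford_tabE hla hT)/subalgZ/hf.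
  rewrite big_seq [RHS]big_seq; apply: eq_bigr => T hT.
  rewrite [RHS](_ : _ = ((k T)^-1 *: f T) * xi T) // (ek T hT) -(scalerAl _ (f T)).
  by rewrite -(scalerAr _ (f T)) scalerA mulVf // scale1r.
rewrite big_seq; apply: (big_ind (Jideal la)); first by exists 0; rewrite mul0r.
  exact: JidealD.
by move=> T hT; apply/JidealM/xiJ.
Qed.

End NormalizedVectors.

End ModuleSide.

(** * Simplicity of the left ideal *)

Section FlipInvariants.
Variables (C : numClosedFieldType) (n : nat).
Local Notation S := (sergeev C n).
Implicit Types (x p : S) (a b : nat) (P Q : pred nat).

Lemma flipK P b x : (b < n)%N -> cl P x -> flip b (flip b x) = x.
Proof.
move=> hb; elim=> [y [a Pa ->]||y z _ h1 _ h2|k y _ h|y z _ h1 _ h2].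
- rewrite flip_cg //; case: eqVneq => [->|ab]; last by rewrite flip_cg // (negbTE ab).
  by rewrite -scaleN1r flipZ flip_cg // eqxx scalerN scaleN1r opprK.
- by rewrite !flip1.
- by rewrite !flipD h1 h2.
- by rewrite !flipZ h.
by rewrite !flipM // h1 h2.
Qed.

Lemma flipC P a b x : (a < n)%N -> (b < n)%N -> cl P x ->
  flip a (flip b x) = flip b (flip a x).
Proof.
move=> ha hb; elim=> [y [d Pd ->]||y z _ h1 _ h2|k y _ h|y z _ h1 _ h2].
- have fN (e : nat) (u : S) : flip e (- u) = - flip e u.
    by rewrite -scaleN1r flipZ scaleN1r.
  rewrite !flip_cg //; case eb: (d == b); case ea : (d == a);
    by rewrite ?fN ?flip_cg // ?ea ?eb.
- by rewrite !flip1.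
- by rewrite !flipD h1 h2.
- by rewrite !flipZ h.
by rewrite !flipM // h1 h2.
Qed.

Lemma cl_single Q b x : {subset Q <= pred1 b} -> cl Q x ->
  exists al be : C, x = al%:A + be *: cg b.
Proof.
move=> Qb; elim=> [y [a Qa ->]||y z _ [al [be ->]] _ [al' [be' ->]]|
  k y _ [al [be ->]]|y z _ [al [be ->]] _ [al' [be' ->]]].
- by exists 0, 1; have /eqP -> := Qb a Qa; rewrite scale0r add0r scale1r.
- by exists 1, 0; rewrite scale0r addr0 scale1r.
- by exists (al + al'), (be + be'); rewrite !scalerDl addrACA.
- by exists (k * al), (k * be); rewrite scalerDr !scalerA.
have [s es] : exists s : C, cg b * cg b = s%:A :> S.
  case: (ltnP b n) => hb; last by exists 0; rewrite cg_out // mulr0 scale0r.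
  by exists (-1); rewrite cg_sq // scaleN1r.
exists (al * al' + be * be' * s), (al * be' + be * al').
have -> : (al%:A + be *: cg b) * (al'%:A + be' *: cg b) = (al * al')%:A + (al * be') *: cg b
    + ((be * al') *: cg b + (be * be') *: (cg b * cg b)) :> S.
  rewrite mulrDl mulr_algl scalerDr !scalerA; congr (_ + _).
  rewrite -(scalerAl _ (cg b)) mulrDr mulr_algr -(scalerAr _ (cg b)).
  by rewrite scalerDr !scalerA.
by rewrite es; lin C.
Qed.

(* A nonzero Clifford element is made invariant under one more sign change by
   adding its image, or, if this gives zero, by multiplying by the generator. *)
Lemma flip_invariant (M : S -> Prop) P l p :
  (forall x y, M x -> M y -> M (x + y)) ->
  (forall a x, P a -> M x -> M (cg a * x)) ->
  (forall a x, a \in l -> cl P x -> M x -> M (flip a x)) ->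
  uniq l -> all P l -> all (ltn^~ n) l -> cl P p -> p != 0 -> M p ->
  exists q, [/\ cl P q, q != 0, M q & forall a, a \in l -> flip a q = q].
Proof.
move=> MD Mc; elim: l => [|a l IH] Mf /=; first by exists p.
move=> /andP[al ul] /andP[Pa Pl] /andP[ha hl] hp p0 Mp.
have [|q [hq q0 Mq fq]] := IH _ ul Pl hl hp p0 Mp.
  by move=> b x hb; apply: Mf; rewrite inE hb orbT.
have hn b : b \in l -> (b < n)%N by move=> hb; have /allP := hl; apply.
case: (eqVneq (q + flip a q) 0) => [e|ne].
  have fa : flip a q = - q by apply/eqP; rewrite -addr_eq0 addrC e.
  exists (cg a * q); split.
  - by apply: subalgM => //; apply: cl_cg.
  - apply: contraNneq q0 => e0; have : cg a * (cg a * q) = 0 by rewrite e0 mulr0.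
    by rewrite mulrA cg_sq // mulN1r => /eqP; rewrite oppr_eq0.
  - exact: Mc.
  move=> b; rewrite inE => /predU1P[->|hb].
    by rewrite flipM // flip_cg // eqxx fa mulrNN.
  rewrite flipM ?hn // flip_cg ?hn // fq //; case: eqVneq => // ab.
  by rewrite ab hb in al.
exists (q + flip a q); split=> //.
- by apply: subalgD => //; apply: cl_flip.
- by apply: MD => //; apply: Mf; rewrite ?mem_head.
move=> b; rewrite inE => /predU1P[->|hb].
  by rewrite flipD (flipK ha hq) addrC.
by rewrite flipD (flipC (hn b hb) ha hq) (fq b hb).
Qed.

End FlipInvariants.

Section Simplicity.
Variables (C : numClosedFieldType) (la : seq nat).
Hypothesis hla : strict_partition la.
Local Notation n := (sumn la).
Local Notation S := (sergeev C n).
Local Notation R := (row_tableau la).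
Local Notation std := (std_tableaux la).
Local Notation tv := (tab_vector C la).

Let hR : R \in std := row_tableau_std la.

(** The squared content determines the length of the row that is prolonged, and addable rows have
    distinct lengths; so the two words agree letter by letter. *)
Lemma kappa_sq_inj T T' : T \in std -> T' \in std ->
  (forall a, (a < n)%N -> kappa C T a * kappa C T a = kappa C T' a * kappa C T' a) ->
  T = T'.
Proof.
move=> hT hT' h; apply: (row_word_inj hla hT hT').
set w := row_word T; set w' := row_word T'.
have sw : size w = n := size_row_word hT; have sw' : size w' = n := size_row_word hT'.
suff H k : (k <= n)%N -> take k w = take k w'.
  by rewrite -(take_size w) -(take_size w') sw sw'; apply: H.
elim: k => [|k IH] hk; first by rewrite !take0.
have e := IH (ltnW hk); rewrite !(take_nth 0%N) ?sw ?sw' // e; congr rcons.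
have hw : lattice (take k w').
  have := std_lattice hla hT'; rewrite -/w' -{1}(cat_take_drop k w') lattice_cat.
  by case/andP.
apply: (addable_inj hw).
- rewrite -e; apply: (elimT (latticeP w) (std_lattice hla hT)); by rewrite sw.
- by apply: (elimT (latticeP w') (std_lattice hla hT')); rewrite sw'.
have := h k hk; rewrite (kappaE C hT hk) (kappaE C hT' hk) => /kq_sq_inj.
by rewrite /wcont -/w -/w' e.
Qed.

Lemma homog_row_vector : homog false (row_vector C la).
Proof.
apply: (@homogM _ _ false false); last by rewrite (EdiagE hla hR); apply: homog_Eprod.
apply: homog_even_prod => k _; apply: homogZ; apply: homog_even_prod => q _.
by apply: homogB; [apply: homog_xg | apply/homogZ/homog_1].
Qed.

Lemma homog_tab_vector T : T \in std -> homog false (tv T).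
Proof.
move=> hT; apply: (tab_path_ind (P := fun _ z => homog false z) hla _ _ hT (tab_vectorP C hla hT)).
  exact: homog_row_vector.
by move=> a T' z _ _ _ _ hz; apply: (@homogM _ _ false false) => //; apply: homog_phi.
Qed.

Lemma Jideal_graded : graded_left_ideal (Jideal la : set S).
Proof.
split; [by exists 0; rewrite mul0r | exact: JidealD | move=> y x; exact: JidealM |].
move=> x [y ->]; have [y0 [y1 [h0 h1 ->]]] := homog_split y.
exists (y0 * row_vector C la), (y1 * row_vector C la); split.
- by exists y0.
- by exists y1.
- by apply: (@homogM _ _ false false) => //; apply: homog_row_vector.
- by apply: (@homogM _ _ true false) => //; apply: homog_row_vector.
by rewrite mulrDl.
Qed.

Section Submodule.
Variable N : set S.
Hypothesis hN : graded_left_ideal N.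

Let ND x y : N x -> N y -> N (x + y). Proof. by case: hN => _ h _ _; apply: h. Qed.
Let NM y x : N x -> N (y * x). Proof. by case: hN => _ _ h _; apply: h. Qed.
Let NZ (k : C) x : N x -> N (k *: x). Proof. by rewrite -mulr_algl; apply: NM. Qed.

Lemma submoduleZ_inv (k : C) x : k != 0 -> N (k *: x) -> N x.
Proof. by move=> k0 /(NZ k^-1); rewrite scalerA mulVf // scale1r. Qed.

Lemma submodule_theta x : N x -> N (theta x).
Proof.
case: hN => _ _ _ h /h [x0 [x1 [n0 n1 h0 h1 ->]]].
rewrite thetaD (homog_theta h0) (homog_theta h1) scale1r expr1.
by apply: ND => //; apply: NZ.
Qed.

(* The squares of the Jucys--Murphy elements commute with the Clifford algebra
   and separate the tableaux. *)
Lemma submodule_component (f : tableau -> S) T0 l :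
  (forall T, cl (fun a => (a < n)%N) (f T)) ->
  T0 \in std -> all [in std] l -> T0 \notin l ->
  N (f T0 * tv T0 + \sum_(T <- l) f T * tv T) -> N (f T0 * tv T0).
Proof.
elim: l f => [|T1 l IH] f hf h0 /=; first by rewrite big_nil addr0.
move=> /andP[h1 hl]; rewrite inE negb_or => /andP[n1 nl] hz.
have [a ha ka] : exists2 a, (a < n)%N &
    kappa C T0 a * kappa C T0 a - kappa C T1 a * kappa C T1 a != 0.
  apply: contrapT => H; move/eqP: n1; apply; apply: kappa_sq_inj => // a ha.
  by apply/eqP; rewrite -subr_eq0; apply: contrapT => /negP na; apply: H; exists a.
have xT T : T \in std -> (xg a * xg a - (kappa C T1 a * kappa C T1 a)%:A) * (f T * tv T)
    = ((kappa C T a * kappa C T a - kappa C T1 a * kappa C T1 a) *: f T) * tv T.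
  move=> hT; rewrite mulrBl mulr_algl -(mulrA (xg a)) (mulrA (xg a) (f T)).
  rewrite (xg_cl ha (hf T)) -mulrA (xg_tab_vector C hla hT ha) -(scalerAr _ (flip a _)).
  rewrite -(scalerAr _ (xg a)) (mulrA (xg a)) (xg_cl ha (cl_flip ha (hf T))).
  rewrite (flipK ha (hf T)) -mulrA (xg_tab_vector C hla hT ha) -(scalerAr _ (f T)).
  by rewrite scalerA -scalerBl (scalerAl _ (f T)).
pose g T := (kappa C T a * kappa C T a - kappa C T1 a * kappa C T1 a) *: f T.
have := IH g (fun T => subalgZ _ (hf T)) h0 hl nl.
rewrite -(scalerAl _ (f T0)) => H; apply: (submoduleZ_inv ka); apply: H.
have := NM (xg a * xg a - (kappa C T1 a * kappa C T1 a)%:A) hz.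
rewrite big_cons !mulrDr !xT // subrr scale0r mul0r add0r mulr_sumr -(scalerAl _ (f T0)).
by rewrite big_seq [X in _ -> N (_ + X)]big_seq (eq_bigr _ (fun T hT => xT T (allP hl T hT))).
Qed.

(** At a nonzero content, [xg a] performs the sign change up to this scalar. The excluded index is
    the unpaired last diagonal entry. *)
Lemma submodule_flip T a p : T \in std -> (a < n)%N -> free_index la T a ->
  ~~ (odd (size la) && (a == dindex T (size la).-1)) ->
  cl (free_index la T) p -> N (p * tv T) -> N (flip a p * tv T).
Proof.
move=> hT ha fa na hp hz; case: (eqVneq (kappa C T a) 0) => k0; last first.
  apply: (submoduleZ_inv k0); rewrite (scalerAr _ (flip a p)) -(xg_tab_vector C hla hT ha).
  by rewrite mulrA -(xg_cl ha hp) -mulrA; apply: NM.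
have [k [hk ek]] : exists k, (k < (size la)./2)%N /\ a = dindex T k.*2.
  have ed : is_diag (box_of T a).
    move: k0; rewrite (kappaE C hT ha) => /eqP; rewrite kq_eq0 (wcont_row_word hT) //.
    have := box_of_mem hT ha; rewrite (std_mem hT); case: (box_of T a) => i j /=.
    by rewrite mem_diagram /is_diag /=; lia.
  have : a \in diag_entries T.
    by rewrite mem_filter ed mem_iota add0n /= (std_size hT).
  rewrite (diag_entriesE hla hT) => /mapP[d]; rewrite mem_iota add0n /= => hd ea.
  have od : ~~ odd d.
    apply/negP => od; move: fa; rewrite /free_index ha /= => /negP; apply.
    apply/mapP; exists d./2; first by rewrite mem_iota; lia.
    by rewrite ea; congr dindex; rewrite -[LHS]odd_double_half od.
  exists d./2; have e2 : d = d./2.*2 by rewrite -[LHS]odd_double_half (negbTE od).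
  split; last by rewrite -e2.
  move: na; rewrite ea; case: (boolP (odd (size la))) => os /=; last by lia.
  by case: (eqVneq d (size la).-1) => [->|]; [rewrite eqxx | lia].
(* At content 0 the pair takes over: [cg a'] crosses [p] by parity and becomes ['i] times [cg a] on
   the vector, which produces the conjugation by [cg a] in [flip]. *)
pose a' := dindex T k.*2.+1.
have -> : flip a p * tv T = 'i *: (cg a * (cg a' * (p * tv T))).
  rewrite (mulrA (cg a') p) (cg_cl (free_index_odd T hk) hp) -mulrA.
  rewrite (cg_tab_vector C hla hT hk) -ek -(scalerAr _ (theta p)) -(scalerAr _ (cg a)).
  by rewrite scalerA -expr2 sqrCi scaleN1r !mulrA /flip mulNr.
by apply: NZ; apply: NM; apply: NM.
Qed.

Lemma submodule_tab_vector T p : T \in std -> cl (free_index la T) p -> p != 0 ->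
  N (p * tv T) -> N (tv T).
Proof.
move=> hT hp p0 hz; set b := dindex T (size la).-1.
pose Q a := odd (size la) && (a == b).
pose l := [seq a <- iota 0 n | free_index la T a && ~~ Q a].
have hl a : a \in l -> [/\ (a < n)%N, free_index la T a & ~~ Q a].
  by rewrite mem_filter mem_iota add0n => /andP[/andP[-> ->]].
have ul : uniq l by rewrite filter_uniq // iota_uniq.
have Fl : all (free_index la T) l by apply/allP => a /hl[].
have nl : all (ltn^~ n) l by apply/allP => a /hl[].
have MD x y : N (x * tv T) -> N (y * tv T) -> N ((x + y) * tv T).
  by move=> hx hy; rewrite mulrDl; apply: ND.
have Mc a x : free_index la T a -> N (x * tv T) -> N (cg a * x * tv T).
  by move=> _ hx; rewrite -mulrA; apply: NM.
have Mf a x : a \in l -> cl (free_index la T) x -> N (x * tv T) -> N (flip a x * tv T).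
  by move=> /hl[ha fa na] hx; apply: submodule_flip.
have [q [hq q0 Nq fq]] := flip_invariant MD Mc Mf ul Fl nl hp p0 hz.
have qQ : cl Q q.
  apply: (cl_fixed (P := free_index la T) (l := l)) => //.
    by apply/hasPn => a /hl[].
  move=> a fa; have {}fa : free_index la T a by [].
  have ha : (a < n)%N by case/andP: (fa).
  have e : (a \in l) = ~~ Q a.
    by rewrite mem_filter fa mem_iota add0n ha /= !andbT.
  have : (a \in l) || Q a by rewrite e; case: (Q a).
  by [].
have Qb : {subset Q <= pred1 b} by move=> a /andP[].
have [al [be e]] := cl_single Qb qQ.
(* Parity fixes the scalar part and negates the generator, so a graded submodule contains both parts
   separately. If the scalar part is zero, multiplication by the generator yields a nonzero
   scalar. *)
have et := homog_theta (homog_tab_vector hT).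
have Nt := submodule_theta Nq; move: Nq Nt q0.
rewrite thetaM et expr0 scale1r e thetaD !thetaZ theta1 theta_cg scalerN.
set u := al%:A; set w := be *: cg b => Nq Nt q0.
have Nu : N (u * tv T).
  apply: (@submoduleZ_inv 2); first by rewrite pnatr_eq0.
  by have := ND Nq Nt; rewrite -mulrDl addrACA subrr addr0 -mulr2n -scaler_nat -scalerAl.
have Nw : N (w * tv T).
  have := ND Nq (NZ (-1) Nu); rewrite scaleN1r -mulNr -mulrDl.
  by rewrite addrAC subrr add0r.
case: (eqVneq al 0) => a0; last by apply: (submoduleZ_inv a0); rewrite -mulr_algl.
have b0 : be != 0 by apply: contraNneq q0 => b0; rewrite /u /w a0 b0 !scale0r addr0.
case: (ltnP b n) => hb; last first.
  by move: q0; rewrite /u /w a0 scale0r add0r cg_out // scaler0 eqxx.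
have := NM (cg b) Nw; rewrite /w -(scalerAl _ (cg b)) -(scalerAr _ (cg b)) mulrA cg_sq //.
by rewrite mulN1r scalerN -scaleNr; apply: submoduleZ_inv; rewrite oppr_eq0.
Qed.

Lemma submodule_row_vector T : T \in std -> N (tv T) -> N (row_vector C la).
Proof.
move=> hT; rewrite -tab_vector_row //.
apply: (tab_path_ind (P := fun T _ => N (tv T) -> N (tv R)) hla _ _ hT (tab_vectorP C hla hT)).
  by [].
move=> a T' z ha hT' hs _ IH hz; apply: IH.
have [k [ek [k0 _]]] := phi_tab_vector_ex C hla hs ha.
rewrite (tab_act_adjK hT' ha) in ek k0; apply: (submoduleZ_inv (k0 hT')).
by rewrite -ek; apply: NM.
Qed.

End Submodule.

Lemma Jideal_simple : row_vector C la != 0 -> simple_left_ideal (Jideal la : set S).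
Proof.
move=> v0; split; first exact: Jideal_graded.
  by exists (row_vector C la) => //; exists 1; rewrite mul1r.
move=> N hN NJ; case: (pselect (exists2 z, N z & z != 0)) => [[z Nz z0]|h]; last first.
  by left=> z Nz; apply/eqP; apply: contrapT => /negP z0; apply: h; exists z.
right=> u [y ->]; case: (hN) => _ _ NM _; apply: NM.
have /(JidealP hla)[f hf ez] := NJ z Nz.
have [T hT fT] : exists2 T, T \in std & f T != 0.
  apply: contrapT => h; move/eqP: z0; apply; rewrite ez big_seq big1 // => T hT.
  case: (eqVneq (f T) 0) => [->|n0]; first by rewrite mul0r.
  by case: h; exists T.
apply: (submodule_row_vector hN hT); apply: (submodule_tab_vector hN hT (hf T) fT).
apply: (submodule_component hN (l := rem T std)) => //.
- by move=> T'; apply: free_cl (hf T').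
- by apply/allP => T' /mem_rem.
- by rewrite mem_rem_uniqF // std_tableaux_uniq.
by have := ez; rewrite (big_rem T) //= => <-.
Qed.

End Simplicity.

Theorem corollary3p4 (R : realType) (n : nat) (la : seq nat)
    (U : lmodType (sergeev R[i] n)) (v : tableau -> U) (b : tableau -> R[i])
    (hla : strict_partition la) (hn : sumn la = n)
    (hU : is_Uhat la v)
    (hb : forall T, T \in std_tableaux la -> b T != 0 /\
       phi_perm R[i] (tab_perm n la T) *: v (row_tableau la) =
         (b T)%:A *: v T) :
  let S := sergeev R[i] n in
  let m := (size la)./2 in
  let J := Jideal la : set S in
  (* extended by 0 to nonstandard tableaux *)
  let xi := fun T => if T \in std_tableaux la
                     then (b T)^-1 *: zeta R[i] n la T else 0 : S in
  [/\ simple_left_ideal J,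
      free_decomposition (std_tableaux la) (fun T => clifford_tab T)
        (xi : tableau -> S^o) J,
      forall T a, T \in std_tableaux la -> (a.+1 < n)%N ->
        sg a * xi T =
          (((kappa R[i] T a.+1 - kappa R[i] T a)^-1)%:A
           + (kappa R[i] T a.+1 + kappa R[i] T a)^-1 *: (cg a * cg a.+1)) * xi T
          + Yfun R[i] T a *: xi (tab_act (adj n a) T),
      forall T a, T \in std_tableaux la -> (a < n)%N ->
        xg a * xi T = kappa R[i] T a *: xi T
    & forall T a, T \in std_tableaux la -> (a < m)%N ->
        let d := nth 0%N (diag_entries T) in
        cg (d a.*2.+1) * xi T = 'i *: (cg (d a.*2) * xi T)].
Proof.
move=> S m J xi; subst n.
have Uz T (hT : T \in std_tableaux la) := zeta_Uhat hla hU hT (hb T hT).1 (hb T hT).2.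
have xiJ T : T \in std_tableaux la -> Jideal la (xi T).
  move=> hT; rewrite /xi hT -mulr_algl /zeta -mulrA; apply/JidealM.
  by exists (phi_perm R[i] (tab_perm (sumn la) la T)).
have xi_Uhat T : T \in std_tableaux la ->
    xi T *: v (row_tableau la) = Ediag R[i] (sumn la) T *: v T.
  move=> hT; rewrite /xi hT -mulr_algl -scalerA Uz // scalerA algM mulVf ?(hb T hT).1 //.
  by rewrite !scale1r.
have xi0 T : T \notin std_tableaux la -> xi T = 0 by rewrite /xi => /negbTE ->.
split.
- exact: (Jideal_simple hla (row_vector_neq0 hla hU)).
- exact: (xi_decomposition hla hU xiJ xi_Uhat).
- by move=> T a hT ha; apply: (sg_xi hla hU xiJ xi_Uhat xi0).
- by move=> T a hT ha; apply: (xg_xi hla hU xiJ xi_Uhat).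
move=> T a hT ha d; rewrite /d !(nth_diag_entries hla hT); try lia.
exact: (cg_xi hla hU xiJ xi_Uhat).
Qed.
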